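(* Let $G$ be a free pronilpotent group of infinite rank. Then for every ordinal $\alpha$, the group $G_\alpha$ (the profinite completion of $G$ of order $\alpha$) is a free pronilpotent group.
   Context: A pronilpotent group is an inverse limit of finite nilpotent groups. For an infinite cardinal $\mathbf{m}$, the free pronilpotent group of rank $\mathbf{m}$ is the free pronilpotent group on a set $X$ converging to $1$ with $|X|=\mathbf{m}$: it is a pronilpotent group $F$ with a continuous pointed map $i:X\cup\{\ast\}\to F$ from the one-point compactification of the discrete space $X$ (with $\ast\mapsto 1$), such that every continuous pointed map $f:X\cup\{\ast\}\to H$ to a pronilpotent group $H$ (with $\ast\mapsto 1$) factors as $f=\bar f\circ i$ for a unique continuous homomorphism $\bar f:F\to H$. For an abstract group $\Gamma$, $\widehat{\Gamma}$ denotes its profinite completion, i.e. the inverse limit of all its finite quotients, with canonical homomorphism $\Gamma\to\widehat\Gamma$. A profinite group is called strongly complete if it equals its profinite completion (as an abstract group), equivalently if every subgroup of finite index is open. A free pronilpotent group of infinite rank is not strongly complete. Completions of higher order: for a nonstrongly complete profinite group $G$, define groups $G_\alpha$ and compatible homomorphisms $\varphi_{\gamma\beta}:G_\gamma\to G_\beta$ ($\gamma<\beta$) by transfinite recursion: $G_0=G$; if $\alpha=\beta+1$ then $G_\alpha=\widehat{G_\beta}$ (completion of $G_\beta$ as an abstract group), with $\varphi_{\beta\alpha}$ the canonical map and the other maps obtained by composition; if $\alpha$ is a limit ordinal then $G_\alpha=\widehat{H_\alpha}$, where $H_\alpha=\varinjlim_{\beta<\alpha}\{G_\beta,\varphi_{\gamma\beta}\}$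 is the direct limit of abstract groups, and $\varphi_{\beta\alpha}$ is the composition $G_\beta\to H_\alpha\to\widehat{H_\alpha}$. *)

(* Defs.v *)
(* MathComp / MathComp-Analysis. *)
From HB Require Import structures.
From mathcomp Require Import all_boot all_order all_fingroup all_solvable.
From mathcomp Require Import all_classical topology wochoice.

Set Implicit Arguments.
Unset Strict Implicit.
Unset Printing Implicit Defensive.

Import Order.TTheory.

Local Open Scope classical_set_scope.
Local Open Scope group_scope.

HB.structure Definition PreTopologicalGroup := {G of Topological G & monoid.Group G}.

HB.mixin Record isTopologicalGroup G of PreTopologicalGroup G := {
  mulg_continuous : continuous (fun xy : G * G => xy.1 * xy.2 : G);
  invg_continuous : continuous (fun x : G => x^-1)
}.

#[short(type="topGroupType")]
HB.structure Definition TopologicalGroup :=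
  {G of isTopologicalGroup G & PreTopologicalGroup G}.

Definition group_iso (G H : groupType) (f : G -> H) : Prop :=
  monoid_morphism f /\ bijective f.

Definition topgroup_iso (G H : topGroupType) (f : G -> H) : Prop :=
  [/\ monoid_morphism f, continuous f &
      exists g : H -> G, [/\ cancel f g, cancel g f & continuous g]].

Definition directed_order (I : Type) (le : I -> I -> Prop) : Prop :=
  [set: I] !=set0 /\
  [/\ forall i, le i i,
      forall i j k, le i j -> le j k -> le i k,
      forall i j, le i j -> le j i -> i = j &
      forall i j, exists k, le i k /\ le j k].

(* The transition maps are given for all pairs of indices; only those between
   comparable indices are meaningful. *)
Record inverse_system := InverseSystem {
  inv_index : Type;
  inv_le : inv_index -> inv_index -> Prop;
  inv_directed : directed_order inv_le;
  inv_obj :> inv_index -> groupType;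
  inv_map : forall i j, inv_obj j -> inv_obj i;
  inv_mapM : forall i j, inv_le i j -> monoid_morphism (@inv_map i j);
  inv_map_id : forall i (x : inv_obj i), inv_map i x = x;
  inv_map_comp : forall i j k (x : inv_obj k), inv_le i j -> inv_le j k ->
    inv_map i (inv_map j x) = inv_map i x
}.

Section InverseLimit.
Variable S : inverse_system.

Definition threads :
    set (prod_topology (fun i : inv_index S => discrete_topology (S i))) :=
  [set x | forall i j, inv_le i j -> inv_map i (x j) = x i].

Definition inverse_limit : Type := set_type threads.

HB.instance Definition _ := Topological.copy inverse_limit (set_type threads).

Definition thread (x : inverse_limit) (i : inv_index S) : S i := set_val x i.

Lemma threadP (x : inverse_limit) i j :
  inv_le i j -> inv_map i (thread x j) = thread x i.
Proof. by case: x => x xP; apply: (set_mem xP). Qed.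

Lemma thread_inj (x y : inverse_limit) : (forall i, thread x i = thread y i) -> x = y.
Proof.
by case: x y => [x xP] [y yP] exy; apply/val_inj/functional_extensionality_dep.
Qed.

Definition mk_thread (x : forall i, S i)
    (xP : forall i j, inv_le i j -> inv_map i (x j) = x i) : inverse_limit :=
  exist _ (x : prod_topology (fun i => discrete_topology (S i))) (mem_set xP).

Lemma thread1_subproof i j : inv_le i j -> inv_map i (1 : S j) = 1.
Proof. by move=> /inv_mapM[]. Qed.

Lemma threadM_subproof (x y : inverse_limit) i j : inv_le i j ->
  inv_map i (thread x j * thread y j) = thread x i * thread y i.
Proof. by move=> leij; rewrite (inv_mapM leij).2 !threadP. Qed.

Lemma threadV_subproof (x : inverse_limit) i j : inv_le i j ->
  inv_map i (thread x j)^-1 = (thread x i)^-1.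
Proof.
move=> leij; have [m1 mM] := inv_mapM leij; apply: (mulIg (thread x i)).
by rewrite mulVg -[X in _ * X](threadP x leij) -mM mulVg m1.
Qed.

Definition limg_one : inverse_limit := mk_thread thread1_subproof.
Definition limg_mul (x y : inverse_limit) : inverse_limit :=
  mk_thread (threadM_subproof x y).
Definition limg_inv (x : inverse_limit) : inverse_limit :=
  mk_thread (threadV_subproof x).

Lemma limg_mulA : associative limg_mul.
Proof. by move=> x y z; apply: thread_inj => i; apply: mulgA. Qed.
Lemma limg_mul1 : left_id limg_one limg_mul.
Proof. by move=> x; apply: thread_inj => i; apply: mul1g. Qed.
Lemma limg_mulr1 : right_id limg_one limg_mul.
Proof. by move=> x; apply: thread_inj => i; apply: mulg1. Qed.
Lemma limg_mulV : left_inverse limg_one limg_inv limg_mul.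
Proof. by move=> x; apply: thread_inj => i; apply: mulVg. Qed.
Lemma limg_mulrV : right_inverse limg_one limg_inv limg_mul.
Proof. by move=> x; apply: thread_inj => i; apply: mulgV. Qed.

HB.instance Definition _ := isGroup.Build inverse_limit
  limg_mulA limg_mul1 limg_mulr1 limg_mulV limg_mulrV.

Lemma thread_continuous i :
  continuous (fun x : inverse_limit => thread x i : discrete_topology (S i)).
Proof.
move=> x.
apply: (@continuous_comp _ (prod_topology (fun i => discrete_topology (S i))) _
  set_val (fun f => f i)); first exact: initial_continuous.
exact: (@proj_continuous {classic inv_index S}
  (fun i => discrete_topology (S i))).
Qed.

Lemma inverse_limit_continuous (T : topologicalType) (f : T -> inverse_limit) :
  (forall i, continuous (fun x => thread (f x) i : discrete_topology (S i))) ->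
  continuous f.
Proof.
move=> fc; apply: continuous_comp_initial => x.
apply/cvg_sup => i; apply: continuous_comp_initial.
exact: fc.
Qed.

Lemma near_thread i (x : inverse_limit) :
  \forall y \near x, thread y i = thread x i.
Proof.
have := discrete_set1 (thread x i : discrete_topology (S i)).
exact: thread_continuous.
Qed.

Lemma limg_mul_continuous :
  continuous (fun xy : inverse_limit * inverse_limit => xy.1 * xy.2).
Proof.
apply: inverse_limit_continuous => i [x y] U /principal_filterP Uxy.
exists ([set x' | thread x' i = thread x i], [set y' | thread y' i = thread y i]).
  by split; apply: near_thread.
move=> [x' y'] [/= ex ey].
by change (U (thread x' i * thread y' i)); rewrite ex ey.
Qed.

Lemma limg_inv_continuous : continuous (fun x : inverse_limit => x^-1).
Proof.
apply: inverse_limit_continuous => i x U /principal_filterP Ux.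
apply: filterS (near_thread i x) => y /= ey.
by change (U (thread y i)^-1); rewrite ey.
Qed.

HB.instance Definition _ :=
  isTopologicalGroup.Build inverse_limit limg_mul_continuous limg_inv_continuous.
End InverseLimit.

Definition finite_nilpotent (K : groupType) : Prop :=
  exists (N : finGroupType) (f : K -> N),
    group_iso f /\ nilpotent [set: N]%G.

Definition pronilpotent (G : topGroupType) : Prop :=
  exists S : inverse_system, (forall i, finite_nilpotent (S i)) /\
    exists f : G -> inverse_limit S, topgroup_iso f.

Definition free_pronilpotent_on (X : choiceType) (F : topGroupType)
    (i : one_point_compactification (discrete_topology X) -> F) : Prop :=
  [/\ pronilpotent F, continuous i, i None = 1 &
   forall (H : topGroupType)
     (f : one_point_compactification (discrete_topology X) -> H),
     pronilpotent H -> continuous f -> f None = 1 ->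
     exists! fbar : F -> H,
       [/\ monoid_morphism fbar, continuous fbar & f = fbar \o i]].

(* The rank, i.e. the cardinality of the basis X, is infinite. *)
Definition free_pronilpotent (G : topGroupType) : Prop :=
  exists (X : choiceType)
    (i : one_point_compactification (discrete_topology X) -> G),
    infinite_set [set: X] /\ free_pronilpotent_on i.

Record normal_subgroup (G : groupType) := NormalSubgroup {
  ns_set :> G -> Prop;
  ns1 : ns_set 1;
  nsM : forall x y, ns_set x -> ns_set y -> ns_set (x * y);
  nsV : forall x, ns_set x -> ns_set x^-1;
  nsJ : forall x y, ns_set x -> ns_set (x ^ y)
}.

Section QuotientGroup.
Variables (G : groupType) (N : normal_subgroup G).
Implicit Types x y : G.

Definition ns_rel : rel G := fun x y => `[< N (x^-1 * y) >].

Lemma ns_rel_equiv : equiv_class_of ns_rel.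
Proof.
split=> [x|x y|y x z]; rewrite /ns_rel.
- by apply/asboolP; rewrite mulVg; apply: ns1.
- apply/asboolP/asboolP => /nsV; rewrite invgM invgK; exact.
- move=> /asboolP h1 /asboolP h2; apply/asboolP.
  by have := nsM h1 h2; rewrite mulgA mulgK.
Qed.

Canonical ns_equiv := EquivRelPack ns_rel_equiv.

Definition quotient_group : Type := {eq_quot ns_equiv}%qT.

HB.instance Definition _ := Choice.on quotient_group.

Definition quotient_proj (x : G) : quotient_group := (\pi x)%qT.
Definition quotient_repr (u : quotient_group) : G :=
  generic_quotient.repr (u : {eq_quot ns_equiv}%qT).

Lemma quotient_reprK : cancel quotient_repr quotient_proj.
Proof. exact: generic_quotient.reprK. Qed.

Lemma quotient_projP x y : quotient_proj x = quotient_proj y <-> N (x^-1 * y).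
Proof.
split=> [/eqP|h]; last apply/eqP.
  by rewrite /quotient_proj eqmodE => /asboolP.
by rewrite /quotient_proj eqmodE; apply/asboolP.
Qed.

Lemma quotient_repr_projP x : N (x^-1 * quotient_repr (quotient_proj x)).
Proof. by apply/quotient_projP; rewrite quotient_reprK. Qed.

Definition quotient_mul (u v : quotient_group) : quotient_group :=
  quotient_proj (quotient_repr u * quotient_repr v).
Definition quotient_inv (u : quotient_group) : quotient_group :=
  quotient_proj (quotient_repr u)^-1.

Lemma quotient_projM x y :
  quotient_mul (quotient_proj x) (quotient_proj y) = quotient_proj (x * y).
Proof.
apply/esym/quotient_projP.
set a := quotient_repr _; set b := quotient_repr _.
have ha : N (x^-1 * a) by apply: quotient_repr_projP.
have hb : N (y^-1 * b) by apply: quotient_repr_projP.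
have := nsM (nsJ y ha) hb.
by rewrite /conjg invgM !mulgA mulgK.
Qed.

Lemma quotient_projV x : quotient_inv (quotient_proj x) = quotient_proj x^-1.
Proof.
apply/esym/quotient_projP; set a := quotient_repr _.
have ha : N (x^-1 * a) by apply: quotient_repr_projP.
have := nsJ x^-1 (nsV ha).
by rewrite /conjg !invgM !invgK !mulgA mulgK.
Qed.

Lemma quotient_mulA : associative quotient_mul.
Proof.
move=> u v w; rewrite -(quotient_reprK u) -(quotient_reprK v) -(quotient_reprK w).
by rewrite !quotient_projM mulgA.
Qed.
Lemma quotient_mul1 : left_id (quotient_proj 1) quotient_mul.
Proof. by move=> u; rewrite -(quotient_reprK u) quotient_projM mul1g. Qed.
Lemma quotient_mulr1 : right_id (quotient_proj 1) quotient_mul.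
Proof. by move=> u; rewrite -(quotient_reprK u) quotient_projM mulg1. Qed.
Lemma quotient_mulV : left_inverse (quotient_proj 1) quotient_inv quotient_mul.
Proof.
by move=> u; rewrite -(quotient_reprK u) quotient_projV quotient_projM mulVg.
Qed.
Lemma quotient_mulrV : right_inverse (quotient_proj 1) quotient_inv quotient_mul.
Proof.
by move=> u; rewrite -(quotient_reprK u) quotient_projV quotient_projM mulgV.
Qed.

HB.instance Definition _ := isGroup.Build quotient_group
  quotient_mulA quotient_mul1 quotient_mulr1 quotient_mulV quotient_mulrV.

Lemma quotient_proj_morphism : monoid_morphism quotient_proj.
Proof. by split=> // x y; rewrite -quotient_projM. Qed.

End QuotientGroup.

Section ProfiniteCompletion.
Variable G : groupType.

Definition finite_index_normal : Type :=
  {N : normal_subgroup G | finite_set [set: quotient_group N]}.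

(* N comes before M when M is contained in N, so that G / M projects to G / N *)
Definition fin_le (N M : finite_index_normal) : Prop := 
  forall x, sval M x -> sval N x.

Definition normal_subgroupI (N M : normal_subgroup G) : normal_subgroup G.
Proof.
exists (fun x => N x /\ M x).
- by split; apply: ns1.
- by move=> x y [? ?] [? ?]; split; apply: nsM.
- by move=> x [? ?]; split; apply: nsV.
- by move=> x y [? ?]; split; apply: nsJ.
Defined.

Definition normal_subgroupT : normal_subgroup G.
Proof. by exists (fun=> True). Defined.

Lemma normal_subgroup_eq (N M : normal_subgroup G) :
  (forall x, N x <-> M x) -> N = M.
Proof.
case: N M => [N N1 NM NV NJ] [M M1 MM MV MJ] /= /predeqP eNM; subst M.
by rewrite (Prop_irrelevance N1 M1) (Prop_irrelevance NM MM)
  (Prop_irrelevance NV MV) (Prop_irrelevance NJ MJ).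
Qed.

Lemma fin_le_directed : directed_order fin_le.
Proof.
split.
  suff NTf : finite_set [set: quotient_group normal_subgroupT].
    by exists (exist _ normal_subgroupT NTf).
  apply: (@sub_finite_set _ _ [set quotient_proj normal_subgroupT 1]).
    move=> u _; rewrite -(quotient_reprK u); apply/quotient_projP.
    exact: I.
  exact: finite_set1.
split.
- by move=> N x.
- by move=> N M K NM MK x Kx; apply/NM/MK.
- move=> [N Nf] [M Mf] NM MN; apply/eq_exist/normal_subgroup_eq => x.
  by split; [apply: MN | apply: NM].
- move=> [N Nf] [M Mf].
  have NMf : finite_set [set: quotient_group (normal_subgroupI N M)].
    pose f (u : quotient_group (normal_subgroupI N M)) :=
      (quotient_proj N (quotient_repr u), quotient_proj M (quotient_repr u)).
    rewrite -(preimage_setT f); apply: finite_preimage; last first.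
      by rewrite -setXTT; apply: finite_setX.
    move=> u v _ _ [/quotient_projP hN /quotient_projP hM].
    rewrite -(quotient_reprK u) -(quotient_reprK v).
    by apply/quotient_projP.
  exists (exist _ (normal_subgroupI N M) NMf).
  by split=> x [].
Qed.

Definition finite_quotient (N : finite_index_normal) : groupType :=
  quotient_group (sval N).

Definition finite_quotient_map (N M : finite_index_normal)
    (u : finite_quotient M) : finite_quotient N :=
  quotient_proj (sval N) (quotient_repr u).

Lemma finite_quotient_map_proj (N M : finite_index_normal) x :
  fin_le N M ->
  finite_quotient_map N (quotient_proj (sval M) x) = quotient_proj (sval N) x.
Proof.
move=> NM; apply/esym/quotient_projP; apply: NM; apply/quotient_projP.
by rewrite quotient_reprK.
Qed.

Lemma finite_quotient_mapM (N M : finite_index_normal) :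
  fin_le N M -> monoid_morphism (@finite_quotient_map N M).
Proof.
move=> NM; split=> [|u v].
  exact: finite_quotient_map_proj.
rewrite -(quotient_reprK u) -(quotient_reprK v).
rewrite -(quotient_proj_morphism (sval M)).2 !finite_quotient_map_proj //.
by rewrite (quotient_proj_morphism (sval N)).2.
Qed.

Lemma finite_quotient_map_id (N : finite_index_normal) (u : finite_quotient N) :
  finite_quotient_map N u = u.
Proof. exact: quotient_reprK. Qed.

Lemma finite_quotient_map_comp (N M K : finite_index_normal)
    (u : finite_quotient K) : fin_le N M -> fin_le M K ->
  finite_quotient_map N (finite_quotient_map M u) = finite_quotient_map N u.
Proof.
move=> NM MK; rewrite -(quotient_reprK u).
by rewrite !finite_quotient_map_proj // => x Kx; apply/NM/MK.
Qed.

Definition finite_quotients : inverse_system :=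
  InverseSystem fin_le_directed finite_quotient_mapM finite_quotient_map_id
    finite_quotient_map_comp.

Definition profinite_completion : topGroupType :=
  inverse_limit finite_quotients.

Definition to_completion (x : G) : profinite_completion :=
  @mk_thread finite_quotients (fun N => quotient_proj (sval N) x)
    (fun N M NM => finite_quotient_map_proj x NM).

Lemma to_completion_morphism : monoid_morphism to_completion.
Proof.
split=> [|x y]; first exact: thread_inj.
by apply: thread_inj => N; apply: (quotient_proj_morphism (sval N)).2.
Qed.

End ProfiniteCompletion.

Record direct_system := DirectSystem {
  dir_index : choiceType;
  dir_le : dir_index -> dir_index -> Prop;
  dir_directed : directed_order dir_le;
  dir_obj :> dir_index -> groupType;
  dir_map : forall i j, dir_obj i -> dir_obj j;
  dir_mapM : forall i j, dir_le i j -> monoid_morphism (@dir_map i j);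
  dir_map_id : forall i (x : dir_obj i), dir_map i x = x;
  dir_map_comp : forall i j k (x : dir_obj i), dir_le i j -> dir_le j k ->
    dir_map k (dir_map j x) = dir_map k x
}.

Section DirectLimit.
Variable S : direct_system.
Local Notation I := (dir_index S).
Local Notation E := {i : I & S i}.

Definition dirlim_rel : rel E := fun u v =>
  `[< exists k, [/\ dir_le (tag u) k, dir_le (tag v) k &
        dir_map k (tagged u) = dir_map k (tagged v)] >].

Let refl_ := let: conj _ (And4 r _ _ _) := dir_directed S in r.
Let trans_ := let: conj _ (And4 _ t _ _) := dir_directed S in t.
Let dir_ := let: conj _ (And4 _ _ _ h) := dir_directed S in h.

Lemma dirlim_rel_equiv : equiv_class_of dirlim_rel.
Proof.
split=> [u|u v|v u w].
- by apply/asboolP; exists (tag u); split=> //; apply: refl_.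
- by apply/asboolP/asboolP => -[k [? ? ?]]; exists k.
- move=> /asboolP[k [uk vk e]] /asboolP[l [vl wl e']]; apply/asboolP.
  have [m [km lm]] := dir_ k l; exists m.
  split; [exact: trans_ km|exact: trans_ lm|].
  rewrite -(dir_map_comp _ uk km) e (dir_map_comp _ vk km).
  by rewrite -(dir_map_comp _ vl lm) e' (dir_map_comp _ wl lm).
Qed.

Canonical dirlim_equiv := EquivRelPack dirlim_rel_equiv.

Definition direct_limit : Type := {eq_quot dirlim_equiv}%qT.

HB.instance Definition _ := Choice.on direct_limit.

Definition to_dirlim (i : I) (x : S i) : direct_limit :=
  (\pi_({eq_quot dirlim_equiv}) (Tagged (fun i => S i) x))%qT.

Lemma to_dirlimP i j (x : S i) (y : S j) :
  to_dirlim x = to_dirlim y <->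
  exists k, [/\ dir_le i k, dir_le j k & dir_map k x = dir_map k y].
Proof.
split=> [/eqP|h]; last apply/eqP.
  by rewrite /to_dirlim eqmodE => /asboolP.
by rewrite /to_dirlim eqmodE; apply/asboolP.
Qed.

Lemma to_dirlim_map i j (x : S i) : dir_le i j ->
  to_dirlim (dir_map j x) = to_dirlim x.
Proof.
move=> ij; apply/to_dirlimP; exists j.
by split; [exact: refl_ | exact: ij | exact: dir_map_id].
Qed.

Lemma dirlim_surj (u : direct_limit) : {v : E | u = to_dirlim (tagged v)}.
Proof.
exists (generic_quotient.repr (u : {eq_quot dirlim_equiv}%qT)).
by rewrite /to_dirlim; case: (generic_quotient.repr _) (generic_quotient.reprK u).
Qed.

Lemma dirlim_surj2 (u v : direct_limit) :
  {k : I & {x : S k & {y : S k | u = to_dirlim x /\ v = to_dirlim y}}}.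
Proof.
have [[i x] /= ->] := dirlim_surj u; have [[j y] /= ->] := dirlim_surj v.
have [k [ik jk]] := cid (dir_ i j).
exists k, (dir_map k x), (dir_map k y).
by rewrite !to_dirlim_map.
Qed.

Definition dirlim_one : direct_limit :=
  to_dirlim (1 : S (projT1 (cid (dir_directed S).1))).

Definition dirlim_mul (u v : direct_limit) : direct_limit :=
  let: existT _ (existT x (exist y _)) := dirlim_surj2 u v in
  to_dirlim (x * y).

Definition dirlim_inv (u : direct_limit) : direct_limit :=
  let: exist v _ := dirlim_surj u in to_dirlim (tagged v)^-1.

Lemma to_dirlim1 i : to_dirlim (1 : S i) = dirlim_one.
Proof.
rewrite /dirlim_one; case: (cid _) => j /= _.
have [k [ik jk]] := dir_ i j; apply/to_dirlimP; exists k; split=> //.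
by rewrite (dir_mapM ik).1 (dir_mapM jk).1.
Qed.

Lemma to_dirlimM i (x y : S i) :
  dirlim_mul (to_dirlim x) (to_dirlim y) = to_dirlim (x * y).
Proof.
rewrite /dirlim_mul; case: (dirlim_surj2 _ _) => j [x' [y' []]].
move=> /to_dirlimP[k [ik jk ex]] /to_dirlimP[l [il jl ey]].
have [m [km lm]] := dir_ k l; apply/to_dirlimP; exists m.
have im := trans_ ik km; have jm := trans_ jk km.
split=> //; rewrite (dir_mapM im).2 (dir_mapM jm).2.
rewrite -(dir_map_comp x ik km) ex (dir_map_comp x' jk km).
by rewrite -(dir_map_comp y il lm) ey (dir_map_comp y' jl lm).
Qed.

Lemma to_dirlimV i (x : S i) : dirlim_inv (to_dirlim x) = to_dirlim x^-1.
Proof.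
rewrite /dirlim_inv; case: (dirlim_surj _) => -[j x'] /=.
move=> /to_dirlimP[k [ik jk ex]]; apply/to_dirlimP; exists k; split=> //.
have [i1 iM] := dir_mapM ik; have [j1 jM] := dir_mapM jk.
by apply: (mulIg (dir_map k x)); rewrite -iM mulVg i1 ex -jM mulVg j1.
Qed.

Lemma dirlim_surj3 (u v w : direct_limit) : exists k (x y z : S k),
  [/\ u = to_dirlim x, v = to_dirlim y & w = to_dirlim z].
Proof.
have [i [x [y [-> ->]]]] := dirlim_surj2 u v.
have [[j z] /= ->] := dirlim_surj w.
have [k [ik jk]] := dir_ i j.
exists k, (dir_map k x), (dir_map k y), (dir_map k z).
by rewrite !to_dirlim_map.
Qed.

Lemma dirlim_mulA : associative dirlim_mul.
Proof.
move=> u v w; have [k [x [y [z [-> -> ->]]]]] := dirlim_surj3 u v w.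
by rewrite !to_dirlimM mulgA.
Qed.
Lemma dirlim_mul1 : left_id dirlim_one dirlim_mul.
Proof.
move=> u; have [[i x] /= ->] := dirlim_surj u.
by rewrite -(to_dirlim1 i) to_dirlimM mul1g.
Qed.
Lemma dirlim_mulr1 : right_id dirlim_one dirlim_mul.
Proof.
move=> u; have [[i x] /= ->] := dirlim_surj u.
by rewrite -(to_dirlim1 i) to_dirlimM mulg1.
Qed.
Lemma dirlim_mulV : left_inverse dirlim_one dirlim_inv dirlim_mul.
Proof.
move=> u; have [[i x] /= ->] := dirlim_surj u.
by rewrite to_dirlimV to_dirlimM mulVg to_dirlim1.
Qed.
Lemma dirlim_mulrV : right_inverse dirlim_one dirlim_inv dirlim_mul.
Proof.
move=> u; have [[i x] /= ->] := dirlim_surj u.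
by rewrite to_dirlimV to_dirlimM mulgV to_dirlim1.
Qed.

HB.instance Definition _ := isGroup.Build direct_limit
  dirlim_mulA dirlim_mul1 dirlim_mulr1 dirlim_mulV dirlim_mulrV.

Lemma to_dirlim_morphism i : monoid_morphism (@to_dirlim i).
Proof. by split=> [|x y]; [exact: to_dirlim1 | rewrite -to_dirlimM]. Qed.

End DirectLimit.

(* Ordinals are presented as elements of a well-ordered type W: an element a
   stands for the order type of the initial segment of W strictly below a, and
   every ordinal arises in this way, as the greatest element of its successor. *)
Section Ordinals.
Variables (d : Order.disp_t) (W : orderType d).
Implicit Types a b c : W.

Definition ord_zero a : Prop := forall b, (a <= b)%O.

Definition ord_succ b a : Prop :=
  (b < a)%O /\ forall c, (c < a)%O -> (c <= b)%O.

Definition ord_limit a : Prop :=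
  (exists b, (b < a)%O) /\
  forall b, (b < a)%O -> exists c, (b < c)%O /\ (c < a)%O.

Definition below a : choiceType := {b : W | (b < a)%O}.

Definition below_le a (b c : below a) : Prop := (val b <= val c)%O.

Lemma below_directed a : ord_limit a -> directed_order (@below_le a).
Proof.
move=> [[b ba] _]; split; first by exists (exist _ b ba).
split; rewrite /below_le.
- by move=> c; apply: lexx.
- by move=> x y z; apply: le_trans.
- move=> x y xy yx; apply/val_inj/le_anti.
  by rewrite xy yx.
- move=> x y; have [xy|/ltW yx] := leP (val x) (val y).
    by exists y; rewrite lexx.
  by exists x; rewrite lexx.
Qed.

End Ordinals.

(* As for inverse_system, tow_map is meaningful for b <= c only. *)
Record group_tower d (W : orderType d) := GroupTower {
  tow_obj :> W -> topGroupType;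
  tow_map : forall b c, tow_obj b -> tow_obj c;
  tow_mapM : forall b c, (b <= c)%O -> monoid_morphism (@tow_map b c);
  tow_map_id : forall b (x : tow_obj b), tow_map b x = x;
  tow_map_comp : forall a b c (x : tow_obj a), (a <= b)%O -> (b <= c)%O ->
    tow_map c (tow_map b x) = tow_map c x
}.

Definition tower_below d (W : orderType d) (T : group_tower W) (a : W)
    (la : ord_limit a) : direct_system :=
  @DirectSystem (below a) (@below_le d W a) (below_directed la)
    (fun b => T (val b)) (fun b c => @tow_map d W T (val b) (val c))
    (fun b c => @tow_mapM d W T (val b) (val c))
    (fun b => @tow_map_id d W T (val b))
    (fun b c e => @tow_map_comp d W T (val b) (val c) (val e)).

(* The tower of completions of higher order of G, indexed by W. The groups at
   the various levels are determined by the recursion up to isomorphisms of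
   topological groups compatible with the transition maps; for a well-order,
   completion_tower_exists below carries out the recursion. *)
Record completion_tower (G : topGroupType) d (W : orderType d) :=
  CompletionTower {
  comp_tower :> group_tower W;
  comp_zero : forall a : W, ord_zero a ->
    exists e : G -> comp_tower a, topgroup_iso e;
  comp_succ : forall b a : W, ord_succ b a ->
    exists e : profinite_completion (comp_tower b) -> comp_tower a,
      topgroup_iso e /\
      forall x, e (to_completion x) = tow_map a x;
  comp_limit : forall (a : W) (la : ord_limit a),
    exists e : profinite_completion (direct_limit (tower_below comp_tower la)) ->
               comp_tower a,
      topgroup_iso e /\
      forall (b : below a) (x : tower_below comp_tower la b),
        e (to_completion (to_dirlim x)) =
        @tow_map d W comp_tower (val b) a x
}.

Lemma well_order_wf d (W : orderType d) :
  well_order (<=%O : rel W) -> well_founded (fun b a : W => (b < a)%O).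
Proof.
move=> wo; apply: contrapT => /existsNP[x nx].
pose A : pred W := fun z => `[< ~ Acc (fun b a : W => (b < a)%O) z >].
have neA : nonempty A by exists x; apply/asboolP.
have [m [[/asboolP mA mmin] _]] := wo A neA.
apply: mA; constructor => b bm; apply: contrapT => nb.
have /mmin : b \in A by apply/asboolP.
by rewrite leNgt bm.
Qed.

Definition castg (A B : groupType) (x : A) : B :=
  match pselect (A = B) with
  | left e => eq_rect A (fun C : groupType => C) x B e
  | right _ => 1
  end.

Lemma castg_id (A : groupType) (x : A) : castg A x = x.
Proof.
by rewrite /castg; case: pselect => // e; rewrite (Prop_irrelevance e erefl).
Qed.

Section TowerConstruction.
Variables (G : topGroupType) (d : Order.disp_t) (W : orderType d).
Hypothesis woW : well_order (<=%O : rel W).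

(* A stage of the recursion: the group reached at that stage, and maps into it
   from all groups, indexed by W; the map indexed by b is used on the group of
   stage b only. This avoids having to state the recursion mutually with the
   source of the maps. *)
Definition stage := {K : topGroupType & W -> forall L : groupType, L -> K}.

Section Step.
Variables (a : W) (rec : forall b, (b < a)%O -> stage).

Definition st_obj (b : below a) : topGroupType := projT1 (rec (valP b)).

Definition st_map (b c : below a) (x : st_obj b) : st_obj c :=
  if val b == val c then castg (st_obj c) x
  else projT2 (rec (valP c)) (val b) (st_obj b) x.

Record st_laws : Prop := StLaws {
  st_directed : directed_order (@below_le d W a);
  st_mapM : forall b c, below_le b c -> monoid_morphism (@st_map b c);
  st_map_id : forall b (x : st_obj b), st_map b x = x;
  st_map_comp : forall b c e (x : st_obj b), below_le b c -> below_le c e ->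
    st_map e (st_map c x) = st_map e x
}.

Definition st_sys (l : st_laws) : direct_system :=
  DirectSystem (st_directed l) (st_mapM l) (st_map_id l) (st_map_comp l).

Definition step : stage :=
  match pselect (exists b : below a, ord_succ (val b) a) with
  | left h =>
    let b := projT1 (cid h) in
    existT _ (profinite_completion (st_obj b))
      (fun c L x =>
        match pselect ((c < a)%O) with
        | left ca => to_completion
            (st_map (b := exist _ c ca) b (castg (st_obj (exist _ c ca)) x))
        | right _ => 1
        end)
  | right _ =>
    match pselect (ord_limit a /\ st_laws) with
    | left h =>
      existT _ (profinite_completion (direct_limit (st_sys h.2)))
        (fun c L x =>
          match pselect ((c < a)%O) with
          | left ca => to_completion
              (to_dirlim (castg (st_sys h.2 (exist _ c ca)) x))
          | right _ => 1
          end)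
    | right _ => existT _ G (fun _ _ _ => 1)
    end
  end.

Definition step_spec (r : stage) : Prop :=
  [/\ ord_zero a -> exists e : G -> projT1 r, topgroup_iso e,
      forall b : below a, ord_succ (val b) a ->
        exists e : profinite_completion (st_obj b) -> projT1 r,
          topgroup_iso e /\
          forall (c : below a) (x : st_obj c),
            e (to_completion (st_map b x)) = projT2 r (val c) (st_obj c) x &
      ord_limit a -> forall l : st_laws,
        exists e : profinite_completion (direct_limit (st_sys l)) -> projT1 r,
          topgroup_iso e /\
          forall (c : below a) (x : st_sys l c),
            e (to_completion (to_dirlim x)) = projT2 r (val c) (st_sys l c) x].

Lemma topgroup_iso_id (H : topGroupType) : topgroup_iso (@id H).
Proof.
split; [by split | by move=> x | exists id].
by split=> // x.
Qed.

Lemma stepP : step_spec step.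
Proof.
rewrite /step; case: pselect => [h|nsucc].
  case: (cid h) => b hb /=; split=> [za|b' hb'|[_ la]].
  - by have := za (val b); rewrite leNgt hb.1.
  - have eb : b' = b.
      apply/val_inj/le_anti.
      by rewrite hb.2 ?hb'.1 ?hb'.2 ?hb.1.
    rewrite {}eb in hb' *; exists id; split; first exact: topgroup_iso_id.
    move=> [c ca] x /=; case: pselect => // ca'.
    by rewrite (Prop_irrelevance ca' ca) castg_id.
  - have [c [bc ca]] := la _ hb.1.
    by have := hb.2 c ca; rewrite leNgt bc.
case: pselect => [h|nlim] /=; split=> [za|b hb|la l].
- by have [[b ba] _] := h.1; have := za b; rewrite leNgt ba.
- by case: nsucc; exists b.
- rewrite (Prop_irrelevance l h.2); exists id; split; first exact: topgroup_iso_id.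
  move=> [c ca] x /=; case: pselect => // ca'.
  by rewrite (Prop_irrelevance ca' ca) castg_id.
- by exists id; apply: topgroup_iso_id.
- by case: nsucc; exists b.
- by case: nlim.
Qed.

End Step.

Implicit Types a b c : W.

Definition stage_at : W -> stage :=
  Fix (well_order_wf woW) (fun=> stage) step.

Lemma stage_atP a : step_spec (fun b (_ : (b < a)%O) => stage_at b) (stage_at a).
Proof.
suff -> : stage_at a = step (fun b (_ : (b < a)%O) => stage_at b) by exact: stepP.
rewrite {1}/stage_at Fix_eq // => {}a f g efg; congr step.
by apply: functional_extensionality_dep => b; apply/funext => ba; apply: efg.
Qed.

Definition order_obj (a : W) : topGroupType := projT1 (stage_at a).

Definition order_map (b c : W) (x : order_obj b) : order_obj c :=
  if b == c then castg (order_obj c) x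
  else projT2 (stage_at c) b (order_obj b) x.

Lemma order_map_id b (x : order_obj b) : order_map b x = x.
Proof. by rewrite /order_map eqxx castg_id. Qed.

Lemma order_map_lt b c (x : order_obj b) : (b < c)%O ->
  order_map c x = projT2 (stage_at c) b (order_obj b) x.
Proof. by move=> bc; rewrite /order_map lt_eqF. Qed.

Lemma morphism_comp (A B C : groupType) (f : A -> B) (g : B -> C) :
  monoid_morphism f -> monoid_morphism g -> monoid_morphism (g \o f).
Proof.
move=> [f1 fM] [g1 gM]; split=> [|x y] /=; first by rewrite f1 g1.
by rewrite fM gM.
Qed.

Lemma ord_succ_or_limit a b : (b < a)%O ->
  (exists c : below a, ord_succ (val c) a) \/ ord_limit a.
Proof.
move=> ba; have [|ns] := pselect (exists c : below a, ord_succ (val c) a).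
  by left.
right; split; first by exists b.
move=> c ca; apply: contrapT => nc; apply: ns; exists (exist _ c ca).
split=> // e ea; rewrite leNgt; apply/negP => /= ce.
by apply: nc; exists e.
Qed.

Definition order_laws (a : W) : Prop :=
  (forall b, (b <= a)%O -> monoid_morphism (@order_map b a)) /\
  (forall b c (x : order_obj b), (b <= c)%O -> (c <= a)%O ->
     order_map a (order_map c x) = order_map a x).

Lemma order_st_laws a : ord_limit a -> (forall b, (b < a)%O -> order_laws b) ->
  st_laws (fun b (_ : (b < a)%O) => stage_at b).
Proof.
move=> la IH; split.
- exact: below_directed.
- by move=> b [c ca] bc; apply: (IH c ca).1.
- by move=> b x; apply: order_map_id.
- by move=> b c [e ea] x bc ce; apply: (IH e ea).2.
Qed.

Lemma order_lawsP a : order_laws a.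
Proof.
elim/(well_founded_ind (well_order_wf woW)): a => a IH.
suff H : (forall b, (b < a)%O -> monoid_morphism (@order_map b a)) /\
    (forall b c (x : order_obj b), (b <= c)%O -> (c < a)%O ->
      order_map a (order_map c x) = order_map a x).
  split=> [b|b c x bc].
    rewrite le_eqVlt => /orP[/eqP ->|/H.1//].
    by split=> [|x y]; rewrite !order_map_id.
  rewrite le_eqVlt => /orP[/eqP eca|ca].
    by subst c; rewrite order_map_id.
  exact: H.2.
have [_ Hs Hl] := stage_atP a.
have [[b0 ba0]|nb] := pselect (exists b, (b < a)%O); last first.
  split=> [b ba|b c x _ ca]; first by case: nb; exists b.
  by case: nb; exists c.
have [[e ea]|la] := ord_succ_or_limit ba0.
  have [f [[fM _ _] fE]] := Hs e ea.
  have mapE b (ba : (b < a)%O) :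
      @order_map b a = f \o @to_completion _ \o @order_map b (val e).
    apply/funext => x; rewrite order_map_lt //; apply/esym.
    exact: (fE (exist _ b ba) x).
  split=> [b ba|b c x bc ca].
    rewrite mapE //; apply: morphism_comp; first exact: (IH _ ea.1).1 _ (ea.2 _ ba).
    exact: morphism_comp (to_completion_morphism _) fM.
  have ba := le_lt_trans bc ca.
  rewrite !mapE //=; congr (f (to_completion _)).
  exact: (IH _ ea.1).2 _ _ _ bc (ea.2 _ ca).
have l := order_st_laws la IH.
have [f [[fM _ _] fE]] := Hl la l.
have mapE b (ba : (b < a)%O) : @order_map b a =
    f \o @to_completion _ \o @to_dirlim (st_sys l) (exist _ b ba).
  apply/funext => x; rewrite order_map_lt //; apply/esym.
  exact: (fE (exist _ b ba) x).
split=> [b ba|b c x bc ca].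
  rewrite mapE; apply: morphism_comp; first exact: to_dirlim_morphism.
  exact: morphism_comp (to_completion_morphism _) fM.
have ba := le_lt_trans bc ca.
rewrite !mapE /=; congr (f (to_completion _)).
exact: (@to_dirlim_map (st_sys l) (exist _ b ba) (exist _ c ca) x bc).
Qed.

Definition order_tower : group_tower W :=
  @GroupTower d W order_obj order_map
    (fun b c bc => (order_lawsP c).1 b bc)
    order_map_id
    (fun a b c x ab bc => (order_lawsP c).2 a b x ab bc).

Lemma completion_tower_exists :
  exists T : completion_tower G W, comp_tower T = order_tower.
Proof.
have Hz (a : W) : ord_zero a -> exists e : G -> order_tower a, topgroup_iso e.
  by have [Hz _ _] := stage_atP a.
have Hs (b a : W) : ord_succ b a ->
    exists e : profinite_completion (order_tower b) -> order_tower a,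
      topgroup_iso e /\
      forall x : order_tower b, e (to_completion x) = tow_map a x.
  move=> ba; have [_ /(_ (exist _ b ba.1) ba) [e [ei eE]] _] := stage_atP a.
  exists e; split=> // x.
  rewrite [RHS]order_map_lt ?ba.1 // -(eE (exist _ b ba.1) x).
  by congr (e (to_completion _)); rewrite [RHS]order_map_id.
have Hl (a : W) (la : ord_limit a) :
    exists e : profinite_completion (direct_limit (tower_below order_tower la)) ->
               order_tower a,
      topgroup_iso e /\
      forall (b : below a) (x : tower_below order_tower la b),
        e (to_completion (to_dirlim x)) = @tow_map d W order_tower (val b) a x.
  pose S := tower_below order_tower la.
  pose l : st_laws (fun b (_ : (b < a)%O) => stage_at b) :=
    StLaws (dir_directed S) (@dir_mapM S) (@dir_map_id S) (@dir_map_comp S).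
  have [_ _ /(_ la l)] := stage_atP a.
  move=> [e [ei eE]]; exists e; split=> // b x.
  by rewrite eE [RHS]order_map_lt // (valP b).
by exists (CompletionTower Hz Hs Hl).
Qed.

End TowerConstruction.

(* Main.v *)
(* Call an abstract group K good if its finite quotients are nilpotent, its
   homomorphisms to finite p-groups lift along surjections of finite p-groups, and
   K is infinite and has, for every prime p, a family of elements indexed by K on
   which the homomorphisms K -> F_p take arbitrary values.

   If K is good, its profinite completion is free pronilpotent.  By the last
   condition Hom(K, F_p) has, for every p, a basis indexed by the subsets of K.
   Let X be the set of these subsets.  The bases give bijections between
   Hom(K, F_p) and the finitely supported maps X -> F_p; lifting through central
   extensions of prime order and a compactness argument extend them to bijections
   between Hom(K, H) and the finitely supported maps X -> H, natural in the finite
   nilpotent group H.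

   A free pronilpotent group F of infinite rank is good.  For the lifting property,
   Serre's argument shows that a homomorphism to a finite p-group is continuous on
   every finitely generated subgroup; a coinduction argument lifts it there, and
   compactness glues the lifts.  For the last condition, F has at most as many
   elements as the basis has subsets, and these index a linearly independent family
   of maps from the basis to F_p.

   The first two conditions pass to direct limits.  For the last one, F has a family
   indexed by F in its completion on which the homomorphisms that kill F take
   arbitrary values, and every homomorphism to F_p extends to the later stages; so
   the families obtained at the successive stages of the tower can be put together. *)

Require Import Defs.
From mathcomp Require Import all_boot all_order.
From mathcomp Require Import wochoice.
From HB Require Import structures.
From mathcomp Require Import all_fingroup all_solvable all_algebra.
From mathcomp Require Import all_classical topology.

Set Implicit Arguments.
Unset Strict Implicit.
Unset Printing Implicit Defensive.

(** * Compactness and duality over 'F_p *)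

(** The limit stages complete a direct limit of abstract groups, and a free pronilpotent group of
    infinite rank has discontinuous homomorphisms to finite groups. Goodness therefore involves no
    topology, and all homomorphisms to finite groups have to be controlled.

    Freeness needs one basis X serving every prime, whereas the dimensions of the spaces Hom(K, F_p)
    have no evident reason to agree. Asking for arbitrary values on a family indexed by K forces
    each dimension to be the largest possible one, the number of subsets of K, which does not depend
    on p.

    A lift through a central extension can be changed by any homomorphism into the centre, so lifts
    chosen for different target groups need not fit together. An ultrafilter limit makes the choice
    natural in the target.

    At a limit stage the family consists of elements born at different stages. A linear relation
    between their evaluations is tested on its latest stage, by a homomorphism vanishing on
    everything earlier; this is why the homomorphisms killing F matter. *)

Section Cluster.
Local Open Scope classical_set_scope.
Variables (D : Type) (le : D -> D -> Prop).
Hypothesis D0 : inhabited D.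
Hypothesis le_trans : forall x y z, le x y -> le y z -> le x z.
Hypothesis le_dir : forall x y, exists z, le x z /\ le y z.

Lemma net_ultrafilter : exists U : set_system D, UltraFilter U /\
  forall d, U [set e | le d e].
Proof.
pose F : set_system D := fun A => exists d, [set e | le d e] `<=` A.
have FF : ProperFilter F.
  apply: Build_ProperFilter_ex.
    by move=> A [d dA]; have [e [de _]] := le_dir d d; exists e; apply: dA.
  split.
  - by case: D0 => d; exists d.
  - move=> A B [d dA] [e eB]; have [f [df ef]] := le_dir d e.
    exists f => x fx; split; [exact/dA/(le_trans df)|exact/eB/(le_trans ef)].
  - by move=> A B AB [d dA]; exists d; apply: subset_trans AB.
have [U [UU FU]] := ultraFilterLemma FF; exists U; split=> // d.
by apply: FU; exists d.
Qed.

Lemma ultra_finite (U : set_system D) (T : Type) (f : D -> T) :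
  UltraFilter U -> finite_set [set: T] -> exists t, U [set d | f d = t].
Proof.
move=> UU; have UP : ProperFilter U by exact: ultra_proper.
elim/Pchoice: T => T in f *.
move=> /finite_seqP[s sE]; apply: contrapT => /forallNP nt.
have : U (fun d => ~ f d \in s).
  elim: s {sE} => [|t s IH]; first by apply: filterS filterT.
  have [//|Ut] := in_ultra_setVsetC [set d | f d = t] UU; first by move/nt.
  apply: filterS (filterI Ut IH) => d [/= dt ds].
  by rewrite inE => /orP[/eqP|].
move=> /filter_ex[d]; apply.
by have : [set: T] (f d) by []; rewrite sE.
Qed.

(** Each coordinate takes finitely many values, so it is constant on a member of an ultrafilter
    containing all tails. No compatibility along the net is assumed: a property of finitely many
    coordinates passes to [y] because [y] agrees there with [x d] for arbitrarily late [d]. *)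
Lemma net_cluster (I : Type) (A : I -> Type) (x : D -> forall i, A i) :
  (forall i, finite_set [set: A i]) ->
  exists y : forall i, A i, forall (E : set I) d0, finite_set E ->
    exists d, le d0 d /\ forall i, E i -> x d i = y i.
Proof.
move=> Af; have [U [UU Ule]] := net_ultrafilter.
have UP : ProperFilter U by exact: ultra_proper.
have H i := ultra_finite (fun d => x d i) UU (Af i).
pose y i := projT1 (cid (H i)).
have yP i : U [set d | x d i = y i] by exact: projT2 (cid (H i)).
exists y; elim/Pchoice: I => I in A x Af H y yP *.
move=> E d0 /finite_seqP[s ->].
suff : U [set d | forall i, i \in s -> x d i = y i].
  by move=> /(filterI (Ule d0))/filter_ex[d [? ?]]; exists d.
elim: s => [|i s IH]; first by apply: filterS filterT.
apply: filterS (filterI (yP i) IH) => d [/= di ds] j.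
by rewrite inE => /orP[/eqP->|/ds].
Qed.

End Cluster.

Section FiniteDuality.
Import GRing.Theory.
Local Open Scope classical_set_scope.
Local Open Scope ring_scope.
Variables (p : nat) (I : choiceType).
Implicit Types (U : set (I -> 'F_p)) (s : seq I) (c g u : I -> 'F_p).

(** Scalars of ['F_p] are multiples of 1, so closure under addition makes the restriction of [U] to
    [s] a subspace; it is then the annihilator of its annihilator. *)
Lemma finite_duality U s g : uniq s -> U (fun=> 0) ->
  (forall u v, U u -> U v -> U (fun i => u i + v i)) ->
  (forall c, (forall u, U u -> \sum_(i <- s) c i * u i = 0) ->
    \sum_(i <- s) c i * g i = 0) ->
  exists2 u, U u & forall i, i \in s -> u i = g i.
Proof.
move=> us U0 UD Hg; have [->|[i0 i0s]] : s = [::] \/ exists i, i \in s.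
- by case: s {us Hg} => [|i s]; [left|right; exists i; rewrite inE eqxx].
- by exists (fun=> 0).
pose n := size s; pose r u : 'rV['F_p]_n := \row_j u (nth i0 s j).
pose V (v : 'rV['F_p]_n) := exists2 u, U u & v = r u.
have V0 : V 0 by exists (fun=> 0) => //; apply/rowP => j; rewrite !mxE.
have VD v w : V v -> V w -> V (v + w).
  move=> [u Uu ->] [u' Uu' ->]; exists (fun i => u i + u' i); first exact: UD.
  by apply/rowP => j; rewrite !mxE.
have VZ a v : V v -> V (a *: v).
  move=> Vv; rewrite -[a]natr_Zp scaler_nat; elim: (nat_of_ord a) => // k IH.
  by rewrite mulrS; apply: VD.
(* All vectors of [V] serve as rows, padded with zero rows, so that no basis has to be chosen; the
   columns of [cokermx M] are the annihilators to be tested. *)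
pose M : 'M['F_p]_(#|{: 'rV['F_p]_n}|, n) :=
  \matrix_k (if `[< V (enum_val k) >] then enum_val k else 0).
have VM k : V (row k M) by rewrite rowK; case: asboolP.
have sumE c u : \sum_(i <- s) c i * u i = (r u *m (r c)^T) 0 0.
  rewrite (big_nth i0) big_mkord mxE; apply: eq_bigr => j _.
  by rewrite !mxE mulrC.
have rK (v : 'rV['F_p]_n) : exists c, r c = v.
  have ns (j : 'I_n) : (index (nth i0 s j) s < n)%N by rewrite index_mem mem_nth.
  exists (fun i => if insub (index i s) is Some j then v 0 j else 0).
  apply/rowP => j; rewrite !mxE index_uniq // insubT //= => lt.
  by congr (v 0 _); apply/val_inj.
have /submxP[A gA] : (r g <= M)%MS.
  rewrite submxE; apply/eqP/rowP => j; rewrite [RHS]mxE.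
  have [c cE] := rK (row j (cokermx M)^T).
  have mulE (v : 'rV_n) : (v *m cokermx M) 0 j = (v *m (r c)^T) 0 0.
    by rewrite cE !mxE; apply: eq_bigr => k _; rewrite !mxE.
  rewrite mulE -sumE; apply: Hg => u Uu; rewrite sumE -mulE.
  have Vu : V (r u) by exists u.
  have -> : r u = row (enum_rank (r u)) M.
    by rewrite rowK enum_rankK asboolT.
  by rewrite -row_mul mulmx_coker !mxE.
have : V (r g).
  rewrite gA mulmx_sum_row; elim/big_ind: _ => // k _; exact/VZ/VM.
move=> [u Uu e]; exists u => // i si.
have lt : (index i s < n)%N by rewrite index_mem.
by have /rowP/(_ (Ordinal lt)) := e; rewrite !mxE /= nth_index.
Qed.

End FiniteDuality.

Definition addhom (K : groupType) (p : nat) (chi : K -> 'F_p) : Prop :=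
  forall x y : K, chi (x * y)%g = (chi x + chi y)%R.

Section AddHom.
Import GRing.Theory.
Local Open Scope classical_set_scope.
Local Open Scope ring_scope.
Variables (K : groupType) (p : nat).
Implicit Types (chi : K -> 'F_p) (x y : K).

Lemma addhom0 : addhom (fun _ : K => 0 : 'F_p).
Proof. by move=> x y; rewrite addr0. Qed.

Lemma addhom1 chi : addhom chi -> chi 1%g = 0.
Proof. by move=> h; apply: (addrI (chi 1%g)); rewrite -h mulg1 addr0. Qed.

Lemma addhomV chi x : addhom chi -> chi x^-1%g = - chi x.
Proof.
by move=> h; apply: (addrI (chi x)); rewrite -h mulgV addhom1 // subrr.
Qed.

Lemma addhomX chi x n : addhom chi -> chi (x ^+ n)%g = chi x *+ n.
Proof.
move=> h; elim: n => [|n IH]; first by rewrite expg0 addhom1.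
by rewrite expgS h IH mulrS.
Qed.

Lemma addhomD chi chi' : addhom chi -> addhom chi' ->
  addhom (fun x => chi x + chi' x).
Proof. by move=> h h' x y; rewrite h h' addrACA. Qed.

Lemma addhomZ a chi : addhom chi -> addhom (fun x => a * chi x).
Proof. by move=> h x y; rewrite h mulrDr. Qed.

Lemma addhom_sum (I : Type) (s : seq I) (c : I -> 'F_p) (f : I -> K -> 'F_p) :
  (forall i, addhom (f i)) -> addhom (fun x => \sum_(i <- s) c i * f i x).
Proof.
move=> h x y; rewrite -big_split; apply: eq_bigr => i _.
by rewrite h mulrDr.
Qed.

(** Multiplication in [K] adds up evaluations, and a coefficient in ['F_p] becomes an exponent. *)
Lemma addhom_comb (I : Type) (s : seq I) (c : I -> 'F_p) (k : I -> K) :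
  exists x, forall chi, addhom chi -> chi x = \sum_(i <- s) c i * chi (k i).
Proof.
elim: s => [|i s [x xP]]; first by exists 1%g => chi h; rewrite big_nil addhom1.
exists (k i ^+ c i * x)%g => chi h.
by rewrite big_cons h addhomX // xP // -[in RHS](natr_Zp (c i)) mulr_natl.
Qed.

(** Values can be prescribed as soon as they respect the linear relations between the evaluations at
    the [k i]. Finite duality handles finitely many points; compactness glues, additivity being a
    condition on three values at a time. *)
Lemma addhom_duality (I : choiceType) (k : I -> K) (g : I -> 'F_p) :
  (forall s c, uniq s ->
    (forall chi, addhom chi -> \sum_(i <- s) c i * chi (k i) = 0) ->
    \sum_(i <- s) c i * g i = 0) ->
  exists2 chi, addhom chi & forall i, chi (k i) = g i.
Proof.
move=> Hg.
have fin (s : seq I) : exists chi, addhom chi /\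
    forall i, i \in s -> chi (k i) = g i.
  pose U : set (I -> 'F_p) := fun u => exists2 chi, addhom chi & u = chi \o k.
  have [||||u [chi h ->] e] := @finite_duality p I U (undup s) g.
  - exact: undup_uniq.
  - by exists (fun=> 0) => //; apply: addhom0.
  - move=> _ _ [f hf ->] [f' hf' ->]; exists (fun x => f x + f' x) => //.
    exact: addhomD.
  - move=> c Hc; apply: Hg => [|chi h]; first exact: undup_uniq.
    by apply: (Hc (chi \o k)); exists chi.
  by exists chi; split=> // i si; apply: e; rewrite mem_undup.
have [f fP] := choice fin.
have [|||| y yP] :=
  @net_cluster (seq I) (fun s t => {subset s <= t}) _ _ _ K (fun=> 'F_p) f.
- exact: (inhabits [::]).
- by move=> s t u st tu i /st/tu.
- move=> s t; exists (s ++ t).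
  by split=> i si; rewrite mem_cat si ?orbT.
- by move=> _; apply: finite_finset.
exists y => [x x'|i].
  have [s [_ e]] := yP [set x; x'; (x * x')%g] [::] (finite_set3 _ _ _).
  rewrite -!e /=; first exact: (fP s).1.
  + by left; right.
  + by left; left.
  + by right.
have [s [si e]] := yP [set k i] [:: i] (finite_set1 _).
by rewrite -e // (fP s).2 //; apply: si; rewrite inE.
Qed.

End AddHom.

(** * Infinite cardinals *)

Definition inj_le (A B : Type) : Prop := exists f : A -> B, injective f.

Lemma inj_le_trans (A B C : Type) : inj_le A B -> inj_le B C -> inj_le A C.
Proof. by move=> [f fi] [g gi]; exists (g \o f); apply: inj_comp. Qed.

Lemma inj_le_prod (A B A' B' : Type) :
  inj_le A A' -> inj_le B B' -> inj_le (A * B) (A' * B').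
Proof.
move=> [f fi] [g gi]; exists (fun x => (f x.1, g x.2)).
by move=> [x y] [x' y'] [/fi -> /gi ->].
Qed.

Lemma inj_le_seq (A B : Type) : inj_le A B -> inj_le (seq A) (seq B).
Proof. by move=> [f fi]; exists (map f); apply: inj_map. Qed.

Lemma inj_le_set (A B : Type) : inj_le A B -> inj_le (set A) (set B).
Proof.
move=> [f fi]; exists (fun X => [set f x | x in X]%classic) => X Y e.
apply/predeqP => x; split=> Xx.
- have : [set f x | x in Y]%classic (f x) by rewrite -e; exists x.
  by move=> [y Yy /fi <-].
- have : [set f x | x in X]%classic (f x) by rewrite e; exists x.
  by move=> [y Yy /fi <-].
Qed.

Lemma inj_le_antisym (A B : Type) :
  inj_le A B -> inj_le B A -> exists f : A -> B, bijective f.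
Proof.
have leE (C D : Type) : inj_le C D -> ([set: C] #<= [set: D])%card.
  move=> [f fi]; have [h] : $|{injfun [set: C] >-> [set: D]}|%classic.
    by apply/injfunPex; exists f => // x y _ _; apply: fi.
  exact: inj_card_le.
move=> /leE AB /leE BA; have /card_bijP[h [g hK gK]] := Cantor_Bernstein AB BA.
exists (fun x => val (h (exist _ x (mem_set I)))).
exists (fun y => val (g (exist _ y (mem_set I)))) => x /=.
  by rewrite (_ : exist _ (val _) _ = h (exist _ x (mem_set I))) ?hK //;
    apply: val_inj.
by rewrite (_ : exist _ (val _) _ = g (exist _ x (mem_set I))) ?gK //;
  apply: val_inj.
Qed.

(** * Squares of infinite cardinals *)

Section Square.
Local Open Scope classical_set_scope.
Variable T : Type.
Implicit Types A B : set T.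

Lemma infinite_nat_inj : infinite_set [set: T] -> inj_le nat T.
Proof.
move=> /infiniteP/card_leP[f].
exists (fun n => val (f (exist _ n (mem_set I)))) => m n.
by move=> /val_inj/(@inj _ _ _ f) => /(_ (mem_set I) (mem_set I)) [].
Qed.

Lemma inj_infinite (S : Type) : inj_le nat S -> infinite_set [set: S].
Proof.
move=> [f fi] /(finite_preimage (f := f)).
rewrite preimage_setT => H; apply/infinite_nat/H => x y _ _; exact: fi.
Qed.

(** Zorn's lemma for graphs of partial bijections: a maximal graph covers [A] or [B], since
    otherwise an uncovered pair could be added. *)
Lemma inj_comparable A B :
  (exists f : T -> T, (forall x, A x -> B (f x)) /\
     forall x y, A x -> A y -> f x = f y -> x = y) \/
  (exists f : T -> T, (forall x, B x -> A (f x)) /\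
     forall x y, B x -> B y -> f x = f y -> x = y).
Proof.
pose P (G : set (T * T)) :=
  (forall x, G x -> A x.1 /\ B x.2) /\
  forall x y, G x -> G y -> x.1 = y.1 \/ x.2 = y.2 -> x = y.
have [F FP Ftot|G [[GAB Gi] Gmax]] := @Zorn_bigcup _ P.
  split=> [x [X FX Xx]|x y [X FX Xx] [Y FY Yy]]; first exact: (FP X FX).1.
  have [XY|YX] := Ftot _ _ FX FY; first exact: (FP Y FY).2 (XY _ Xx) Yy.
  exact: (FP X FX).2 Xx (YX _ Yy).
have [dA|/existsNP[a /not_implyP[Aa na]]] :=
    pselect (forall x, A x -> exists y, G (x, y)).
  left; have /choice[f fP] : forall x, exists y, A x -> G (x, y).
    by move=> x; have [/dA[y Gy]|] := pselect (A x); [exists y|exists x].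
  exists f; split=> [x /fP/GAB[]//|x y Ax Ay e].
  by have := Gi _ _ (fP _ Ax) (fP _ Ay) (or_intror e) => -[].
have [dB|/existsNP[b /not_implyP[Bb nb]]] :=
    pselect (forall y, B y -> exists x, G (x, y)).
  right; have /choice[f fP] : forall y, exists x, B y -> G (x, y).
    by move=> y; have [/dB[x Gx]|] := pselect (B y); [exists x|exists y].
  exists f; split=> [x /fP/GAB[]//|x y Bx By e].
  by have := Gi _ _ (fP _ Bx) (fP _ By) (or_introl e) => -[].
exfalso; apply: (Gmax (G `|` [set (a, b)])).
  split=> [|/(_ (a, b))]; first by move=> x; left.
  by move=> h; apply: na; exists b; apply: h; right.
split=> [x [/GAB//|->//]|x y [Gx|->] [Gy|->]] //=.
- exact: Gi.
- move: x Gx => [u v] Gx /= [e|e]; [case: na|case: nb].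
    by exists v; rewrite -e.
  by exists u; rewrite -e.
- move: y Gy => [u v] Gy /= [e|e]; [case: na|case: nb].
    by exists v; rewrite e.
  by exists u; rewrite e.
Qed.

(* Zorn's lemma on pairs of a subset A and an injection A x A -> A. *)
Lemma infinite_square : infinite_set [set: T] -> inj_le (T * T) T.
Proof.
move=> /infinite_nat_inj[e0 e0i].
pose good (x : set T * (T * T -> T)) :=
  [/\ (exists e : nat -> T, injective e /\ forall n, x.1 (e n)),
      forall a b, x.1 a -> x.1 b -> x.1 (x.2 (a, b)) &
      forall a b c d, x.1 a -> x.1 b -> x.1 c -> x.1 d ->
        x.2 (a, b) = x.2 (c, d) -> (a, b) = (c, d)].
pose le (x y : {x | good x}) := `[< (sval x).1 `<=` (sval y).1 /\
  forall a b, (sval x).1 a -> (sval x).1 b ->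
    (sval y).2 (a, b) = (sval x).2 (a, b) >].
have base : exists x, good x.
  have /choice[d dP] : forall x : T, exists n, forall m, e0 m = x -> m = n.
    move=> x; have [[m <-]|nx] := pselect (exists m, e0 m = x).
      by exists m => k /e0i.
    by exists 0%N => m em; case: nx; exists m.
  exists (range e0, fun x => e0 (pickle (d x.1, d x.2))); split => /=.
  - by exists e0; split=> // n; exists n.
  - by move=> a b _ _; eexists.
  - move=> _ _ _ _ [i _ <-] [j _ <-] [k _ <-] [l _ <-].
    move=> /e0i/(pcan_inj (@pickleK _))[].
    by rewrite -!(dP _ _ erefl) => -> ->.
have [x0 x0P] := base.
have [||F Ftot|[[A f] Af] fmax] :=
  @ZL_preorder _ (exist _ x0 x0P) le.
- by move=> x; apply/asboolP; split=> [y|a b _ _].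
- move=> y x z /asboolP[xy exy] /asboolP[yz eyz]; apply/asboolP; split.
    exact: subset_trans yz.
  by move=> a b xa xb; rewrite eyz ?exy //; apply: xy.
- have [[[x xP] Fx]|nF] := pselect (F !=set0); last first.
    by exists (exist _ x0 x0P) => y Fy; case: nF; exists y.
  pose A a := exists2 y, F y & (sval y).1 a.
  have common a b : A a -> A b -> exists y, [/\ F y, (sval y).1 a & (sval y).1 b].
    move=> [y Fy ya] [z Fz zb]; have [/asboolP[yz _]|/asboolP[zy _]] := Ftot _ _ Fy Fz.
      by exists z; split=> //; apply: yz.
    by exists y; split=> //; apply: zy.
  have agree y z a b : F y -> F z -> (sval y).1 a -> (sval y).1 b ->
      (sval z).1 a -> (sval z).1 b -> (sval y).2 (a, b) = (sval z).2 (a, b).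
    move=> Fy Fz ya yb za zb.
    by have [/asboolP[_ ->]|/asboolP[_ ->]] := Ftot _ _ Fy Fz.
  have /choice[f fP] : forall ab : T * T, exists c, forall y, F y ->
      (sval y).1 ab.1 -> (sval y).1 ab.2 -> (sval y).2 ab = c.
    move=> [a b]; have [[y [Fy ya yb]]|ny] :=
        pselect (exists y, [/\ F y, (sval y).1 a & (sval y).1 b]).
      by exists ((sval y).2 (a, b)) => z Fz za zb; apply: agree.
    by exists a => z Fz za zb; case: ny; exists z.
  have fE y a b : F y -> (sval y).1 a -> (sval y).1 b ->
    f (a, b) = (sval y).2 (a, b) by move=> Fy ya yb; apply/esym/fP.
  have Af : good (A, f).
    split=> /= [|a b Aa Ab|a b c d Aa Ab Ac Ad].
    + have [[e [ei xe]] _ _] := xP.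
      by exists e; split=> // n; eexists; [exact: Fx|].
    + have [y [Fy ya yb]] := common _ _ Aa Ab; exists y => //.
      by rewrite (fE _ _ _ Fy) //; have [_ + _] := svalP y; apply.
    + have [y [Fy ya yb]] := common _ _ Aa Ab.
      have [z [Fz zc zd]] := common _ _ Ac Ad.
      rewrite (fE _ _ _ Fy) // (fE _ _ _ Fz) //.
      have [/asboolP[yz eyz]|/asboolP[zy ezy]] := Ftot _ _ Fy Fz.
        by rewrite -eyz //; have [_ _ +] := svalP z; apply=> //; apply: yz.
      by rewrite -ezy //; have [_ _ +] := svalP y; apply=> //; apply: zy.
  exists (exist _ (A, f) Af) => y Fy; apply/asboolP; split => /=.
    by move=> a ya; exists y.
  by move=> a b ya yb; apply: fE.
have [/= [e [ei eA]] fA fi] := Af.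
have eN m n : m != n -> e m <> e n by move=> mn /ei/eqP; apply/negP.
(* If the complement embeds in [A], so does [T], with [e 0] and [e 1] marking the two parts.
   Otherwise [A] embeds in its complement by [g], and [f] extends to the union of [A] and its image,
   the new pairs being sent into that image; this contradicts maximality. *)
have [[g [gA gi]]|[g [gA gi]]] := inj_comparable (~` A) A.
  pose h x := if pselect (A x) is left _ then f (x, e 0%N) else f (g x, e 1%N).
  have hA x : A (h x) by rewrite /h; case: pselect => Ax; apply: fA => //; apply: gA.
  have hi : injective h.
    move=> x y; rewrite /h; case: pselect => Ax; case: pselect => Ay e'.
    - by have [] := fi _ _ _ _ Ax (eA _) Ay (eA _) e'.
    - by have [_ /ei] := fi _ _ _ _ Ax (eA _) (gA _ Ay) (eA _) e'.
    - by have [_ /ei] := fi _ _ _ _ (gA _ Ax) (eA _) Ay (eA _) e'.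
    - have [gxy] := fi _ _ _ _ (gA _ Ax) (eA _) (gA _ Ay) (eA _) e'.
      exact: gi.
  exists (fun x => f (h x.1, h x.2)) => -[x y] [x' y'] /= e'.
  by have [/hi -> /hi ->] := fi _ _ _ _ (hA _) (hA _) (hA _) (hA _) e'.
exfalso.
have /choice[u uP] : forall x, exists y, (A x -> y = x) /\
    forall z, A z -> g z = x -> y = z.
  move=> x; have [Ax|nAx] := pselect (A x).
    by exists x; split=> // z Az gz; case: (gA z Az); rewrite gz.
  have [[z [Az gz]]|nz] := pselect (exists z, A z /\ g z = x).
    by exists z; split=> // w Aw gw; apply: gi; rewrite ?gz.
  by exists x; split=> // z Az gz; case: nz; exists z.
pose A' x := A x \/ exists2 z, A z & x = g z.
have uA x : A' x -> A (u x).
  by move=> [Ax|[z Az ->]]; [rewrite (uP x).1|rewrite ((uP (g z)).2 z)].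
(* A new pair has an entry outside [A]. The mark records which entries are outside, as [u] forgets
   it. *)
pose t x y := e (if pselect (A x) is left _ then 0%N else
                 if pselect (A y) is left _ then 1%N else 2%N).
have uf x y : A' x -> A' y -> A (f (u x, u y)).
  by move=> Ax Ay; apply: (fA _ _ (uA _ Ax) (uA _ Ay)).
pose f' xy := if pselect (A xy.1 /\ A xy.2) is left _ then f xy else
  g (f (t xy.1 xy.2, f (u xy.1, u xy.2))).
have tA x y : A (t x y) by apply: eA.
have tuf x y : A' x -> A' y -> A (f (t x y, f (u x, u y))).
  by move=> Ax Ay; apply: (fA _ _ (tA _ _) (uf _ _ Ax Ay)).
have ui x y : A' x -> A' y -> (A x <-> A y) -> u x = u y -> x = y.
  move=> [Ax|[z Az ->]] [Ay|[w Aw ->]] xy.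
  - by rewrite (uP x).1 // (uP y).1.
  - by case: (gA w Aw); apply/xy.
  - by case: (gA z Az); apply/xy.
  - by rewrite ((uP (g z)).2 z) // ((uP (g w)).2 w) // => ->.
have f'g : good (A', f').
  split => /=.
  - by exists e; split=> // n; left.
  - move=> a b Aa Ab; rewrite /f'; case: pselect => /= [[Ha Hb]|_].
      by left; apply: fA.
    by right; exists (f (t a b, f (u a, u b))) => //; apply: tuf.
  - move=> a b c d Aa Ab Ac Ad; rewrite /f'.
    have gf x y : A' x -> A' y -> ~ A (g (f (t x y, f (u x, u y)))).
      by move=> Ax Ay; apply/gA/tuf.
    case: pselect => /= [[Ha Hb]|nab]; case: pselect => /= [[Hc Hd]|ncd].
    + exact: fi.
    + by move=> e'; case: (gf c d Ac Ad); rewrite -e'; apply: fA.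
    + by move=> e'; case: (gf a b Aa Ab); rewrite e'; apply: fA.
    + move=> e'; have {}e' := gi _ _ (tuf _ _ Aa Ab) (tuf _ _ Ac Ad) e'.
      have [te fe] := fi _ _ _ _ (tA _ _) (uf _ _ Aa Ab) (tA _ _) (uf _ _ Ac Ad) e'.
      have [ue ue'] := fi _ _ _ _ (uA _ Aa) (uA _ Ab) (uA _ Ac) (uA _ Ad) fe.
      suff [ac bd] : (A a <-> A c) /\ (A b <-> A d).
        by rewrite (ui a c) // (ui b d).
      move: te; rewrite /t.
      case: (pselect (A a)) => Ha; case: (pselect (A c)) => Hc;
        case: (pselect (A b)) => Hb; case: (pselect (A d)) => Hd;
        by move=> /ei // _; split; split=> // ?; tauto.
have /fmax/asboolP[/= A'A _] : le (exist _ (A, f) Af) (exist _ (A', f') f'g).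
  apply/asboolP; split=> /= [x|a b Aa Ab]; first by left.
  by rewrite /f'; case: pselect => // -[].
by apply: (gA (e 0%N)); [apply: eA|apply: A'A; right; exists (e 0%N)].
Qed.

Lemma infinite_seq : infinite_set [set: T] -> inj_le (seq T) T.
Proof.
move=> Ti; have [h hi] := infinite_square Ti; have [e ei] := infinite_nat_inj Ti.
exists (fun s => h (e (size s), foldr (fun x y => h (x, y)) (e 0%N) s)).
move=> s t /hi[/ei]; elim: s t => [|x s IH] [|y t] //= [st] /hi[-> xy].
by rewrite (IH t).
Qed.

Lemma infinite_nat_prod : infinite_set [set: T] -> inj_le (T * nat) T.
Proof.
move=> Ti; apply: inj_le_trans (infinite_square Ti).
by apply: inj_le_prod; [exists id|apply: infinite_nat_inj].
Qed.

End Square.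

(** * Independent families and bases of Hom(K, F_p) *)

Section Independence.
Import GRing.Theory.
Local Open Scope classical_set_scope.
Local Open Scope ring_scope.

Definition lin_indep (p : nat) (A : Type) (I : choiceType)
    (b : I -> A -> 'F_p) : Prop :=
  forall (s : seq I) (c : I -> 'F_p), uniq s ->
    (forall x, \sum_(i <- s) c i * b i x = 0) -> forall i, i \in s -> c i = 0.

Lemma lin_indep_inj p A (I : choiceType) (b : I -> A -> 'F_p) :
  lin_indep b -> injective b.
Proof.
move=> bi i j eb; apply/eqP/negPn/negP => ij.
have uij : uniq [:: i; j] by rewrite /= inE ij.
have := bi _ (fun k => if k == i then 1 else -1) uij _ i (mem_head _ _).
rewrite eqxx => H; have /eqP := oner_neq0 'F_p; apply; apply: H => x.
rewrite !big_cons big_nil eqxx [j == i]eq_sym (negPf ij) eb.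
by rewrite mul1r mulN1r addr0 subrr.
Qed.

(* The coordinates are indexed by a code of pairs (E, T) of finite subsets, and
   [X] has coordinate 1 at (E, T) when it meets E in T. *)
Lemma lin_indep_subsets (p : nat) (A : Type) : infinite_set [set: A] ->
  exists d : {classic set A} -> A -> 'F_p, lin_indep d.
Proof.
move=> Ai; have [code codei] : inj_le (seq A * seq A) A.
  apply: inj_le_trans (infinite_square Ai).
  by apply: inj_le_prod; apply: infinite_seq.
elim/Pchoice: A => A in Ai code codei *.
exists (fun X y => if `[< exists E T, y = code (E, T) /\
   forall x, x \in E -> (X x <-> x \in T) >] then 1 else 0).
move=> s c us Hs X Xs.
(* [E] tells [X] apart from the other members of [s], so only the term of [X] survives at the
   coordinate coded by [E] and its intersection with [X]. *)
have [E EP] : exists E : seq A, forall Y, Y \in s ->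
    (forall x, x \in E -> (Y x <-> X x)) -> Y = X.
  elim: s {us Hs Xs} => [|Y s [E EP]]; first by exists [::].
  have [->|YX] := pselect (Y = X).
    exists E => Z; rewrite inE => /orP[/eqP ->//|]; exact: EP.
  have [x xP] : exists x, ~ (Y x <-> X x).
    by apply/existsNP => XY; apply/YX/predeqP.
  exists (x :: E) => Z; rewrite inE => /orP[/eqP ->|Zs] EZ.
    by case: xP; apply: EZ; rewrite inE eqxx.
  by apply: EP => // y yE; apply: EZ; rewrite inE yE orbT.
have := Hs (code (E, [seq x <- E | `[< X x >]])).
rewrite (bigD1_seq X) //= asboolT ?mulr1; last first.
  eexists _, _; split; first by reflexivity.
  by move=> x xE; rewrite mem_filter xE andbT; split=> /asboolP.
rewrite big_seq_cond big1 ?addr0 // => Y /andP[Ys YX].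
rewrite asboolF ?mulr0 // => -[E' [T [/codei[<- <-] YE]]].
case/eqP: YX; apply: EP => // x xE.
by rewrite YE // mem_filter xE andbT; split=> /asboolP.
Qed.

Section Basis.
Variables (K : groupType) (p : nat).
Local Notation V := {classic (K -> 'F_p)}.

Definition addhom_basis (I : choiceType) (b : I -> K -> 'F_p) : Prop :=
  [/\ forall i, addhom (b i), lin_indep b &
      forall chi, addhom chi -> exists s c, uniq s /\
        forall x, chi x = \sum_(i <- s) c i * b i x].

Let indep (B : set V) : Prop := forall (s : seq V) (c : V -> 'F_p),
  uniq s -> (forall f, f \in s -> B f) ->
  (forall x, \sum_(f <- s) c f * f x = 0) -> forall f, f \in s -> c f = 0.

Lemma addhom_basis_set (B0 : set V) : indep B0 ->
  (forall f : V, B0 f -> addhom f) ->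
  exists B : set V, [/\ B0 `<=` B, indep B, forall f : V, B f -> addhom f &
    forall chi, addhom chi -> exists (s : seq V) c, [/\ uniq s,
        forall f, f \in s -> B f & forall x, chi x = \sum_(f <- s) c f * f x]].
Proof.
move=> B0i B0h.
(* [B0] is joined outside [A] so that the union of the empty chain satisfies [P] as well. *)
pose P (A : set V) := (forall f, A f -> addhom f) /\ indep (A `|` B0).
have [F FP Ftot|A [[Ah Ai] Amax]] := @Zorn_bigcup _ P.
  split=> [f [X FX Xf]|s c us sB]; first exact: (FP X FX).1.
  suff [[X FX sX]|sX] : (exists2 X, F X & forall f, f \in s -> (X `|` B0) f) \/
      forall f, f \in s -> B0 f.
  - exact: (FP X FX).2.
  - exact: B0i.
  elim: s {us} sB => [|f s IH] sB; first by right.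
  have /IH{}IH : forall f, f \in s -> (\bigcup_(X in F) X `|` B0) f.
    by move=> g gs; apply: sB; rewrite inE gs orbT.
  have := sB f (mem_head _ _) => -[[X FX Xf]|Bf]; last first.
    case: IH => [[X FX sX]|sX]; [left; exists X => //|right];
      by move=> g; rewrite inE => /orP[/eqP ->|/sX]; by [right|].
  left; case: IH => [[Y FY sY]|sY].
    have [XY|YX] := Ftot _ _ FX FY.
      exists Y => // g; rewrite inE => /orP[/eqP ->|/sY//].
      by left; apply: XY.
    exists X => // g; rewrite inE => /orP[/eqP ->|/sY[/YX|]]; by [left|right].
  by exists X => // g; rewrite inE => /orP[/eqP ->|/sY]; [left|right].
exists (A `|` B0); split; first by move=> f; right.
- exact: Ai.
- by move=> f [/Ah|/B0h].
move=> chi chih; pose f0 : V := chi.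
have [Bf|nBf] := pselect ((A `|` B0) f0).
  exists [:: f0], (fun=> 1); split=> // [g|x]; first by rewrite inE => /eqP ->.
  by rewrite big_seq1 mul1r.
have /Amax nP : A `<` A `|` [set f0].
  by split=> [f|/(_ f0 (or_intror erefl))]; [left|move=> ?; apply: nBf; left].
have {nP} : ~ indep ((A `|` [set f0]) `|` B0).
  by move=> h; apply: nP; split=> // f [/Ah//|->].
move=> /existsNP[s /existsNP[c /not_implyP[us /not_implyP[sB /not_implyP[Hs]]]]].
move=> /existsNP[g /not_implyP[gs cg]].
have sB' f : f \in s -> f != f0 -> (A `|` B0) f.
  by move=> /sB[[Af|->]|Bf]; [left|rewrite eqxx|right].
have [f0s|nf0s] := boolP (f0 \in s); last first.
  by case: cg; apply: (Ai s c us) => // f fs; apply: sB' => //; apply: contraNneq nf0s => <-.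
have Hs' x : c f0 * chi x = - \sum_(f <- rem f0 s) c f * f x.
  apply/eqP; rewrite -addr_eq0; have := Hs x.
  by rewrite (big_rem f0) //= => ->.
have rB f : f \in rem f0 s -> (A `|` B0) f.
  by rewrite mem_rem_uniq // inE => /andP[ff0 fs]; apply: sB'.
have cf0 : c f0 != 0.
  apply/eqP => c0; have [gf0|gf0] := eqVneq g f0; first by rewrite gf0 in cg.
  case: cg; apply: (Ai (rem f0 s) c) => //.
  - exact: rem_uniq.
  - by move=> x; apply/eqP; rewrite -oppr_eq0 -Hs' c0 mul0r.
  - by rewrite mem_rem_uniq // inE gf0.
exists (rem f0 s), (fun f => - (c f0)^-1 * c f); split=> //.
  exact: rem_uniq.
move=> x; apply: (mulfI cf0); rewrite Hs' mulr_sumr -sumrN; apply: eq_bigr => f _.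
by rewrite !mulNr mulrN -mulrA mulVKf.
Qed.

(** A basis extending [b] contains a copy of [I] and embeds in [I], so by Cantor and Bernstein it
    can be indexed by [I] again. *)
Lemma addhom_basis_extend (I : choiceType) (b : I -> K -> 'F_p) :
  (forall i, addhom (b i)) -> lin_indep b -> inj_le (K -> 'F_p) I ->
  exists b' : I -> K -> 'F_p, addhom_basis b'.
Proof.
move=> bh bi le; have binj := lin_indep_inj bi.
have [|f [i _ <-] //|B [bB Bi Bh Bspan]] := @addhom_basis_set (range b).
  move=> s c us sb Hs f fs; have [i0 _ i0f] := sb f fs.
  pose g (f : V) : I := xget i0 [set i | b i = f].
  have gK f' : f' \in s -> b (g f') = f'.
    by move=> /sb[i _ <-]; rewrite /g; case: xgetP => [j _ //|/(_ i)/=].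
  have ugs : uniq [seq g f | f <- s].
    by rewrite map_inj_in_uniq // => f1 f2 /gK {2}<- /gK {2}<- ->.
  have := bi _ (c \o b) ugs _ (g f); rewrite /= gK //; apply.
    move=> x; rewrite big_map -[RHS](Hs x) [LHS]big_seq [RHS]big_seq.
    by apply: eq_bigr => f' f's; rewrite /= gK.
  by apply/mapP; exists f.
have [h [h' hK h'K]] : exists h : I -> {f | B f}, bijective h.
  apply: inj_le_antisym.
    have bB' i : B (b i) by apply: bB; exists i.
    by exists (fun i => exist _ _ (bB' i)) => i j [/binj].
  apply: inj_le_trans le; exists sval => -[f Bf] [g Bg] /= fg.
  by apply: eq_exist.
exists (fun i => sval (h i)); split=> [i|s c us Hs|chi chih].
- exact/Bh/(svalP (h i)).
- move=> i si.
  pose g (f : V) := if pselect (B f) is left Bf then h' (exist _ f Bf) else i.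
  have gK j : g (sval (h j)) = j.
    rewrite /g; case: pselect => [Bj|/(_ (svalP (h j)))//].
    by rewrite -[RHS]hK; congr (h' _); case: (h j) Bj => f Bf Bf'; apply: eq_exist.
  have hi : injective (fun j => sval (h j)) by apply: can_inj gK.
  rewrite -(gK i); apply: (Bi [seq sval (h j) | j <- s] (c \o g)).
  + by rewrite map_inj_uniq.
  + by move=> _ /mapP[j _ ->]; apply: (svalP (h j)).
  + move=> x; rewrite big_map -[RHS](Hs x); apply: eq_bigr => j _.
    by rewrite /= gK.
  + by apply/mapP; exists i.
have [s [c [us sB Hs]]] := Bspan chi chih.
have [t ts] : exists t : seq I, s = [seq sval (h j) | j <- t].
  elim: s sB {us Hs} => [|f s IH] sB; first by exists [::].
  have [|t ->] := IH; first by move=> g gs; apply: sB; rewrite inE gs orbT.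
  have Bf := sB f (mem_head _ _).
  by exists (h' (exist _ f Bf) :: t); rewrite /= h'K.
exists t, (fun j => c (sval (h j))); split.
  by move: us; rewrite ts => /map_uniq.
by move=> x; rewrite Hs ts big_map.
Qed.

(** Homomorphisms whose restrictions along [k] are independent are independent, which gives one for
    each subset of [K]. There are no more functions from [K] to ['F_p] than that, as their graphs
    show. The index set is the same for all p. *)
Lemma addhom_basis_pow (k : K -> K) : infinite_set [set: K] ->
  (forall g : K -> 'F_p, exists2 chi, addhom chi & chi \o k = g) ->
  exists b : {classic set K} -> K -> 'F_p, addhom_basis b.
Proof.
move=> Ki kP; have [d di] := lin_indep_subsets p Ki.
have /choice[b bP] : forall X, exists chi, addhom chi /\ chi \o k = d X.
  by move=> X; have [chi] := kP (d X); exists chi.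
apply: (@addhom_basis_extend _ b) => [X||]; first exact: (bP X).1.
  move=> s c us Hs; apply: (di s c us) => x; rewrite -[RHS](Hs (k x)).
  by apply: eq_bigr => X _; rewrite -(bP X).2.
apply: (@inj_le_trans _ (set (K * nat))).
  exists (fun chi => [set x : K * nat | x.2 = val (chi x.1)]) => chi chi' /predeqP H.
  by apply/funext => x; apply/val_inj; exact: (H (x, val (chi x))).1.
exact/inj_le_set/infinite_nat_prod.
Qed.

End Basis.
End Independence.

(** * Finite nilpotent groups *)

Section NilpotentCommutators.
Import fintype boot.finset GroupScope.
Local Open Scope group_scope.

Lemma prodg_move (gT : groupType) (z : gT) (I : Type) (r : seq I) (b : I -> nat)
    (a : I -> gT) : (forall i, commute z (a i)) ->
  \prod_(i <- r) (z ^+ b i * a i) = (\prod_(i <- r) a i) * z ^+ (\sum_(i <- r) b i).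
Proof.
move=> za; elim: r => [|i r IH]; first by rewrite !big_nil mulg1.
rewrite !big_cons IH expgD !mulgA; congr (_ * _).
have zc : commute (z ^+ b i) (a i * \prod_(j <- r) a j).
  apply/commute_sym/commuteX/commute_sym/commuteM; first exact: za.
  by elim/big_rec: _ => [|j x _ h]; [exact: commute1|exact: commuteM].
by rewrite -mulgA zc.
Qed.

Lemma morphim_gen_seq (aT rT : finGroupType) (D : {group aT})
    (f : {morphism D >-> rT}) (s : seq aT) : {subset s <= D} ->
  f @* <<[set x in s]>> = <<[set x in [seq f x | x <- s]]>>.
Proof.
move=> sD; rewrite morphim_gen; last by apply/subsetP => x; rewrite inE => /sD.
congr <<_>>; apply/setP => u; rewrite inE.
apply/morphimP/mapP => [[x _ xs ->]|[x xs ->]]; last by exists x; rewrite ?inE ?sD.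
by exists x => //; rewrite inE in xs.
Qed.

(* Modulo the last nontrivial term Z of the lower central series, an element of
   the derived subgroup is such a product; and [w x, s] = [w, s] [x, s] when
   [w, s] is central, so that the factor in Z can be absorbed. *)
Lemma nilpotent_der1_prod_comm (gT : finGroupType) (P : {group gT}) (s : seq gT) :
  nilpotent P -> <<[set x in s]>> = P -> forall c, c \in P^`(1) ->
  exists x : nat -> gT, (forall i, x i \in P) /\
    c = \prod_(i < size s) [~ x i, nth 1 s i].
Proof.
have [n] := ubnP #|P|; elim: n => // n IH in gT P s * => /ltnSE leP nilP genP.
have sP i : (i < size s)%N -> nth 1 s i \in P.
  by move=> si; rewrite -genP mem_gen // inE mem_nth.
have [ab|nab] := eqVneq P^`(1) 1.
  move=> c; rewrite ab => /set1P ->; exists (fun=> 1); split=> [i|]; first exact: group1.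
  by rewrite big1 // => i _; rewrite comm1g.
have [k Lk Lk1] : exists2 k, 'L_k.+3(P) = 1 & 'L_k.+2(P) <> 1.
  have ex : exists m, 'L_m.+1(P) == 1.
    by have /lcnP[m Lm] := nilP; exists m; apply/eqP.
  case: (ex_minnP ex) => -[|[|k]] /eqP Lk minL.
  - by case/eqP: nab; apply/trivgP; rewrite -Lk lcn1 der_sub.
  - by case/eqP: nab; rewrite -Lk lcn2.
  - by exists k => // /eqP/minL; rewrite ltnn.
pose Z := 'L_k.+2(P); pose L := 'L_k.+1(P).
have ZE : Z = [~: L, P] by rewrite /Z lcnSn.
have sZP : Z \subset P by apply: lcn_sub.
have sLP : L \subset P by apply: lcn_sub.
have nZP : P \subset 'N(Z) by apply: lcn_norm.
have cZ z g : z \in Z -> g \in P -> commute z g.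
  move=> Zz Pg; have : [~ z, g] \in 'L_k.+3(P) by rewrite lcnSn mem_commg.
  by rewrite Lk => /set1P zg; apply/commgP/eqP.
pose C c := exists x : nat -> gT, (forall i, x i \in P) /\
    c = \prod_(i < size s) [~ x i, nth 1 s i].
(* [T] collects the elements of [Z] that every such product can absorb. It is a subgroup; it
   contains the commutators of [L] with the generators, then with all of [P], hence [Z]. *)
pose T := [set z in Z | `[< forall c, C c -> C (c * z) >]].
have gT1 : group_set T.
  apply/group_setP; split=> [|z z'].
    by rewrite inE group1; apply/asboolP => c; rewrite mulg1.
  rewrite !inE => /andP[Zz /asboolP Cz] /andP[Zz' /asboolP Cz'].
  by rewrite groupM //; apply/asboolP => c Cc; rewrite mulgA; apply/Cz'/Cz.
have comP x g : x \in P -> g \in P -> [~ x, g] \in P.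
  by move=> Px Pg; rewrite groupR.
have Ts w t : w \in L -> t \in s -> [~ w, t] \in T.
  move=> Lw ts; have Pt : t \in P by rewrite -genP mem_gen // inE.
  have Zwt : [~ w, t] \in Z by rewrite ZE mem_commg.
  rewrite inE Zwt; apply/asboolP => c [x [Px ->]].
  exists (fun i => if i == index t s then w * x i else x i); split=> [i|].
    by case: eqP => // _; rewrite groupM // (subsetP sLP).
  have E (i : 'I_(size s)) :
      [~ if i == index t s :> nat then w * x i else x i, nth 1 s i] =
      [~ w, t] ^+ (i == index t s :> nat) * [~ x i, nth 1 s i].
    case: eqP => [->|_]; last by rewrite mul1g.
    rewrite nth_index // expg1 commMgJ; congr (_ * _).
    by rewrite /conjg (cZ _ _ Zwt (Px _)) mulKg.
  rewrite (eq_bigr _ (fun i _ => E i)) prodg_move; last first.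
    by move=> i; apply: cZ => //; apply: comP => //; apply: sP.
  congr (_ * _); rewrite -index_mem in ts.
  rewrite (bigD1 (Ordinal ts)) //= eqxx big1 ?addn0 ?expg1 // => i.
  by rewrite -val_eqE /= => /negPf ->.
pose TG := Group gT1.
have TP w g : w \in L -> g \in P -> [~ w, g] \in TG.
  pose H := [set g in P | [forall w in L, [~ w, g] \in T]].
  have gH : group_set H.
    apply/group_setP; split=> [|g1 g2].
      by rewrite inE group1; apply/forall_inP => v _; rewrite commg1 (group1 TG).
    rewrite !inE => /andP[P1 /forall_inP H1] /andP[P2 /forall_inP H2].
    rewrite groupM //; apply/forall_inP => v Lv; rewrite commgMJ.
    have Zc : [~ v, g1] \in Z by rewrite ZE mem_commg.
    rewrite /conjg (cZ _ _ Zc P2) mulKg.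
    exact: (groupM (G := TG)) (H2 v Lv) (H1 v Lv).
  have : P \subset H.
    rewrite -{1}genP (gen_subG _ (Group gH)); apply/subsetP => t; rewrite inE => ts.
    rewrite inE -genP mem_gen ?inE //; apply/forall_inP => v Lv; exact: Ts.
  by move=> /subsetP PH Lw /PH; rewrite inE => /andP[_ /forall_inP]; apply.
have ZT : Z \subset TG.
  rewrite ZE gen_subG; apply/subsetP => _ /imset2P[w g Lw Pg ->]; exact: TP.
move=> c Pc.
have [||||x [Px cx]] := IH _ (P / Z)%G [seq coset Z x | x <- s] _ _ _ (coset Z c).
- apply: leq_trans leP; rewrite ltn_quotient //.
  by apply/eqP; exact: Lk1.
- exact: quotient_nil.
- rewrite /= -morphim_gen_seq ?genP // => x xs.
  by rewrite (subsetP nZP) // -genP mem_gen // inE.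
- by rewrite /= -quotient_der // mem_quotient.
have /choice[y yP] i : exists y, y \in P /\ coset Z y = x i.
  by have /morphimP[y _ Py ->] := Px i; exists y.
pose c' := \prod_(i < size s) [~ y i, nth 1 s i].
have Pc' : c' \in P.
  by apply: group_prod => i _; apply: comP; rewrite ?sP //; apply: (yP _).1.
have cc' : coset Z c = coset Z c'.
  have Ny i : y i \in 'N(Z) by rewrite (subsetP nZP) ?(yP i).1.
  have Ns (i : 'I_(size s)) : nth 1 s i \in 'N(Z) by rewrite (subsetP nZP) ?sP.
  rewrite cx size_map /c' morph_prod => [|i _]; last by rewrite groupR.
  apply: eq_bigr => i _; rewrite morphR //.
  by congr [~ _, _]; [rewrite -(yP i).2|rewrite (nth_map 1)].
have : c'^-1 * c \in Z.
  have Pcc : c'^-1 * c \in P by rewrite groupM ?groupV // (subsetP (der_sub 1 P)).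
  apply: coset_idr; first exact: subsetP nZP _ Pcc.
  have Nc : c \in 'N(Z) by apply: subsetP nZP _ (subsetP (der_sub 1 P) _ Pc).
  have Nc' : c'^-1 \in 'N(Z) by rewrite groupV (subsetP nZP).
  by rewrite morphM // morphV ?(subsetP nZP) //= cc' mulVg.
move=> /(subsetP ZT); rewrite [_ \in TG]inE => /andP[_ /asboolP/(_ c')].
rewrite mulKVg; apply; exists y; split=> // i; exact: (yP i).1.
Qed.

End NilpotentCommutators.

Section PowersAndCommutators.
Import fintype boot.finset GroupScope.
Local Open Scope group_scope.

Lemma abelian_gen_prod (gT : finGroupType) (A : {group gT}) (p : nat) (t : seq gT) :
  (0 < p)%N -> abelian A -> {in A, forall x, x ^+ p = 1} ->
  {subset t <= A} -> forall g, g \in <<[set x in t]>> ->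
  exists e : nat -> nat, (forall i, e i < p)%N /\
    g = \prod_(i < size t) nth 1 t i ^+ e i.
Proof.
move=> p0 abA Ap; elim: t => [|x t IH] tA g.
  have /subsetP/(_ g) : <<[set y in [::] : seq gT]>> \subset [1 gT].
    by rewrite gen_subG; apply/subsetP => y; rewrite inE.
  move=> /[apply]/set1P ->; exists (fun=> 0%N); split=> //.
  by rewrite big_ord0.
have xA : x \in A by apply: tA; apply: mem_head.
have {}tA : {subset t <= A} by move=> y yt; apply: tA; rewrite inE yt orbT.
have -> : [set y in x :: t] = x |: [set y in t] by apply/setP => y; rewrite !inE.
have stA : <<[set y in t]>> \subset A.
  by rewrite gen_subG; apply/subsetP => y; rewrite inE => /tA.
rewrite -joingE -joing_idl -joing_idr cent_joinEl; last first.
  by rewrite cycle_subG; apply: subsetP (subset_trans abA (centS stA)) _ xA.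
move=> /mulsgP[_ h /cycleP[k ->] /(IH tA)[e [ep ->]] ->].
exists (fun i => if i is j.+1 then e j else k %% p)%N; split=> [[|i]//|].
  by rewrite ltn_mod.
by rewrite big_ord_recl /= {1}(divn_eq k p) expgD mulnC expgM (Ap _ xA) expg1n mul1g.
Qed.

Variables (gT : finGroupType) (P : {group gT}) (p : nat).
Hypothesis p0 : (0 < p)%N.

(** The subgroup generated by p-th powers and commutators. Modulo the derived subgroup the p-th
    powers already form a subgroup, so a single power suffices. *)
Definition pder : {set gT} :=
  [set h in P | [exists y in P, coset P^`(1) h == coset P^`(1) y ^+ p]].

Let abD : abelian (P / P^`(1)). Proof. exact: der_abelian. Qed.
Let ND x : x \in P -> x \in 'N(P^`(1)). Proof. exact/subsetP/der_norm. Qed.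

Lemma pder_group_set : group_set pder.
Proof.
apply/group_setP; split=> [|x y].
  rewrite inE group1; apply/exists_inP; exists 1; first exact: group1.
  by rewrite morph1 expg1n.
rewrite !inE => /andP[Px /exists_inP[u Pu /eqP ux]] /andP[Py /exists_inP[v Pv /eqP vy]].
rewrite groupM //; apply/exists_inP; exists (u * v); first exact: groupM.
rewrite !morphM ?ND //= ux vy expgMn //.
by apply: (centsP abD); apply: mem_quotient.
Qed.
Canonical pder_group := Group pder_group_set.

Lemma pderP h : reflect (exists y c, [/\ y \in P, c \in P^`(1) & h = y ^+ p * c])
  (h \in pder).
Proof.
rewrite inE; apply: (iffP andP) => [[Ph /exists_inP[y Py /eqP hy]]|[y [c [Py Pc ->]]]].
  have Pyp : y ^+ p \in P by rewrite groupX.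
  exists y, ((y ^+ p)^-1 * h); split; rewrite ?mulKVg //.
  apply: coset_idr; first by rewrite ND // groupM ?groupV.
  by rewrite morphM ?morphV ?morphX ?groupV ?ND //= hy mulVg.
have Pc' := subsetP (der_sub 1 P) _ Pc.
split; first by rewrite groupM ?groupX.
apply/exists_inP; exists y => //.
by rewrite morphM ?morphX ?ND ?groupX //= (coset_id Pc) mulg1.
Qed.

Lemma pder_sub : pder \subset P.
Proof. by apply/subsetP => x; rewrite inE => /andP[]. Qed.

(** The quotient by [pder] is abelian and killed by p. The exponents of the representatives range
    over a finite set depending only on p and [size s], so finitely many words serve all finite
    quotients of a group at once. *)
Lemma pder_gen_prod (s : seq gT) : <<[set x in s]>> = P -> forall g, g \in P ->
  exists e : nat -> nat, (forall i, e i < p)%N /\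
    (\prod_(i < size s) nth 1 s i ^+ e i)^-1 * g \in pder.
Proof.
move=> genP g Pg.
have sP i : (i < size s)%N -> nth 1 s i \in P.
  by move=> si; rewrite -genP mem_gen // inE mem_nth.
have DV : P^`(1) \subset pder.
  apply/subsetP => c Pc; apply/pderP; exists 1, c.
  by rewrite expg1n mul1g group1.
have nV : P \subset 'N(pder) by apply: sub_der1_norm => //; apply: pder_sub.
have NV x : x \in P -> x \in 'N(pder) by apply: subsetP.
have ts : {subset s <= 'N(pder)}.
  by move=> x xs; rewrite NV // -genP mem_gen // inE.
have [||||e [ep ge]] :=
    @abelian_gen_prod _ (P / pder)%G p [seq coset pder x | x <- s] p0 _ _ _ (coset pder g).
- by rewrite /= sub_der1_abelian.
- move=> _ /morphimP[x Nx Px ->]; rewrite -morphX //; apply: coset_id.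
  by apply/pderP; exists x, 1; rewrite group1 mulg1.
- move=> _ /mapP[x xs ->]; apply: mem_quotient.
  by rewrite -genP mem_gen // inE.
- by rewrite -morphim_gen_seq // genP mem_quotient.
have sN (i : 'I_(size s)) : nth 1 s i ^+ e i \in 'N(pder) by rewrite groupX ?NV ?sP.
have pN : \prod_(i < size s) nth 1 s i ^+ e i \in 'N(pder) by apply: group_prod.
exists e; split=> //; apply: coset_idr; first by rewrite groupM ?groupV //; apply: NV.
rewrite morphM ?morphV ?groupV //=; last exact: NV.
rewrite ge size_map.
rewrite morph_prod // (eq_bigr (fun i : 'I__ => coset pder (nth 1 s i) ^+ e i)).
  by rewrite [X in _ * X](eq_bigr (fun i : 'I__ => coset pder (nth 1 s i) ^+ e i))
    ?mulVg // => i _; rewrite (nth_map 1).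
by move=> i _; rewrite morphX ?NV ?sP //.
Qed.
End PowersAndCommutators.

Section NilpotentCriterion.
Import fintype boot.finset GroupScope.
Local Open Scope group_scope.

Lemma Sylow_subset_eq (gT : finGroupType) (G H : {group gT}) : H \subset G ->
  (forall p, prime p -> exists2 P : {group gT}, p.-Sylow(G) P & P \subset H) ->
  H :=: G.
Proof.
move=> sHG sylH; apply/eqP; rewrite eqEcard sHG dvdn_leq ?cardG_gt0 //.
apply/dvdn_partP => [|p]; first exact: cardG_gt0.
rewrite mem_primes => /and3P[/sylH[P sylP sPH] _ _].
by rewrite -(card_Hall sylP) cardSg.
Qed.

(** Sylow subgroups for different primes centralize each other, so the normalizer of a Sylow
    subgroup contains a Sylow subgroup for every prime and is everything. The Fitting subgroup then
    contains all Sylow subgroups. *)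
Lemma nilpotent_coprime_commute (gT : finGroupType) (G : {group gT}) :
  (forall x y, x \in G -> y \in G -> coprime #[x] #[y] -> commute x y) ->
  nilpotent G.
Proof.
move=> comG; suff nSyl p (P : {group gT}) : prime p -> p.-Sylow(G) P -> P <| G.
  suff <- : 'F(G) = G by apply: Fitting_nil.
  apply: Sylow_subset_eq => [|p pr]; first exact: Fitting_sub.
  have [P sylP] := Sylow_exists p G; exists P => //.
  rewrite Fitting_max ?(nSyl p) //.
  exact: pgroup_nil (pHall_pgroup sylP).
move=> pr sylP; have sPG := pHall_sub sylP.
rewrite /normal sPG; have <- : 'N_G(P) = G; last exact: subsetIr.
apply: Sylow_subset_eq => [|q qr]; first exact: subsetIl.
have [<-|pq] := eqVneq p q; first by exists P => //; rewrite subsetI sPG normG.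
have [Q sylQ] := Sylow_exists q G; exists Q => //.
rewrite subsetI (pHall_sub sylQ) cents_norm //.
apply/centsP => x Qx y Py; apply: comG.
- exact: subsetP (pHall_sub sylQ) _ Qx.
- exact: subsetP sPG _ Py.
apply: (@pnat_coprime q).
  exact: mem_p_elt (pHall_pgroup sylQ) Qx.
apply: sub_in_pnat (mem_p_elt (pHall_pgroup sylP) Py) => r _ /eqP ->.
by rewrite !inE.
Qed.

Lemma finite_Cauchy_center (gT : finGroupType) : nilpotent [set: gT] ->
  [set: gT] != 1 -> exists z : gT, prime #[z] /\ forall x, commute z x.
Proof.
move=> nil nt; have : 'Z([set: gT]) != 1.
  by rewrite center_nil_eq1.
rewrite -cardG_gt1 => /pdiv_prime pr.
have [z Zz oz] := Cauchy pr (pdiv_dvd _).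
exists z; rewrite oz; split=> // x; move/centerP: Zz => [_]; apply.
by rewrite inE.
Qed.

End NilpotentCriterion.

Section Wreath.
Variables (P B : finGroupType).

(* The wreath product of [B] by [P] acting on its subsets by right translation *)
Definition wreath : Type := (P * {ffun {set P} -> B})%type.
HB.instance Definition _ := Finite.on wreath.

Import fintype boot.finset GroupScope.
Local Open Scope group_scope.

Implicit Types x y z : wreath.

Definition wreath_one : wreath := (1, [ffun=> 1]).
Definition wreath_mul x y : wreath :=
  (x.1 * y.1, [ffun S : {set P} => x.2 S * y.2 (S :* x.1)]).
Definition wreath_inv x : wreath :=
  (x.1^-1, [ffun S : {set P} => (x.2 (S :* x.1^-1))^-1]).

Lemma wreath_mulA : associative wreath_mul.
Proof.
move=> [g u] [h v] [k w]; rewrite /wreath_mul /= mulgA; congr (_, _).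
by apply/ffunP => S; rewrite !ffunE /= rcosetM mulgA.
Qed.

Lemma wreath_mul1 : left_id wreath_one wreath_mul.
Proof.
move=> [g u]; rewrite /wreath_mul /= mul1g; congr (_, _).
by apply/ffunP => S; rewrite !ffunE /= rcoset1 mul1g.
Qed.

Lemma wreath_mulV : left_inverse wreath_one wreath_inv wreath_mul.
Proof.
move=> [g u]; rewrite /wreath_mul /= mulVg; congr (_, _).
by apply/ffunP => S; rewrite !ffunE /= mulVg.
Qed.

HB.instance Definition _ :=
  Finite_isGroup.Build wreath wreath_mulA wreath_mul1 wreath_mulV.

Lemma wreath_sndE x y (S : {set P}) : (x * y).2 S = x.2 S * y.2 (S :* x.1).
Proof. by rewrite ffunE. Qed.

Lemma wreath_pgroup (p : nat) :
  p.-group [set: P] -> p.-group [set: B] -> p.-group [set: wreath].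
Proof.
rewrite /pgroup !cardsT card_prod card_ffun => pP pB.
by rewrite pnatM pP pnatX pB.
Qed.

End Wreath.

(** * Homomorphisms from free pronilpotent groups to p-groups *)

Section Presentation.
Local Open Scope classical_set_scope.
Local Open Scope group_scope.

(* [q] exhibits [F] as the limit of the finite nilpotent groups [N l]; the
   compactness of [F] is expressed by cluster points of families of nets. *)
Record pronil_pres (F : groupType) (L : Type) (N : L -> finGroupType)
    (q : forall l, F -> N l) : Prop := PronilPres {
  pres_inh : inhabited L;
  pres_hom : forall l, monoid_morphism (q l);
  pres_nil : forall l, nilpotent [set: N l]%G;
  pres_dir : forall l m, exists n, forall x,
    q n x = 1 -> q l x = 1 /\ q m x = 1;
  pres_sep : forall x, (forall l, q l x = 1) -> x = 1;
  pres_cluster : forall (D : Type) (le : D -> D -> Prop), inhabited D ->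
    (forall x y z, le x y -> le y z -> le x z) ->
    (forall x y, exists z, le x z /\ le y z) ->
    forall (A : Type) (x : D -> A -> F), exists y : A -> F,
    forall l (E : set A) d0, finite_set E ->
      exists d, le d0 d /\ forall a, E a -> q l (x d a) = q l (y a)
}.

Lemma morph1g (G H : groupType) (f : G -> H) : monoid_morphism f -> f 1 = 1.
Proof. by case. Qed.
Lemma morphMg (G H : groupType) (f : G -> H) : monoid_morphism f ->
  forall x y, f (x * y) = f x * f y.
Proof. by case. Qed.
Lemma morphVg (G H : groupType) (f : G -> H) : monoid_morphism f ->
  forall x, f x^-1 = (f x)^-1.
Proof.
by move=> [f1 fM] x; apply: (mulgI (f x)); rewrite -fM !mulgV f1.
Qed.
Lemma morphXg (G H : groupType) (f : G -> H) : monoid_morphism f ->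
  forall x n, f (x ^+ n) = f x ^+ n.
Proof.
move=> [f1 fM] x; elim=> [|n IH]; first by rewrite !expg0.
by rewrite !expgS fM IH.
Qed.

(** By directedness the fibres of the single projections generate a filter; it converges to [x]
    because it does so in each coordinate. *)
Lemma nbhs_inverse_limit (S : inverse_system) (x : inverse_limit S) U :
  nbhs x U -> exists i, forall y, thread y i = thread x i -> U y.
Proof.
pose P := prod_topology (fun i : inv_index S => discrete_topology (S i)).
have [[i0 _] [_ _ _ dir]] := inv_directed S.
pose F : set_system P := fun A => exists i, forall y : inverse_limit S,
  thread y i = thread x i -> A (set_val y).
have FF : Filter F.
  split=> [|A B [i iA] [j jB]|A B AB [i iA]].
  - by exists i0.
  - have [k [ik jk]] := dir i j; exists k => y yk; split.
      by apply: iA; rewrite -(threadP y ik) yk threadP.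
    by apply: jB; rewrite -(threadP y jk) yk threadP.
  - by exists i => y /iA/AB.
have cvgF : F --> (set_val x : P).
  apply/(cvg_sup _ _ _) => i A [_ [[B Bop <-] /= Bx] BA].
  by exists i => y yx; apply: BA; rewrite /= -[set_val y i]/(thread y i) yx.
move=> [_ [[W Wop <-] /= Wx] WU].
have [i iW] : F W by apply: cvgF; apply: open_nbhs_nbhs.
by exists i => y /iW Wy; apply: WU.
Qed.

(** The kernels of the [q l] form a neighbourhood basis of 1. Arguments about possibly discontinuous
    homomorphisms can then work with this algebraic data alone. *)
Lemma pronilpotent_presP (G : topGroupType) : pronilpotent G ->
  exists (L : Type) (N : L -> finGroupType) (q : forall l, G -> N l),
    [/\ pronil_pres q, forall l, nbhs (1 : G) [set x | q l x = 1] &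
        forall U, nbhs (1 : G) U -> exists l, forall x, q l x = 1 -> U x].
Proof.
move=> [S [Snil [f [fM fc [g [fK gK gc]]]]]].
have [[i0 _] [_ _ _ dir]] := inv_directed S.
have /choice[N NP] : forall i, exists N : finGroupType, exists k : S i -> N,
    group_iso k /\ nilpotent [set: N]%G by exact: Snil.
have k_ex i : exists k : S i -> N i, group_iso k by have [k []] := NP i; exists k.
pose k i := projT1 (cid (k_ex i)).
have kM i : monoid_morphism (@k i) by case: (projT2 (cid (k_ex i))).
have kbij i : bijective (@k i) by case: (projT2 (cid (k_ex i))).
have thM i : monoid_morphism (fun x : inverse_limit S => thread x i) by [].
pose q i x := k i (thread (f x) i).
have qM i : monoid_morphism (q i).
  by split=> [|x y]; rewrite /q ?(morph1g fM) ?(morphMg fM) ?(morphMg (kM i)) ?(morph1g (kM i)).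
have qE i x y : q i x = q i y <-> thread (f x) i = thread (f y) i.
  by rewrite /q; split=> [/(bij_inj (kbij i))|->].
have q1 i x : q i x = 1 <-> thread (f x) i = 1.
  by rewrite -(morph1g (qM i)) qE (morph1g fM).
have q_le i j x : inv_le i j -> q j x = 1 -> q i x = 1.
  by move=> ij /q1 xj; apply/q1; rewrite -(threadP (f x) ij) xj (morph1g (inv_mapM ij)).
exists (inv_index S), N, q; split.
- split=> //.
  + by move=> i; have [? []] := NP i.
  + by move=> i j; have [m [im jm]] := dir i j; exists m => x qx; split;
      apply: q_le qx.
  + move=> x qx; rewrite -(fK x) (_ : f x = f 1) ?fK //.
    by apply: thread_inj => i; rewrite (morph1g fM); apply/q1.
  + move=> D le D0 le_tr le_dir A x.
    have Sfin i : finite_set [set: S i].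
      by have [h hK _] := kbij i; apply: (@finite_preimage _ _ [set: N i] (k i));
        [move=> u v _ _ /(can_inj hK)|apply: finite_finset].
    have [y yP] := @net_cluster D le D0 le_tr le_dir (A * inv_index S)
      (fun ai => S ai.2) (fun d ai => thread (f (x d ai.1)) ai.2)
      (fun ai => Sfin ai.2).
    have [d0] := D0.
    have yth a i j : inv_le i j -> inv_map i (y (a, j)) = y (a, i).
      move=> ij; have [d [_ yd]] := yP [set (a, i); (a, j)] d0 (finite_set2 _ _).
      by rewrite -!yd /=; [apply: threadP|left|right].
    exists (fun a => g (mk_thread (yth a))) => l E d1 Ef.
    have [d [dd1 yd]] := yP [set (a, l) | a in E] d1 (finite_image _ Ef).
    exists d; split=> // a Ea; apply/qE; rewrite gK /=.
    by apply: (yd (a, l)); exists a.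
- move=> i.
  have H : nbhs (1 : G) [set x | thread (f x) i = thread (f 1) i].
    exact: (fc 1 _ (near_thread i (f 1))).
  apply: filterS H => x /= xi; apply/q1.
  by rewrite xi (morph1g fM).
- move=> U U1; have : nbhs (f 1) (g @^-1` U).
    by have := gc (f 1) U; rewrite fK => /(_ U1).
  move=> /nbhs_inverse_limit[i iU]; exists i => x /q1 xi.
  by rewrite -(fK x); apply: iU; rewrite (morph1g fM).
Qed.

End Presentation.

Section Generation.
Local Open Scope group_scope.
Variable F : groupType.
Implicit Types (s : seq F) (g : F).

Definition gen s g : Prop := forall H : F -> Prop, H 1 ->
  (forall x y, H x -> H y -> H (x * y)) -> (forall x, H x -> H x^-1) ->
  (forall x, x \in s -> H x) -> H g.

Lemma gen1 s : gen s 1. Proof. by []. Qed.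
Lemma genM s x y : gen s x -> gen s y -> gen s (x * y).
Proof. by move=> gx gy H H1 HM HV Hs; exact: HM (gx H H1 HM HV Hs) (gy H H1 HM HV Hs). Qed.
Lemma genV s x : gen s x -> gen s x^-1.
Proof. by move=> gx H H1 HM HV Hs; exact: HV (gx H H1 HM HV Hs). Qed.
Lemma gen_mem s x : x \in s -> gen s x.
Proof. by move=> xs H H1 HM HV; apply. Qed.
Lemma gen_nth s (i : 'I_(size s)) : gen s (nth 1 s i).
Proof. apply: gen_mem; apply: mem_nth; exact: ltn_ord. Qed.
Lemma genX s x n : gen s x -> gen s (x ^+ n).
Proof. by move=> gx; elim: n => [|n IH]; rewrite ?expg0 ?expgS //; apply: genM. Qed.
Lemma gen_sub s t g : (forall x, x \in s -> gen t x) -> gen s g -> gen t g.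
Proof.
by move=> st gg; exact: gg (gen t) (@gen1 t) (@genM t) (@genV t) st.
Qed.

Lemma gen_ind_right s (P : F -> Prop) : P 1 ->
  (forall g x, P g -> x \in s -> P (g * x)) ->
  (forall g x, P g -> x \in s -> P (g * x^-1)) ->
  forall g, gen s g -> P g.
Proof.
(* The equivalence of [P u] and [P (u * g)] for all [u] is stable under products and inverses of
   [g], unlike [P] itself. *)
move=> P1 PM PV g gg; suff H u : P u <-> P (u * g) by rewrite -[g]mul1g -H.
move: u; apply: (gg (fun g => forall u, P u <-> P (u * g)))
  => [u|x y Hx Hy u|x Hx u|x xs u].
- by rewrite mulg1.
- by rewrite mulgA -Hy -Hx.
- by rewrite [P (u * _)]Hx mulgKV.
- split=> [Pu|Pux]; first exact: PM.
  by rewrite -(mulgK x u); apply: PV.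
Qed.

Import fintype boot.finset GroupScope.

Lemma gen_image (A : finGroupType) (f : F -> A) s g : monoid_morphism f ->
  gen s g -> f g \in <<[set x in [seq f x | x <- s]]>>.
Proof.
move=> fM gg; apply: (gg (fun g => f g \in _)) => [|x y fx fy|x fx|x xs].
- by rewrite (morph1g fM) group1.
- by rewrite (morphMg fM) groupM.
- by rewrite (morphVg fM) groupV.
- by rewrite mem_gen // inE map_f.
Qed.

Lemma image_gen (A : finGroupType) (f : F -> A) s a : monoid_morphism f ->
  a \in <<[set x in [seq f x | x <- s]]>> -> exists2 g, gen s g & f g = a.
Proof.
move=> fM; pose H : {set A} := [set a | `[< exists2 g, gen s g & f g = a >]].
have gH : group_set H.
  apply/group_setP; split=> [|x y].
    by rewrite inE; apply/asboolP; exists 1; rewrite ?(morph1g fM).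
  rewrite !inE => /asboolP[g gg <-] /asboolP[h gh <-]; apply/asboolP.
  by exists (g * h); rewrite ?(morphMg fM) //; apply: genM.
suff /subsetP sH : <<[set x in [seq f x | x <- s]]>> \subset Group gH.
  by move=> /sH; rewrite inE => /asboolP.
rewrite gen_subG; apply/subsetP => x; rewrite !inE => /mapP[g gs ->].
by apply/asboolP; exists g => //; apply: gen_mem.
Qed.

End Generation.

(** * Serre's argument for homomorphisms to finite p-groups *)

Section Serre.
Import fintype boot.finset GroupScope.
Local Open Scope group_scope.
Variables (F : groupType) (L : Type) (N : L -> finGroupType) (q : forall l, F -> N l).
Hypothesis Fq : pronil_pres q.
Implicit Types (s : seq F) (g x y : F).

Let qM l := pres_hom Fq l.

Definition pres_le (l m : L) : Prop := forall x, q m x = 1 -> q l x = 1.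

Lemma pres_leE l m x y : pres_le l m -> q m x = q m y -> q l x = q l y.
Proof.
move=> lm e; apply: (mulIg (q l y)^-1); rewrite mulgV -!(morphVg (qM l)) -!(morphMg (qM l)).
by apply: lm; rewrite (morphMg (qM m)) (morphVg (qM m)) e mulgV.
Qed.

Lemma pres_le_trans l m n : pres_le l m -> pres_le m n -> pres_le l n.
Proof. by move=> lm mn x /mn/lm. Qed.

Lemma pres_le_dir l m : exists n, pres_le l n /\ pres_le m n.
Proof. by have [n nP] := pres_dir Fq l m; exists n; split=> x /nP[]. Qed.

(** The closure of the subgroup generated by [s]. *)
Definition topgen s g : Prop := forall l, exists2 h, gen s h & q l h = q l g.

Lemma gen_topgen s g : gen s g -> topgen s g.
Proof. by move=> gg l; exists g. Qed.
Lemma topgenM s x y : topgen s x -> topgen s y -> topgen s (x * y).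
Proof.
move=> gx gy l; have [x' gx' xx] := gx l; have [y' gy' yy] := gy l.
by exists (x' * y'); rewrite ?(morphMg (qM l)) ?xx ?yy //; apply: genM.
Qed.
Lemma topgenV s x : topgen s x -> topgen s x^-1.
Proof.
move=> gx l; have [x' gx' xx] := gx l.
by exists x'^-1; rewrite ?(morphVg (qM l)) ?xx //; apply: genV.
Qed.
Lemma topgen_sub s t g : (forall x, x \in s -> gen t x) -> topgen s g -> topgen t g.
Proof. by move=> st gg l; have [h gh e] := gg l; exists h => //; apply: gen_sub gh. Qed.

Definition power_comms p s y (x : nat -> F) : F :=
  y ^+ p * \prod_(i < size s) [~ x i, nth 1 s i].

Lemma morph_power_comms (A : groupType) (f : F -> A) p s y (x : nat -> F) : monoid_morphism f ->
  f (power_comms p s y x) =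
  f y ^+ p * \prod_(i < size s) [~ f (x i), f (nth 1 s i)].
Proof.
move=> fM; rewrite (morphMg fM) (morphXg fM); congr (_ * _).
elim: (index_enum _) => [|i r IH]; first by rewrite !big_nil (morph1g fM).
by rewrite !big_cons (morphMg fM) IH /commg /conjg !(morphMg fM) !(morphVg fM).
Qed.

Local Notation P s l := <<[set x in [seq q l x | x <- s]]>>%G.

(** Nilpotency of [N l] bounds the number of commutators by [size s], the same bound for every
    [l]. *)
Lemma pder_presP p s l g :
  (exists y (x : nat -> F), [/\ gen s y, forall i, gen s (x i) & q l g = q l (power_comms p s y x)]) <->
  q l g \in pder (P s l) p.
Proof.
have qgen := gen_image (qM l); split=> [[y [x [gy gx ->]]]|].
  rewrite (morph_power_comms _ _ _ _ (qM l)).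
  apply/pderP; exists (q l y), (\prod_(i < size s) [~ q l (x i), q l (nth 1 s i)]).
  split; [exact: qgen gy| |by []].
  apply: group_prod => i _; apply: mem_commg; apply: qgen; first exact: gx.
  exact: gen_nth.
move=> /pderP[u [c [Pu Pc ->]]]; have [y gy <-] := image_gen (qM l) Pu.
have nilP : nilpotent (P s l) by apply: nilpotentS (pres_nil Fq l); apply: subsetT.
have [v [Pv ->]] := nilpotent_der1_prod_comm nilP erefl Pc.
have /choice[x xP] : forall i, exists x, gen s x /\ q l x = v i.
  by move=> i; have [x gx <-] := image_gen (qM l) (Pv i); exists x.
exists y, x; split=> // [i|]; first exact: (xP i).1.
rewrite (morph_power_comms _ _ _ _ (qM l)) size_map; congr (_ * _).
by apply: eq_bigr => i _; rewrite (xP i).2 (nth_map 1).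
Qed.

Lemma pder_pres_le p s l m g : pres_le l m ->
  q m g \in pder (P s m) p -> q l g \in pder (P s l) p.
Proof.
move=> lm /pder_presP[y [x [gy gx e]]]; apply/pder_presP; exists y, x.
by split=> //; apply: pres_leE lm e.
Qed.

(** The equation has the same finitely many unknowns modulo every kernel, so its solutions cluster
    to a solution in [F]. The entries of the limit are no longer words in [s] but limits of words,
    hence [topgen]. *)
Lemma pder_compact p s g : (forall l, q l g \in pder (P s l) p) ->
  exists y (x : nat -> F), [/\ topgen s y, forall i, topgen s (x i) & g = power_comms p s y x].
Proof.
move=> Hg; have /choice[u uP] : forall l, exists u : nat -> F,
    (forall i, gen s (u i)) /\ q l g = q l (power_comms p s (u 0%N) (fun i => u i.+1)).
  move=> l; have /pder_presP[y [x [gy gx e]]] := Hg l.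
  (* Coordinate 0 holds the base of the p-th power, the later ones the commutator entries. *)
  by exists (fun i => if i is j.+1 then x j else y); split=> // -[|i].
have [l0] := pres_inh Fq.
have [w wP] := pres_cluster Fq (pres_inh Fq) pres_le_trans pres_le_dir u.
have wtop i : topgen s (w i).
  move=> l; have [d [_ dw]] := wP l [set i]%classic l (finite_set1 _).
  by exists (u d i); [exact: (uP d).1|exact: dw].
exists (w 0%N), (fun i => w i.+1); split=> //.
apply/eqP; rewrite -(can_eq (mulgK (power_comms p s (w 0%N) (fun i => w i.+1))^-1)).
rewrite mulgV; apply/eqP/(pres_sep Fq) => l.
have [|d [ld dw]] := wP l [set i | (i < (size s).+1)%N]%classic l.
  exact: finite_II.
rewrite (morphMg (qM l)) (morphVg (qM l)); apply/eqP; rewrite mulg_eq1 invgK; apply/eqP.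
rewrite (pres_leE ld (uP d).2) !(morph_power_comms _ _ _ _ (qM l)) dw //.
by congr (_ * _); apply: eq_bigr => i _; rewrite dw //= ltnS.
Qed.

Variables (p : nat) (A : finGroupType) (phi : F -> A).
Hypotheses (pr : prime p) (pA : p.-group [set: A]) (phiM : monoid_morphism phi).

Definition topgen_image s : {set A} :=
  [set a | `[< exists2 g, topgen s g & phi g = a >]].

Lemma topgen_image_group s : group_set (topgen_image s).
Proof.
apply/group_setP; split=> [|x y].
  by rewrite inE; apply/asboolP; exists 1; [apply: gen_topgen|rewrite (morph1g phiM)].
rewrite !inE => /asboolP[g gg <-] /asboolP[h gh <-]; apply/asboolP.
by exists (g * h); rewrite ?(morphMg phiM) //; apply: topgenM.
Qed.
Canonical topgen_image_Group s := Group (topgen_image_group s).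

Lemma topgen_imageP s g : topgen s g -> phi g \in topgen_image s.
Proof. by move=> gg; rewrite inE; apply/asboolP; exists g. Qed.

Lemma finite_bound (I : finType) (f : I -> L) : exists l, forall i, pres_le (f i) l.
Proof.
have [l0] := pres_inh Fq.
suff [l lP] : exists l, forall i, i \in enum I -> pres_le (f i) l.
  by exists l => i; apply: lP; rewrite mem_enum.
elim: (enum I) => [|i r [l IH]]; first by exists l0.
have [m [lm im]] := pres_le_dir l (f i); exists m => j.
by rewrite inE => /orP[/eqP ->//|/IH jl]; apply: pres_le_trans lm.
Qed.

(** [M] is normal of index p in the image, so [phi] sends p-th powers and commutators of the closure
    into [M]. Modulo such elements there are only the finitely many words [se e], and one [l]
    detects every word that fails to be of this kind. *)
Lemma serre_step s (M : {group A}) : maximal M (topgen_image s) ->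
  exists l, forall g, topgen s g -> q l g = 1 -> phi g \in M.
Proof.
move=> maxM; set Q := topgen_image_Group s.
have pQ : p.-group Q by apply: pgroupS pA; apply: subsetT.
have nMQ := p_maximal_normal pQ maxM; have iM := p_maximal_index pQ maxM.
have nQ : Q \subset 'N(M) := normal_norm nMQ.
have cQM : cyclic (Q / M) by rewrite prime_cyclic // card_quotient // iM.
have dM : Q^`(1) \subset M by rewrite der1_min // cyclic_abelian.
have XM a : a \in Q -> a ^+ p \in M.
  move=> Qa; apply: coset_idr; first by rewrite (subsetP nQ) ?groupX.
  rewrite morphX ?(subsetP nQ) //= -iM -card_quotient // expg_cardG //.
  exact: mem_quotient.
have inM g : (forall l, q l g \in pder (P s l) p) -> phi g \in M.
  move=> /pder_compact[y [x [gy gx ->]]].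
  rewrite (morph_power_comms _ _ _ _ phiM) groupM ?XM ?topgen_imageP //.
  apply: group_prod => i _; apply: (subsetP dM).
  apply: mem_commg; apply: topgen_imageP; first exact: gx.
  apply: gen_topgen; exact: gen_nth.
pose se (e : {ffun 'I_(size s) -> 'I_p}) := \prod_(i < size s) nth 1 s i ^+ e i.
have /choice[f fP] : forall e, exists l, q l (se e) \in pder (P s l) p ->
    forall m, q m (se e) \in pder (P s m) p.
  move=> e; have [H|/existsNP[l nl]] := pselect (forall m, q m (se e) \in pder (P s m) p).
    by have [l0] := pres_inh Fq; exists l0.
  by exists l.
have [l lP] := finite_bound f; exists l => g gg ql; apply: inM => m.
have [n [ln mn]] := pres_le_dir l m; apply: pder_pres_le mn _.
have [|e [ep]] := @pder_gen_prod _ (P s n) p (prime_gt0 pr) [seq q n x | x <- s] erefl (q n g).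
  by have [h gh <-] := gg n; apply: gen_image.
pose e' : {ffun 'I_(size s) -> 'I_p} := [ffun i : 'I_(size s) => Ordinal (ep i)].
have -> : \prod_(i < size [seq q n x | x <- s]) nth 1 [seq q n x | x <- s] i ^+ e i =
    q n (se e').
  rewrite size_map (big_morph _ (morphMg (qM n)) (morph1g (qM n))).
  by apply: eq_bigr => i _; rewrite (nth_map 1) // ffunE (morphXg (qM n)).
rewrite -(morphVg (qM n)) -(morphMg (qM n)) => Hn.
(* Since [q l g] is 1, the word [se e'] passes its test at [f e'], hence lies in [pder] in every
   quotient. *)
have /fP/(_ n) He : q (f e') (se e') \in pder (P s (f e')) p.
  apply: pder_pres_le (lP e') _; have := pder_pres_le ln Hn.
  by rewrite (morphMg (qM l)) ql mulg1 (morphVg (qM l)) groupV.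
have := groupM He Hn.
by rewrite -(morphMg (qM n)) mulKVg.
Qed.

(** The representatives [t1] are taken modulo the kernel of [phi] and not modulo the preimage of
    [M], so to the Schreier generators [s1] are added the representatives [s2] lying over [M]. *)
Lemma schreier s (M : {group A}) : exists s',
  (forall x, x \in s' -> gen s x /\ phi x \in M) /\
  forall g, gen s g -> phi g \in M -> gen s' g.
Proof.
have /choice[t tP] : forall a, exists t, gen s t /\
    ((exists2 g, gen s g & phi g = a) -> phi t = a).
  move=> a; have [[g gg ga]|na] := pselect (exists2 g, gen s g & phi g = a).
    by exists g.
  by exists 1; split=> // -[g gg ga]; case: na; exists g.
pose t1 a := t a * (t 1)^-1.
have t1g a : gen s (t1 a) by apply: genM (tP _).1 (genV (tP _).1).
have phit1 : phi (t 1) = 1 by apply: (tP 1).2; exists 1; rewrite ?(morph1g phiM).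
have t1P a g : gen s g -> phi g = a -> phi (t1 a) = a.
  move=> gg ga; rewrite (morphMg phiM) (morphVg phiM) phit1 invg1 mulg1.
  by apply: (tP a).2; exists g.
have t11 : t1 1 = 1 by rewrite /t1 mulgV.
clearbody t1.
pose A' := [seq a <- enum A | `[< exists2 g, gen s g & phi g = a >]].
have A'P a : reflect (exists2 g, gen s g & phi g = a) (a \in A').
  by rewrite mem_filter mem_enum andbT; apply: asboolP.
pose s1 := [seq t1 a * x * (t1 (a * phi x))^-1 | a <- A', x <- s].
pose s2 := [seq t1 a | a <- A' & a \in M].
exists (s1 ++ s2); split=> [x|g gg].
  rewrite mem_cat => /orP[/allpairsP[[a y] /= [/A'P[g gg ga] ys ->]]|].
    have gy : gen s (g * y) by apply: genM (gen_mem ys).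
    split; first by apply: genM (genV _) => //; apply: genM (gen_mem ys).
    rewrite (morphMg phiM) (morphVg phiM) (morphMg phiM) (t1P _ _ gg) //.
    by rewrite (t1P _ _ gy) ?(morphMg phiM) ?ga // mulgV group1.
  move=> /mapP[a]; rewrite mem_filter => /andP[aM /A'P[g gg ga]] ->.
  by rewrite (t1P _ _ gg).
have [gg' [h gh gE]] : gen s g /\ exists2 h, gen (s1 ++ s2) h & g = h * t1 (phi g).
  elim/gen_ind_right: g / gg => [|g x [gg [h gh gE]] xs|g x [gg [h gh gE]] xs].
  - by split=> //; exists 1; rewrite // (morph1g phiM) t11 mulg1.
  - split; first exact: genM gg (gen_mem xs).
    exists (h * (t1 (phi g) * x * (t1 (phi g * phi x))^-1)).
      apply: genM gh (gen_mem _); rewrite mem_cat; apply/orP; left.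
      by apply/allpairsP; exists (phi g, x); split=> //; apply/A'P; exists g.
    by rewrite (morphMg phiM) !mulgA mulgKV -gE.
  - have gx : gen s (g * x^-1) by apply: genM gg (genV (gen_mem xs)).
    split=> //; exists (h * (t1 (phi (g * x^-1)) * x * (t1 (phi (g * x^-1) * phi x))^-1)^-1).
      apply: genM gh (genV (gen_mem _)); rewrite mem_cat; apply/orP; left.
      by apply/allpairsP; exists (phi (g * x^-1), x); split=> //; apply/A'P; exists (g * x^-1).
    rewrite -(morphMg phiM) mulgKV !invgM invgK !mulgA -gE.
    by rewrite mulgKV.
move=> gM; rewrite gE; apply: genM gh (gen_mem _); rewrite mem_cat; apply/orP; right.
apply/mapP; exists (phi g) => //; rewrite mem_filter gM; apply/A'P.
by exists g.
Qed.

(** Induction on the image of the closure. On the kernel of [q l1] the values of [phi] lie in a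
    maximal subgroup [M]; Schreier generators of the part over [M] generate a group whose closure
    has smaller image. *)
Lemma serre s : exists l, forall g, gen s g -> q l g = 1 -> phi g = 1.
Proof.
have [n] := ubnP #|topgen_image s|; elim: n s => // n IH s /ltnSE leQ.
have [Q1|Qn] := eqVneq (topgen_image s) 1.
  have [l0] := pres_inh Fq; exists l0 => g gg _.
  by have := topgen_imageP (gen_topgen gg); rewrite Q1 => /set1P.
have [/esym/eqP|[M maxM _]] := maximal_exists (sub1G (topgen_image_Group s)).
  by rewrite (negPf Qn).
have [l1 l1P] := serre_step maxM; have [s' [s'P gens']] := schreier s M.
have sub x : x \in s' -> gen s x by move=> /s'P[].
have [|l2 l2P] := IH s'.
  apply: leq_trans leQ; apply: (@leq_ltn_trans #|M|); last first.
    exact: proper_card (maxgroupp maxM).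
  apply: subset_leq_card; apply/subsetP => a; rewrite inE => /asboolP[g gg <-].
  (* An element of the new closure differs from a word [h] over [M] by an element of the old closure
     killed by [q l1], which [phi] sends into [M] too. *)
  have [h gh hg] := gg l1.
  have hM : phi h \in M.
    apply: (gh (fun h => phi h \in M)) => [|x y|x|x /s'P[]//].
    - by rewrite (morph1g phiM).
    - by rewrite (morphMg phiM); apply: groupM.
    - by rewrite (morphVg phiM) groupV.
  rewrite -(mulKVg h g) (morphMg phiM) groupM //; apply: l1P.
    apply: topgenM (topgenV _) (topgen_sub sub gg).
    by apply: gen_topgen; apply: gen_sub gh.
  by rewrite (morphMg (qM l1)) (morphVg (qM l1)) hg mulVg.
have [l [ll1 ll2]] := pres_le_dir l1 l2; exists l => g gg ql.
have gM : phi g \in M by apply: l1P (gen_topgen gg) (ll1 _ ql).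
exact: l2P (gens' g gg gM) (ll2 _ ql).
Qed.

End Serre.

(** * Lifting along surjections of finite p-groups *)

Section Projective.
Import fintype boot.finset GroupScope.
Local Open Scope group_scope.

Definition p_projective (K : groupType) (p : nat) : Prop :=
  forall (A B : finGroupType) (pi : B -> A), p.-group [set: B]%G ->
    monoid_morphism pi -> (forall a, exists b, pi b = a) ->
  forall phi : K -> A, monoid_morphism phi ->
  exists psi : K -> B, monoid_morphism psi /\ forall x, pi (psi x) = phi x.

(** The lifts on different subgroups need not agree. A cluster point over the finite subsets is
    still multiplicative, as this concerns three elements at a time. *)
Lemma local_lift (K : groupType) (A B : finGroupType) (pi : B -> A) (phi : K -> A) :
  (forall s : seq K, exists psi : K -> B,
    (forall x y, gen s x -> gen s y -> psi (x * y) = psi x * psi y) /\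
    forall x, gen s x -> pi (psi x) = phi x) ->
  exists psi : K -> B, monoid_morphism psi /\ forall x, pi (psi x) = phi x.
Proof.
move=> /choice[f fP].
have [||||psi psiP] :=
  @net_cluster (seq K) (fun s t => {subset s <= t}) _ _ _ K (fun=> B) f.
- exact: (inhabits [::]).
- by move=> s t u st tu x /st/tu.
- by move=> s t; exists (s ++ t); split=> x xs; rewrite mem_cat xs ?orbT.
- by move=> _; apply: finite_finset.
have psiM x y : psi (x * y) = psi x * psi y.
  have [s [xys e]] := psiP [set x; y; x * y]%classic [:: x; y] (finite_set3 _ _ _).
  rewrite -!e; [|by left; right|by left; left|by right].
  by apply: (fP s).1; apply: gen_mem; apply: xys; rewrite !inE eqxx ?orbT.
exists psi; split=> [|x].
  by split=> //; apply: (mulgI (psi 1)); rewrite -psiM !mulg1.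
have [s [xs e]] := psiP [set x]%classic [:: x] (finite_set1 _).
by rewrite -e // (fP s).2 //; apply: gen_mem; apply: xs; rewrite inE.
Qed.

Section FreePresentation.
Variables (F : groupType) (L : Type) (N : L -> finGroupType) (q : forall l, F -> N l).

Definition pres_cont (H : groupType) (f : F -> H) : Prop :=
  exists l, forall x, q l x = 1 -> f x = 1.

Record free_pres (X : Type) (i : X -> F) : Prop := FreePres {
  fp_supp : forall l, finite_set [set x | q l (i x) <> 1]%classic;
  fp_lift : forall (H : finGroupType) (f : X -> H), nilpotent [set: H]%G ->
    finite_set [set x | f x <> 1]%classic ->
    exists th : F -> H, [/\ monoid_morphism th, pres_cont th & forall x, th (i x) = f x];
  fp_uniq : forall (H : finGroupType) (th th' : F -> H), nilpotent [set: H]%G ->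
    monoid_morphism th -> pres_cont th -> monoid_morphism th' -> pres_cont th' ->
    (forall x, th (i x) = th' (i x)) -> forall x, th x = th' x
}.

Hypothesis Fq : pronil_pres q.
Variables (X : Type) (i : X -> F).
Hypothesis Fi : free_pres i.

(** Take [l] from [serre] and divide [N l] by its largest normal p'-subgroup. If [x] dies there,
    then [q l x] has order m prime to p, so [phi x] has order dividing m; being a p-element, it is
    1. *)
Lemma p_quotient_gen (p : nat) (A : finGroupType) (phi : F -> A) (s : seq F) :
  prime p -> p.-group [set: A]%G -> monoid_morphism phi ->
  exists (P : finGroupType) (r : F -> P), [/\ p.-group [set: P]%G, monoid_morphism r,
    exists l, forall x y, q l x = q l y -> r x = r y &
    forall x, gen s x -> r x = 1 -> phi x = 1].
Proof.
move=> pr pA phiM; have [l lP] := serre Fq pr pA phiM s.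
have qM := pres_hom Fq l; have nilN := pres_nil Fq l.
pose O := 'O_p^'([set: N l])%G.
have NO x : x \in 'N(O) by apply: (subsetP (normal_norm (pcore_normal _ _))); apply: in_setT.
exists (coset_of O), (fun x => coset O (q l x)); split.
- have -> : [set: coset_of O]%G = ([set: N l] / O)%G.
    apply/val_inj/setP => u; rewrite /= in_setT; have [x Nx ->] := cosetP u.
    by rewrite mem_quotient.
  have [_ /= defG _ _] := dprodP (nilpotent_pcoreC p nilN).
  by rewrite /= -[X in X / _]defG quotientMidr quotient_pgroup // pcore_pgroup.
- by split=> [|x y]; rewrite ?(morph1g qM) ?morph1 // (morphMg qM) morphM.
- by exists l => x y ->.
- move=> x gx /(coset_idr (NO _)) Oqx.
  have p'm : p^'.-nat #[q l x] by apply: mem_p_elt Oqx; apply: pcore_pgroup.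
  have : phi (x ^+ #[q l x]) = 1.
    by apply: lP; [apply: genX|rewrite (morphXg qM) expg_order].
  rewrite (morphXg phiM) => /eqP; rewrite -order_dvdn => dm.
  apply/eqP; rewrite -order_eq1; apply/eqP/(@pnat_1 p).
    exact: mem_p_elt pA (in_setT _).
  exact: pnat_dvd dm p'm.
Qed.

Lemma surj_pgroup (p : nat) (A B : finGroupType) (pi : B -> A) :
  p.-group [set: B]%G -> monoid_morphism pi -> (forall a, exists b, pi b = a) ->
  p.-group [set: A]%G.
Proof.
move=> pB piM pis; apply/pgroupP => r rr /(Cauchy rr)[a _ oa].
rewrite -oa in rr *; have [b ba] := pis a; rewrite -ba in rr *; have pb : p.-nat #[b] := mem_p_elt pB (in_setT b).
have pib : (#[pi b] %| #[b])%N.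
  by rewrite order_dvdn -(morphXg piM) expg_order (morph1g piM).
have {}pib := pnat_dvd pib pb; apply: (pnatPpi pib).
by rewrite pi_of_prime // inE.
Qed.

(* [phi], which need not be continuous, factors on [gen s] through the image Q of
   [gen s] in a continuous p-quotient P of F.  Coinducing from Q to P gives a
   subgroup [T] of the wreath product of B by P; F -> P lifts to a continuous map
   into [T], whose coordinate at the coset Q lifts [phi] on [gen s]. *)
Lemma free_pres_p_projective (p : nat) : prime p -> p_projective F p.
Proof.
move=> pr A B pi pB piM pis phi phiM; apply: local_lift => s.
have pA := surj_pgroup pB piM pis.
have [P [r [pP rM [l lr] rphi]]] := p_quotient_gen s pr pA phiM.
have rE x y : gen s x -> gen s y -> r x = r y -> phi x = phi y.
  move=> gx gy e; apply: (mulIg (phi y)^-1).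
  rewrite mulgV -(morphVg phiM) -(morphMg phiM); apply: rphi.
    exact: genM (genV _).
  by rewrite (morphMg rM) (morphVg rM) e mulgV.
pose Q : {group P} := <<[set x in [seq r x | x <- s]]>>%G.
have Qr x : gen s x -> r x \in Q by apply: gen_image.
have /choice[phi' phi'P] : forall u : P, exists a, forall x, gen s x -> r x = u -> phi x = a.
  move=> u; have [[x gx <-]|nx] := pselect (exists2 x, gen s x & r x = u).
    by exists (phi x) => y gy; apply: rE.
  by exists 1 => x gx rx; case: nx; exists x.
have phi'M : {in Q &, forall u v, phi' (u * v) = phi' u * phi' v}.
  move=> _ _ /(image_gen rM)[x gx <-] /(image_gen rM)[y gy <-].
  rewrite -(phi'P (r x) x) // -(phi'P (r y) y) // -(phi'P _ (x * y)) ?(morphMg phiM) //.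
    exact: genM.
  exact: morphMg rM _ _.
(* The cocycle of the action on right cosets of [Q]: it satisfies c(S, gh) = c(S, g) c(Sg, h), so
   [T] is a group. *)
pose c (S : {set P}) g := repr S * g * (repr (S :* g))^-1.
have cQ S g : S \in rcosets Q [set: P]%G -> c S g \in Q.
  move=> /rcosetsP[x _ ->]; rewrite /c -rcosetM.
  have /rcosetP[k Qk ->] := mem_repr_rcoset Q x.
  have /rcosetP[k' Qk' ->] := mem_repr_rcoset Q (x * g).
  by rewrite !invgM !mulgA mulgK mulgK groupM ?groupV.
pose T := [set w : wreath P B | [forall S in rcosets Q [set: P]%G, pi (w.2 S) == phi' (c S w.1)]].
have TP (w : wreath P B) : reflect (forall S, S \in rcosets Q [set: P]%G -> pi (w.2 S) = phi' (c S w.1))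
    (w \in T).
  by rewrite inE; apply: (iffP forall_inP) => H S QS; apply/eqP/H.
have phi'1 : phi' 1 = 1 by rewrite -(phi'P _ 1) ?(morph1g phiM) ?(morph1g rM).
have gT : group_set T.
  apply/group_setP; split=> [|w w' /TP wT /TP wT'].
    apply/TP => S _; rewrite ffunE (morph1g piM) /c /= mulg1 rcoset1 mulgV.
    by rewrite phi'1.
  apply/TP => S QS; rewrite wreath_sndE (morphMg piM) wT //.
  have QS' : S :* w.1 \in rcosets Q [set: P]%G.
    move/rcosetsP: QS => [x _ ->]; rewrite -rcosetM; apply/rcosetsP.
    by exists (x * w.1) => //; apply: in_setT.
  rewrite wT' // -phi'M ?cQ //; congr phi'.
  by rewrite /c rcosetM !mulgA mulgKV.
pose TG := Group gT.
have pT : p.-group [set: subg_of TG]%G.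
  by rewrite /pgroup -(card_isog (isog_subg TG)); apply: pgroupS (subsetT _) (wreath_pgroup pP pB).
(* Choosing 1 wherever [r (i x)] is 1 keeps the support of [f] finite. *)
have /choice[f fP] : forall x : X, exists w : subg_of TG,
    (sgval w).1 = r (i x) /\ (r (i x) = 1 -> w = 1).
  move=> x; have [e|ne] := pselect (r (i x) = 1); first by exists 1; rewrite e.
  have /choice[u uP] : forall S : {set P}, exists b, pi b = phi' (c S (r (i x))).
    by move=> S; apply: pis.
  have wT : ((r (i x), [ffun S => u S]) : wreath P B) \in TG by apply/TP => S _; rewrite ffunE uP.
  by exists (Subg wT).
have qrcont : pres_cont r by exists l => x qx; rewrite -(morph1g rM); apply: lr;
  rewrite qx (morph1g (pres_hom Fq l)).
have nilT := pgroup_nil pT; have nilP := pgroup_nil pP.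
have [|th [thM [m thc] thi]] := fp_lift Fi nilT (f := f).
  apply: sub_finite_set (fp_supp Fi l) => x /= fx qx; apply: fx.
  apply: (fP x).2; rewrite -(morph1g rM); apply: lr.
  by rewrite qx (morph1g (pres_hom Fq l)).
pose rho x : wreath P B := sgval (th x).
have rhoM x y : rho (x * y) = rho x * rho y by rewrite /rho (morphMg thM).
have rho1 x : (rho x).1 = r x.
  apply: (@fp_uniq X i Fi P (fun x => (rho x).1) r nilP) => //.
  - by split=> [|y z]; rewrite /rho ?(morph1g thM) // (morphMg thM).
  - by exists m => y /thc e; rewrite /rho e.
  - by move=> y; rewrite /rho thi (fP y).1.
have Qin : (Q : {set P}) \in rcosets Q [set: P]%G.
  by apply/rcosetsP; exists 1; rewrite ?rcoset1 ?in_setT.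
exists (fun x => (rho x).2 Q); split=> [x y gx gy|x gx].
  by rewrite rhoM wreath_sndE rho1 rcoset_id ?Qr.
have /TP/(_ Q Qin) -> : rho x \in T by apply: subgP.
by rewrite rho1 /c rcoset_id ?Qr // repr_group mul1g invg1 mulg1 -(phi'P _ x).
Qed.
End FreePresentation.
End Projective.

Section CentralLift.
Import fintype boot.finset GroupScope.
Local Open Scope group_scope.

Lemma nilpotent_quotient_pcore (p : nat) (H : finGroupType) : nilpotent [set: H]%G ->
  p.-group [set: coset_of 'O_p^'([set: H])]%G.
Proof.
move=> nilH; set O := 'O_p^'([set: H])%G.
have -> : [set: coset_of O]%G = ([set: H] / O)%G.
  apply/val_inj/setP => u; rewrite /= in_setT; have [x Nx ->] := cosetP u.
  by rewrite mem_quotient.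
have [_ /= defG _ _] := dprodP (nilpotent_pcoreC p nilH).
by rewrite /= -[X in X / _]defG quotientMidr quotient_pgroup // pcore_pgroup.
Qed.

(** The cyclic p-group of [z] meets [O] trivially, so an element of [H] is determined by its images
    in [A] and in the p-group [coset_of O]. The lift is found in the latter and combined with
    [phi]. *)
Lemma p_projective_central_lift (K : groupType) (H A : finGroupType) (pi : H -> A)
    (z : H) (phi : K -> A) :
  p_projective K #[z] -> prime #[z] -> nilpotent [set: H]%G ->
  monoid_morphism pi -> (forall a, exists h, pi h = a) ->
  (forall h, commute z h) -> (forall h, pi h = 1 -> h \in <[z]>) -> pi z = 1 ->
  monoid_morphism phi ->
  exists psi : K -> H, monoid_morphism psi /\ forall x, pi (psi x) = phi x.
Proof.
set p := #[z] => Kp pr nilH piM /choice[sig sigK] zC kerz piz phiM.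
pose O := 'O_p^'([set: H])%G.
have NO x : x \in 'N(O).
  by apply: (subsetP (normal_norm (pcore_normal _ _))); apply: in_setT.
have cM : monoid_morphism (coset O).
  by split=> [|x y]; rewrite ?morph1 // morphM.
pose zb := coset O z; pose Z := <[zb]>%G.
have NZ u : u \in 'N(Z).
  have [h _ ->] := cosetP u.
  apply: (subsetP (cent_sub Z)); rewrite cent_cycle; apply/cent1P.
  by rewrite /commute -!(morphMg cM) (zC h).
have cZM : monoid_morphism (coset Z).
  by split=> [|x y]; rewrite ?morph1 // morphM.
have cZz : coset Z zb = 1 by apply: coset_id; apply: cycle_id.
have dpi h h' : pi h = pi h' -> exists k, h = h' * z ^+ k.
  move=> e; have /cycleP[k hk] : h'^-1 * h \in <[z]>.
    by apply: kerz; rewrite (morphMg piM) (morphVg piM) e mulVg.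
  by exists k; rewrite -hk mulKVg.
have dphi h h' : pi h = pi h' -> coset Z (coset O h) = coset Z (coset O h').
  move=> /dpi[k ->]; rewrite (morphMg cM) (morphXg cM) (morphMg cZM) (morphXg cZM).
  by rewrite cZz expg1n mulg1.
have pP := nilpotent_quotient_pcore p nilH.
have [u||rho [rhoM rhoP]] := Kp (coset_of Z) (coset_of O) (coset Z) pP cZM _
  (fun x => coset Z (coset O (sig (phi x)))).
- by have [v _ ->] := cosetP u; exists v.
- split=> [|x y].
    rewrite (dphi _ 1) ?(morph1g cM) ?(morph1g cZM) //.
    by rewrite sigK (morph1g phiM) (morph1g piM).
  rewrite -(morphMg cZM) -(morphMg cM); apply: dphi.
  by rewrite (morphMg piM) !sigK (morphMg phiM).
have /choice[psi psiP] x : exists h, pi h = phi x /\ coset O h = rho x.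
  have : coset Z ((coset O (sig (phi x)))^-1 * rho x) = 1.
    by rewrite (morphMg cZM) (morphVg cZM) rhoP mulVg.
  move=> /(coset_idr (NZ _))/cycleP[k e].
  exists (sig (phi x) * z ^+ k).
  rewrite (morphMg piM) (morphXg piM) piz expg1n mulg1 sigK.
  by rewrite (morphMg cM) (morphXg cM) -e mulKVg.
have uniq h h' : pi h = pi h' -> coset O h = coset O h' -> h = h'.
  move=> e e'; apply: (mulgI h'^-1); rewrite mulVg.
  have zh : h'^-1 * h \in <[z]>.
    by apply: kerz; rewrite (morphMg piM) (morphVg piM) e mulVg.
  have Oh : h'^-1 * h \in O.
    by apply: (coset_idr (NO _)); rewrite (morphMg cM) (morphVg cM) e' mulVg.
  apply/eqP; rewrite -order_eq1; apply/eqP/(@pnat_1 p).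
    by apply: mem_p_elt zh; rewrite /pgroup -orderE pnat_id.
  by apply: mem_p_elt Oh; apply: pcore_pgroup.
exists psi; split=> [|x]; last exact: (psiP x).1.
split=> [|x y]; apply: uniq.
- by rewrite (psiP 1).1 (morph1g phiM) (morph1g piM).
- by rewrite (psiP 1).2 (morph1g rhoM) (morph1g cM).
- by rewrite (morphMg piM) !(psiP _).1 (morphMg phiM).
- by rewrite (morphMg cM) !(psiP _).2 (morphMg rhoM).
Qed.

End CentralLift.

Section NilpotentQuotients.
Import fintype boot.finset GroupScope.
Local Open Scope group_scope.

(** The criterion [nilpotent_coprime_commute] for the image of [phi], phrased without forming the
    image. *)
Definition nil_quotients (K : groupType) : Prop :=
  forall (Q : finGroupType) (phi : K -> Q), monoid_morphism phi ->
  forall x y, coprime #[phi x] #[phi y] -> commute (phi x) (phi y).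

Variables (F : groupType) (L : Type) (N : L -> finGroupType) (q : forall l, F -> N l).
Hypothesis Fq : pronil_pres q.
Let qM l := pres_hom Fq l.

Lemma pres_eq (x y : F) : (forall l, q l x = q l y) -> x = y.
Proof.
move=> e; apply: (mulIg y^-1); rewrite mulgV; apply: (pres_sep Fq) => l.
by rewrite (morphMg (qM l)) (morphVg (qM l)) e mulgV.
Qed.

(** With M = d! n, the Chinese remainder theorem gives e congruent to 1 modulo the pi-part of M and
    to 0 modulo the rest; raising to the power e extracts pi-parts. The cofactors [a] and [b] of e
    and e - 1 are what is needed, and M is added to keep e positive. *)
Lemma exponents (pi : nat_pred) (n d : nat) : (0 < n)%N -> exists a b,
  [/\ (n`_pi^' * a = 1 + n`_pi * b)%N &
      forall m, (0 < m <= d)%N -> (m %| n`_pi^' * a * (d`! * n)`_pi)%N].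
Proof.
move=> n0; set M := (d`! * n)%N.
have M0 : (0 < M)%N by rewrite muln_gt0 fact_gt0.
have nM (rho : nat_pred) : (n`_rho %| M`_rho)%N by rewrite partn_dvd // dvdn_mull.
have cop : coprime M`_pi M`_pi^' by apply: coprime_partC.
pose e := (chinese M`_pi M`_pi^' 1 0 + M)%N.
have e0 : (0 < e)%N by rewrite addn_gt0 M0 orbT.
have e1 : (M`_pi %| e - 1)%N.
  rewrite -eqn_mod_dvd // eq_sym; apply/eqP/esym.
  by rewrite -modnDmr (eqP (dvdn_part pi M)) addn0 chinese_modl.
have e2 : (M`_pi^' %| e)%N.
  rewrite /e dvdn_addl ?dvdn_part // /dvdn (chinese_modr cop) mod0n //.
exists (e %/ n`_pi^')%N, ((e - 1) %/ n`_pi)%N.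
have ea : (n`_pi^' * (e %/ n`_pi^') = e)%N.
  by rewrite mulnC divnK // (dvdn_trans (nM _)).
split=> [|m /andP[m0 md]].
  by rewrite ea mulnC divnK ?(dvdn_trans (nM _)) // subnKC.
rewrite ea; apply: (@dvdn_trans M).
  by rewrite dvdn_mulr // dvdn_fact // m0.
by rewrite -{1}(partnC pi M0) mulnC dvdn_mul.
Qed.

(** As [phi] need not be continuous, it only sees identities holding in [F]. Cluster points [u], [v]
    of the powers of [x] give two expressions for [x']: as a power of [u], which makes [phi x'] a
    pi-element, and as [x] times a power of [v], which makes it differ from [phi x] by a
    pi'-element. *)
Lemma pi_part_lift (pi : nat_pred) (Q : finGroupType) (phi : F -> Q) (x : F) :
  monoid_morphism phi ->
  exists x', phi x' = (phi x).`_pi /\ forall l, pi.-elt (q l x').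
Proof.
move=> phiM; set n := #|[set: Q]|; have n0 : (0 < n)%N by apply: cardG_gt0.
have /choice[a /choice[b ab]] := fun d => exponents pi d n0.
have [||uv uvP] := pres_cluster Fq (le := leq) (inhabits 0%N) _ _
  (fun d (c : bool) => if c then x ^+ a d else x ^+ b d).
- by move=> i j k; apply: leq_trans.
- by move=> i j; exists (maxn i j); rewrite leq_maxl leq_maxr.
set u := uv true in uvP; set v := uv false in uvP.
have uvE l : exists d, [/\ (#|[set: N l]| <= d)%N, q l u = q l x ^+ a d & q l v = q l x ^+ b d].
  have [d [ld e]] := uvP l [set: bool]%classic #|[set: N l]| (finite_finset).
  by exists d; rewrite -(e true I) -(e false I) !(morphXg (qM l)).
pose x' := u ^+ n`_pi^'; have x'E : x' = x * v ^+ n`_pi.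
  apply: pres_eq => l; have [d [_ qu qv]] := uvE l.
  rewrite (morphMg (qM l)) !(morphXg (qM l)) qu qv -!expgM -expgS.
  by congr (_ ^+ _); rewrite mulnC (ab d).1 mulnC.
have vx : commute v x.
  apply: pres_eq => l; have [d [_ qu qv]] := uvE l.
  by rewrite !(morphMg (qM l)) qv; apply/commute_sym/commuteX.
have Qn (w : Q) : w ^+ n = 1 by apply: expg_cardG; apply: in_setT.
exists x'; split=> [|l].
  have px' : pi.-elt (phi x').
    apply: (@pnat_dvd _ n`_pi); last exact: part_pnat.
    by rewrite order_dvdn (morphXg phiM) -expgM mulnC partnC // Qn.
  have pv : pi^'.-elt (phi (v ^+ n`_pi)).
    apply: (@pnat_dvd _ n`_pi^'); last exact: part_pnat.
    by rewrite order_dvdn (morphXg phiM) -expgM partnC // Qn.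
  have xE : x = x' * (v ^+ n`_pi)^-1 by rewrite x'E mulgK.
  rewrite [in RHS]xE (morphMg phiM) (morphVg phiM) consttM.
    rewrite constt_p_elt // (constt1P _) ?mulg1 //.
    by rewrite /p_elt orderV.
  rewrite /commute -(morphVg phiM) -!(morphMg phiM); congr phi.
  apply/commuteV; rewrite x'E; apply/commute_sym/commuteM.
    exact/commute_sym/commuteX/commute_sym.
  exact: commute_refl.
have [d [ld qu _]] := uvE l.
apply: (@pnat_dvd _ (d`! * n)`_pi); last exact: part_pnat.
rewrite order_dvdn (morphXg (qM l)) qu -!expgM -order_dvdn.
rewrite mulnC -mulnA [(_ * a d)%N]mulnC mulnA; apply: (ab d).2.
rewrite order_gt0 (leq_trans _ ld) //.
by apply: dvdn_leq; [apply: cardG_gt0|apply: order_dvdG; apply: in_setT].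
Qed.

(** Lifts of [phi x] and [phi y] that are a pi-element and a pi'-element in every nilpotent [N l]
    commute there, hence in [F]. *)
Lemma pres_nil_quotients : nil_quotients F.
Proof.
move=> Q phi phiM x y cop; pose pi : nat_pred := \pi(#[phi x]).
have [x' [ex px]] := pi_part_lift pi x phiM.
have [y' [ey py]] := pi_part_lift pi^' y phiM.
have <- : phi x' = phi x by rewrite ex constt_p_elt // /p_elt pnat_pi.
have <- : phi y' = phi y.
  rewrite ey constt_p_elt // /p_elt.
  by rewrite -coprime_pi' // order_gt0.
rewrite /commute -!(morphMg phiM); congr phi; apply: pres_eq => l.
rewrite !(morphMg (qM l)).
have := sub_nilpotent_cent2 (pres_nil Fq l) (subsetT <[q l x']>) (subsetT <[q l y']>).
rewrite /= => H; apply: commute_sym.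
apply: (centsP (H _)); rewrite ?cycle_id //.
by apply: (@pnat_coprime pi); [apply: px|apply: py].
Qed.

End NilpotentQuotients.

(** * Homomorphisms to finite nilpotent groups and finitely supported maps *)

Section Coordinates.
Import GRing.Theory.
Local Open Scope classical_set_scope.
Local Open Scope ring_scope.

Record dual_coords (K : groupType) (p : nat) (X : Type)
    (e : (K -> 'F_p) -> X -> 'F_p) : Prop := DualCoords {
  dc_supp : forall chi, addhom chi -> finite_set [set x | e chi x <> 0];
  dc_add : forall chi chi', addhom chi -> addhom chi' ->
    forall x, e (fun k => chi k + chi' k) x = e chi x + e chi' x;
  dc_inj : forall chi, addhom chi -> (forall x, e chi x = 0) -> forall k, chi k = 0;
  dc_surj : forall f : X -> 'F_p, finite_set [set x | f x <> 0] ->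
    exists chi, addhom chi /\ forall x, e chi x = f x
}.

Lemma big_uniq_subset (A : nmodType) (I : eqType) (s r : seq I) (f : I -> A) :
  uniq s -> uniq r -> {subset s <= r} -> (forall i, i \notin s -> f i = 0) ->
  \sum_(i <- r) f i = \sum_(i <- s) f i.
Proof.
move=> us ur sr f0; rewrite (bigID (mem s)) /= [X in _ + X]big1 ?addr0 //.
rewrite -big_filter; apply: perm_big; apply: uniq_perm; rewrite ?filter_uniq //.
by move=> i; rewrite mem_filter; case: (boolP (i \in s)) => // /sr.
Qed.

Lemma addhom_basis_coords (K : groupType) (p : nat) (X : choiceType)
    (b : X -> K -> 'F_p) : addhom_basis b ->
  exists e : (K -> 'F_p) -> X -> 'F_p, dual_coords e.
Proof.
move=> [bh bi bspan].
pose rep (chi : K -> 'F_p) (f : X -> 'F_p) (s : seq X) := [/\ uniq s,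
  forall x, x \notin s -> f x = 0 & forall k, chi k = \sum_(x <- s) f x * b x k].
have rep_sub chi f s r : rep chi f s -> uniq r -> {subset s <= r} -> rep chi f r.
  move=> [us f0 chiE] ur sr; split=> // [x xr|k].
    by apply: f0; apply: contra xr; apply: sr.
  rewrite chiE; apply/esym/big_uniq_subset => // x /f0 ->.
  by rewrite mul0r.
have rep_uniq chi f s f' s' : rep chi f s -> rep chi f' s' -> f =1 f'.
  move=> R R'; pose r := undup (s ++ s').
  have ur : uniq r by apply: undup_uniq.
  have [|_ f0 e] := rep_sub _ _ _ r R ur.
    by move=> x xs; rewrite mem_undup mem_cat xs.
  have [|_ f0' e'] := rep_sub _ _ _ r R' ur.
    by move=> x xs; rewrite mem_undup mem_cat xs orbT.
  move=> x; have [xr|nxr] := boolP (x \in r); last by rewrite f0 ?f0'.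
  apply/eqP; rewrite -subr_eq0; apply/eqP.
  apply: (bi r (fun x => f x - f' x)) xr => // k.
  rewrite (eq_bigr (fun x => f x * b x k - f' x * b x k)) => [|y _]; last first.
    by rewrite mulrBl.
  by rewrite sumrB -e -e' subrr.
have /choice[e eP] : forall chi, exists f, addhom chi -> exists s, rep chi f s.
  move=> chi; have [/bspan[s [c [us chiE]]]|] := pselect (addhom chi); last first.
    by exists (fun=> 0).
  exists (fun x => if x \in s then c x else 0) => _; exists s; split=> //.
    by move=> x /negPf ->.
  by move=> k; rewrite chiE big_seq [RHS]big_seq; apply: eq_bigr => x ->.
exists e; split=> [chi h|chi chi' h h' x|chi h e0 k|f ffin].
- have [s [us f0 _]] := eP _ h.
  apply: (@sub_finite_set _ _ [set` s]); last exact: finite_seq.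
  by move=> x /= ex; apply/negPn/negP => /f0.
- have [s R] := eP _ h; have [s' R'] := eP _ h'.
  have [s'' R''] := eP _ (addhomD h h').
  have ur : uniq (undup (s ++ s')) by apply: undup_uniq.
  have [|_ f0 E] := rep_sub _ _ _ _ R ur.
    by move=> y ys; rewrite mem_undup mem_cat ys.
  have [|_ f0' E'] := rep_sub _ _ _ _ R' ur.
    by move=> y ys; rewrite mem_undup mem_cat ys orbT.
  apply: (rep_uniq _ _ _ (fun x => e chi x + e chi' x) (undup (s ++ s')) R''); split=> //.
    by move=> y ys; rewrite f0 ?f0' ?addr0.
  by move=> k; rewrite E E' -big_split; apply: eq_bigr => y _; rewrite mulrDl.
- have [s [_ _ ->]] := eP _ h.
  by rewrite big1 // => x _; rewrite e0 mul0r.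
- have /finite_seqP[s sE] := ffin.
  pose chi k := \sum_(x <- undup s) f x * b x k.
  have chih : addhom chi by apply: addhom_sum.
  exists chi; split=> //; have [s' R] := eP _ chih.
  apply: rep_uniq R (_ : rep chi f (undup s)); split=> //; first exact: undup_uniq.
  move=> x; rewrite mem_undup => xs; apply: contrapT => fx.
  have : [set x | f x <> 0] x by [].
  by rewrite sE /= (negPf xs).
Qed.

Section Theory.
Variables (K : groupType) (p : nat) (X : Type) (e : (K -> 'F_p) -> X -> 'F_p).
Hypothesis ec : dual_coords e.
Implicit Types chi : K -> 'F_p.

Lemma dc0 x : e (fun=> 0) x = 0.
Proof.
apply: (addrI (e (fun=> 0) x)); rewrite addr0 -(dc_add ec) //; last 2 first.
- exact: addhom0.
- exact: addhom0.
by congr (e _ x); apply/funext => k; rewrite addr0.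
Qed.

Lemma dcZ a chi x : addhom chi -> e (fun k => a * chi k) x = a * e chi x.
Proof.
move=> h; rewrite -[a]natr_Zp; elim: (nat_of_ord a) => [|n IH].
  rewrite mul0r -[RHS](dc0 x); congr (e _ x); apply/funext => k.
  by rewrite mul0r.
rewrite -[RHS]/(n.+1%:R * e chi x) mulrS mulrDl mul1r -IH -(dc_add ec) //; last exact: addhomZ.
by congr (e _ x); apply/funext => k; rewrite mulrDl mul1r.
Qed.

Lemma dc_eq chi chi' : addhom chi -> addhom chi' ->
  (forall x, e chi x = e chi' x) -> forall k, chi k = chi' k.
Proof.
move=> h h' ee k; have hN := addhomZ (-1) h'.
apply/eqP; rewrite -subr_eq0 -mulN1r; apply/eqP.
apply: (dc_inj ec (addhomD h hN)) => x.
by rewrite (dc_add ec) // dcZ // ee mulN1r subrr.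
Qed.
End Theory.
End Coordinates.

Section CyclicPowers.
Import GRing.Theory fintype boot.finset GroupScope.
Local Open Scope group_scope.

Lemma expg_FpD (H : finGroupType) (z : H) (a b : 'F_(#[z])) : prime #[z] ->
  z ^+ (a + b)%R = z ^+ a * z ^+ b.
Proof.
(* The modulus of ['F_(#[z])] equals [#[z]] only through [Fp_cast], hence the variable [m]. *)
move=> pr; have modE m n : m = #[z] -> z ^+ (n %% m) = z ^+ n.
  by move=> ->; apply: expg_mod_order.
by rewrite -expgD; apply: modE; apply: Fp_cast.
Qed.

Lemma expg_Fp_eq1 (H : finGroupType) (z : H) (a : 'F_(#[z])) : prime #[z] ->
  z ^+ a = 1 -> a = 0%R.
Proof.
move=> pr /eqP; rewrite -order_dvdn => dv; apply/val_inj => /=.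
apply/eqP; rewrite -leqn0 leqNgt; apply/negP => a0.
have := dvdn_leq a0 dv; rewrite leqNgt => /negP; apply.
have lt_cast m : m = #[z] -> (a < m)%N -> (a < #[z])%N by move=> ->.
exact: lt_cast (Fp_cast pr) (ltn_ord a).
Qed.

Lemma expg_Fp_inj (H : finGroupType) (z : H) (a b : 'F_(#[z])) : prime #[z] ->
  z ^+ a = z ^+ b -> a = b.
Proof.
move=> pr e; apply/eqP; rewrite -subr_eq0; apply/eqP/(expg_Fp_eq1 pr).
by apply: (mulgI (z ^+ b)); rewrite -expg_FpD // addrC subrK mulg1.
Qed.
End CyclicPowers.

Definition finsupp (X : Type) (H : groupType) (f : X -> H) : Prop :=
  finite_set [set x | f x <> 1%g]%classic.

Lemma finsupp_comp (X : Type) (H H' : groupType) (f : X -> H) (g : H -> H') :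
  g 1%g = 1%g -> finsupp f -> finsupp (g \o f).
Proof.
move=> g1; apply: sub_finite_set => x /= gf fx; apply: gf.
by rewrite fx g1.
Qed.

(** * Homomorphisms with prescribed coordinates *)

Section CompatibleLift.
Import GRing.Theory boot.monoid fintype boot.finset GroupScope.
Local Open Scope group_scope.
Variables (K : groupType) (X : Type) (e : forall p, (K -> 'F_p) -> X -> 'F_p).
Arguments e {p}.
Hypothesis ec : forall p, prime p -> dual_coords (@e p).
Hypothesis Kp : forall p, prime p -> p_projective K p.

Lemma central_quotient (H : finGroupType) (z : H) : (forall h, commute z h) ->
  [/\ monoid_morphism (coset <[z]>), forall u, exists h, coset <[z]> h = u,
      forall h, coset <[z]> h = 1 -> h \in <[z]> & coset <[z]> z = 1].
Proof.
move=> zC; have N h : h \in 'N(<[z]>).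
  by apply: (subsetP (cent_sub <[z]>)); rewrite cent_cycle; apply/cent1P; rewrite /commute (zC h).
split; first by split; [exact: morph1|move=> x y; exact: morphM (N x) (N y)].
- by move=> u; have [h _ ->] := cosetP u; exists h.
- by move=> h; apply: coset_idr.
- by apply: coset_id; apply: cycle_id.
Qed.

Lemma nilpotent_coset (H : finGroupType) (z : H) : nilpotent [set: H]%G ->
  (forall h, commute z h) -> nilpotent [set: coset_of <[z]> ]%G.
Proof.
move=> nilH zC; have [_ cs _ _] := central_quotient zC.
have -> : [set: coset_of <[z]> ]%G = ([set: H] / <[z]>)%G.
  apply/val_inj/setP => u; rewrite /= in_setT; have [x Nx ->] := cosetP u.
  by rewrite mem_quotient.
exact: quotient_nil.
Qed.

Lemma card_coset_lt (H : finGroupType) (z : H) n : prime #[z] ->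
  (forall h, commute z h) -> (#|[set: H]| < n.+1)%N -> (#|[set: coset_of <[z]> ]| < n)%N.
Proof.
move=> pr zC; rewrite ltnS; apply: leq_trans.
have [_ cs _ _] := central_quotient zC.
have -> : [set: coset_of <[z]> ] = quotient [set: H] <[z]>.
  apply/setP => u; rewrite in_setT; have [x Nx ->] := cosetP u.
  by rewrite mem_quotient.
by rewrite ltn_quotient ?subsetT // -cardG_gt1 -orderE prime_gt1.
Qed.

Lemma addhom_coset (H : finGroupType) (z : H) p (al : H -> 'F_p) :
  (forall h, commute z h) -> addhom al -> al z = 0%R ->
  exists2 al' : coset_of <[z]> -> 'F_p, addhom al' & forall h, al' (coset <[z]> h) = al h.
Proof.
move=> zC ah az; have [cM /choice[sig sigK] ck _] := central_quotient zC.
have aE h h' : coset <[z]> h = coset <[z]> h' -> al h = al h'.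
  move=> hh; have /ck/cycleP[k] : coset <[z]> (h'^-1 * h) = 1.
    by rewrite (morphMg cM) (morphVg cM) hh mulVg.
  move=> /(congr1 (mulg h')); rewrite mulKVg => ->.
  by rewrite ah addhomX // az mul0rn addr0.
exists (fun u => al (sig u)) => [u v|h]; last exact/aE/sigK.
by rewrite -ah; apply: aE; rewrite (morphMg cM) !sigK.
Qed.

Lemma addhom_order (H : finGroupType) (z : H) p (al : H -> 'F_p) : prime p ->
  prime #[z] -> addhom al -> al z <> 0%R -> #[z] = p.
Proof.
move=> pr prz ah az; have : (al z *+ #[z] = 0)%R.
  by rewrite -addhomX // expg_order addhom1.
rewrite -mulr_natr => /eqP; rewrite mulf_eq0 => /orP[/eqP//|].
rewrite -(dvdn_pcharf (pchar_Fp pr)) => dv.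
by apply/eqP; rewrite eq_sym -(dvdn_prime2 pr prz).
Qed.

(** Induction along a central [z] of prime order. Any lift of the solution modulo [z] is right for
    the homomorphisms killing [z]. If some [al] does not kill [z], then p is the order of [z];
    powers of [z] correct the lift for [al], and any other homomorphism not killing [z] is a
    multiple of [al] plus one that does. *)
Lemma compatible_lift (H : finGroupType) (f : X -> H) :
  nilpotent [set: H]%G -> finsupp f ->
  exists th : K -> H, monoid_morphism th /\ forall p (al : H -> 'F_p), prime p ->
    addhom al -> forall x, e (al \o th) x = al (f x).
Proof.
have [n] := ubnP #|[set: H]|; elim: n => // n IH in H f * => leH nilH ff.
have [H1|Hn] := eqVneq [set: H] 1.
  have eq1 (h : H) : h = 1 by have := in_setT h; rewrite H1 => /set1P.
  exists (fun=> 1); split=> [|p al pr ah x]; first by split=> // x y; rewrite mulg1.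
  rewrite (eq1 (f x)) addhom1 // -[RHS](dc0 (ec pr) x); congr (e _ x).
  by apply/funext => k; rewrite /= addhom1.
have [z [pr zC]] := finite_Cauchy_center nilH Hn.
have [cM cs ck cz] := central_quotient zC.
have [|||thb [thbM thbP]] := IH _ (coset <[z]> \o f).
- exact: card_coset_lt leH.
- exact: nilpotent_coset.
- by apply: finsupp_comp ff; apply: morph1g cM.
have [th [thM thP]] :=
  p_projective_central_lift (Kp pr) pr nilH cM cs zC ck cz thbM.
(* any other lift is compatible with the homomorphisms killing [z] *)
have thz (th' : K -> H) p (al : H -> 'F_p) : prime p -> addhom al -> al z = 0%R ->
    (forall k, coset <[z]> (th' k) = thb k) ->
    forall x, e (al \o th') x = al (f x).
  move=> prp ah az th'P x; have [al' ah' al'P] := addhom_coset zC ah az.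
  rewrite -al'P -[RHS](thbP p al') //; congr (e _ x); apply/funext => k /=.
  by rewrite -al'P th'P.
have [[p [al [prp ah az]]]|nal] := pselect (exists p, exists al : H -> 'F_p,
    [/\ prime p, addhom al & al z <> 0%R]); last first.
  exists th; split=> // p al prp ah; apply: thz => //.
  by apply: contrapT => az; apply: nal; exists p, al.
have oz := addhom_order prp pr ah az; subst p.
have [|chi [chih chiE]] := dc_surj (ec prp) (f := al \o f).
  apply: sub_finite_set ff => x /= ax fx; apply: ax.
  by rewrite fx addhom1.
have athh : addhom (al \o th) by move=> x y; rewrite /= (morphMg thM) ah.
pose de k := ((al z)^-1 * (chi k + -1 * al (th k)))%R.
have deh : addhom de by apply: addhomZ; apply: addhomD => //; apply: addhomZ.
pose th' k := th k * z ^+ de k.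
have th'M : monoid_morphism th'.
  split=> [|x y]; rewrite /th'.
    by rewrite (morph1g thM) (addhom1 deh) mulg1.
  rewrite (morphMg thM) deh expg_FpD // !mulgA; congr (_ * _).
  by rewrite -!mulgA; congr (_ * _); apply/commuteX/commute_sym/zC.
have th'P k : coset <[z]> (th' k) = thb k.
  by rewrite (morphMg cM) (morphXg cM) cz expg1n mulg1 thP.
have alth' k : al (th' k) = chi k.
  rewrite ah addhomX // -mulr_natl natr_Zp /de mulrAC mulVf ?mul1r; last exact/eqP.
  by rewrite mulN1r addrC subrK.
exists th'; split=> // q be prq bh.
have [bz|/eqP bz] := eqVneq (be z) 0%R; first exact: thz.
have oz := addhom_order prq pr bh bz; subst q.
pose c := (be z / al z)%R.
pose ga h := (be h + (- c) * al h)%R.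
have gh : addhom ga by apply: addhomD => //; apply: addhomZ.
have gz : ga z = 0%R by rewrite /ga mulNr /c divfK ?subrr //; apply/eqP.
have gth : addhom (ga \o th') by move=> x y; rewrite /= (morphMg th'M) gh.
move=> x; have := thz th' _ ga prp gh gz th'P x.
have -> : be \o th' = fun k => ((ga \o th') k + c * chi k)%R.
  by apply/funext => k; rewrite /= /ga alth' mulNr subrK.
rewrite (dc_add (ec prp)) //; last exact: addhomZ.
by move=> ->; rewrite (dcZ (ec prp)) // chiE /ga mulNr subrK.
Qed.

End CompatibleLift.

Section NilpotentTargets.
Import fintype boot.finset GroupScope.
Local Open Scope group_scope.

Lemma nilpotent_joint_inj (H H1 H2 : finGroupType) (a1 : H -> H1) (a2 : H -> H2) :
  monoid_morphism a1 -> monoid_morphism a2 ->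
  (forall x y, a1 x = a1 y -> a2 x = a2 y -> x = y) ->
  nilpotent [set: H1]%G -> nilpotent [set: H2]%G -> nilpotent [set: H]%G.
Proof.
move=> m1 m2 inj n1 n2; apply: nilpotent_coprime_commute => x y _ _ cop.
have com (H' : finGroupType) (a : H -> H') : monoid_morphism a ->
    nilpotent [set: H']%G -> commute (a x) (a y).
  move=> am nil; have := sub_nilpotent_cent2 nil (subsetT <[a x]>) (subsetT <[a y]>).
  rewrite /= => /(_ _)/centsP H0; apply: commute_sym; apply: H0; rewrite ?cycle_id //.
  rewrite -!orderE; apply: coprime_dvdl (coprime_dvdr _ cop).
    by rewrite order_dvdn -(morphXg am) expg_order (morph1g am).
  by rewrite order_dvdn -(morphXg am) expg_order (morph1g am).
by apply: inj; rewrite !morphMg //; apply: com.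
Qed.

Variable X : Type.

Definition epi_on (H : finGroupType) (f : X -> H) : Prop :=
  forall (H' : finGroupType) (b b' : H -> H'), monoid_morphism b -> monoid_morphism b' ->
  (forall x, b (f x) = b' (f x)) -> forall h, b h = b' h.

(** Passing to the subgroup generated by the values of [f] makes a homomorphism unique once its
    values on them are given; this makes the maps between indices unique in
    [natural_family_exists]. *)
Lemma epi_cover (H : finGroupType) (f : X -> H) : nilpotent [set: H]%G -> finsupp f ->
  exists (H0 : finGroupType) (f0 : X -> H0) (a : H0 -> H),
    [/\ nilpotent [set: H0]%G, finsupp f0, epi_on f0, monoid_morphism a &
        forall x, a (f0 x) = f x].
Proof.
move=> nilH ff; pose T : {group H} := <<[set h | `[< exists x, h = f x >]]>>%G.
have Tf x : f x \in T by apply: mem_gen; rewrite inE; apply/asboolP; exists x.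
have sgM : monoid_morphism (sgval : subg_of T -> H) by [].
exists (subg_of T), (fun x => Subg (Tf x)), sgval; split=> //.
- apply: (nilpotent_joint_inj (a1 := sgval) (a2 := sgval) sgM sgM) => // x y e _.
  exact: val_inj.
- apply: sub_finite_set ff => x /= fx e; apply: fx; exact: val_inj.
move=> H' b b' bM b'M bb' h.
pose E := [set t in T | b (subg T t) == b' (subg T t)].
have gE : group_set E.
  apply/group_setP; split=> [|t u].
    by rewrite inE group1 /= morph1 (morph1g bM) (morph1g b'M).
  rewrite !inE => /andP[Tt /eqP et] /andP[Tu /eqP eu]; rewrite groupM //=.
  by rewrite morphM // (morphMg bM) (morphMg b'M) et eu.
have /subsetP/(_ (sgval h) (subgP h)) : T \subset Group gE.
  rewrite gen_subG; apply/subsetP => t; rewrite inE => /asboolP[x ->].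
  rewrite inE Tf /=; have -> : subg T (f x) = Subg (Tf x).
    by apply: val_inj; rewrite /= subgK.
  by rewrite bb'.
by rewrite inE sgvalK => /andP[_ /eqP].
Qed.

End NilpotentTargets.

Section Cayley.
Import fintype boot.finset GroupScope.
Local Open Scope group_scope.

(* Isomorphism types of finite groups, as a countable type *)
Definition group_code : Type := {n : nat & {group {perm 'I_n}}}.
Definition code_group (c : group_code) : finGroupType := subg_of (tagged c).

Lemma inverse_morphism (G H : groupType) (f : G -> H) (g : H -> G) :
  monoid_morphism f -> cancel f g -> cancel g f -> monoid_morphism g.
Proof.
move=> fM fK gK; split=> [|x y]; apply: (can_inj fK); first by rewrite gK (morph1g fM).
by rewrite (morphMg fM) !gK.
Qed.

Lemma code_groupP (H : finGroupType) : exists (c : group_code) (k : H -> code_group c)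
    (k' : code_group c -> H), [/\ monoid_morphism k, cancel k k' & cancel k' k].
Proof.
pose act (h : H) (i : 'I_#|H|) : 'I_#|H| := enum_rank (enum_val i * h).
have actI h : injective (act h).
  by move=> i j /enum_rank_inj/mulIg/enum_val_inj.
pose phi h := perm (actI h).
have phiM h h' : phi (h * h') = phi h * phi h'.
  by apply/permP => i; rewrite permM !permE /act enum_rankK mulgA.
have phi_inj h h' : phi h = phi h' -> h = h'.
  move=> /permP/(_ (enum_rank 1)); rewrite !permE /act enum_rankK !mul1g.
  exact: enum_rank_inj.
have phi1 : phi 1 = 1 by apply: (mulgI (phi 1)); rewrite -phiM !mulg1.
pose T := [set phi h | h : H].
have gT : group_set T.
  apply/group_setP; split=> [|_ _ /imsetP[h _ ->] /imsetP[h' _ ->]].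
    by apply/imsetP; exists 1.
  by apply/imsetP; exists (h * h').
have phiT h : phi h \in Group gT by apply/imsetP; exists h.
pose c : group_code := Tagged (fun n => {group {perm 'I_n}}) (Group gT).
pose k h : code_group c := Subg (phiT h).
have /choice[k' k'P] : forall u : code_group c, exists h, k h = u.
  by move=> [u uT]; have /imsetP[h _ e] := uT; exists h; apply: val_inj; rewrite /= e.
exists c, k, k'; split=> [|h|u]; last exact: k'P.
  by split=> [|x y]; apply: val_inj; rewrite /= ?phi1 ?phiM.
by apply: phi_inj; have := k'P (k h) => /(congr1 val).
Qed.

End Cayley.

(** * A natural choice of homomorphisms *)

Section NaturalFamily.
Import GRing.Theory boot.monoid fintype boot.finset GroupScope.
Local Open Scope group_scope.
Variables (K : groupType) (X : Type) (e : forall p, (K -> 'F_p) -> X -> 'F_p).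
Arguments e {p}.
Hypothesis ec : forall p, prime p -> dual_coords (@e p).
Hypothesis Kp : forall p, prime p -> p_projective K p.

Definition natural_family (Psi : forall H : finGroupType, (X -> H) -> K -> H) : Prop :=
  [/\ forall (H : finGroupType) f, nilpotent [set: H]%G -> finsupp f ->
        monoid_morphism (Psi H f),
      forall (H H' : finGroupType) (f : X -> H) (a : H -> H'),
        nilpotent [set: H]%G -> finsupp f ->
        nilpotent [set: H']%G -> monoid_morphism a ->
        forall k, Psi H' (a \o f) k = a (Psi H f k) &
      forall (H : finGroupType) f p (al : H -> 'F_p), nilpotent [set: H]%G ->
        finsupp f -> prime p -> addhom al ->
        forall x, e (al \o Psi H f) x = al (f x)].

(** A compatible lift for one generating pair [d] yields, by composition, values for all pairs
    receiving a map from [d], and these values are natural. Products make the pairs directed, and a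
    cluster point keeps naturality because each instance of it involves finitely many values. *)
Lemma natural_family_exists : exists Psi, natural_family Psi.
Proof.
pose C := {c : group_code & X -> code_group c}.
pose D := {Hf : C | [/\ nilpotent [set: code_group (tag Hf)]%G,
  finsupp (tagged Hf) & epi_on (tagged Hf)]}.
pose G (d : D) : finGroupType := code_group (tag (sval d)).
pose F (d : D) : X -> G d := tagged (sval d).
pose maps (d : D) (H : finGroupType) (f : X -> H) (a : G d -> H) :=
  monoid_morphism a /\ forall x, a (F d x) = f x.
pose le (d d' : D) := exists a : G d' -> G d, maps d' (G d) (F d) a.
have maps_comp d d' (H : finGroupType) (f : X -> H) a b :
    maps d' (G d) (F d) b -> maps d H f a -> maps d' H f (a \o b).
  move=> [bM bE] [aM aE]; split=> [|x]; last by rewrite /= bE aE.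
  exact: morphism_comp bM aM.
have cover (H : finGroupType) (f : X -> H) : nilpotent [set: H]%G -> finsupp f ->
    exists d a, maps d H f a.
  move=> nilH ff; have [H0 [f0 [a [nil0 f0f ep aM aE]]]] := epi_cover nilH ff.
  have [c [k [k' [kM kK k'K]]]] := code_groupP H0.
  have k'M := inverse_morphism kM kK k'K.
  have P : [/\ nilpotent [set: code_group c]%G, finsupp (k \o f0) & epi_on (k \o f0)].
    split.
    - apply: (nilpotent_joint_inj (a1 := k') (a2 := k') k'M k'M) => // x y e' _.
      exact: can_inj k'K _ _ e'.
    - by apply: finsupp_comp f0f; apply: morph1g kM.
    - move=> H' b b' bM b'M bb' h; rewrite -(k'K h).
      by apply: (ep H' (b \o k) (b' \o k)) => //; apply: morphism_comp.
  exists (exist _ (Tagged (fun c => X -> code_group c) (k \o f0)) P), (a \o k').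
  split=> [|x]; last by rewrite /= kK.
  exact: morphism_comp k'M aM.
have D0 : inhabited D.
  have perm1 (s : {perm 'I_1}) : s = 1 by apply/permP => i; rewrite !ord1.
  have [||d _] := cover {perm 'I_1} (fun=> 1); last exact: (inhabits d).
    by apply: nilpotent_coprime_commute => s t _ _ _; rewrite (perm1 s) (perm1 t).
  by apply: (sub_finite_set _ (finite_set0 X)) => x /=.
have le_trans x y z : le x y -> le y z -> le x z.
  by move=> [a aP] [b bP]; exists (a \o b); apply: maps_comp aP.
have nilG d : nilpotent [set: G d]%G by case: (svalP d).
have Ff d : finsupp (F d) by case: (svalP d).
have epiF d : epi_on (F d) by case: (svalP d).
have le_dir x y : exists z, le x z /\ le y z.
  have [||d [a [aM aE]]] := cover (G x * G y)%type (fun u => (F x u, F y u)).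
  - by apply: (nilpotent_joint_inj (a1 := fst) (a2 := snd)) => // -[u v] [u' v'] /= -> ->.
  - have fU : finite_set ([set u | F x u <> 1] `|` [set u | F y u <> 1])%classic.
      by rewrite finite_setU; split; apply: Ff.
    apply: sub_finite_set fU => u /= nu.
    by apply: contrapT => /not_orP[/contrapT xu /contrapT yu]; apply: nu; rewrite xu yu.
  exists d; split; [exists (fst \o a)|exists (snd \o a)]; split=> [|u]; rewrite /= ?aE //.
  + exact: morphism_comp aM _.
  + exact: morphism_comp aM _.
pose th d := projT1 (cid (compatible_lift ec Kp (nilG d) (Ff d))).
have thP d := projT2 (cid (compatible_lift ec Kp (nilG d) (Ff d))).
pose I := (C * K)%type.
(* When [i] receives no map from [d] the condition is void and 1 is taken; such [d] are eventually
   left behind if the map in [i] is finitely supported. *)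
have y0_ex (d : D) (i : I) : exists u : code_group (tag i.1), forall a,
    maps d _ (tagged i.1) a -> u = a (th d i.2).
  have [[a aP]|na] := pselect (exists a, maps d _ (tagged i.1) a).
    exists (a (th d i.2)) => b bP; apply: epiF; [exact: aP.1|exact: bP.1|].
    by move=> x; rewrite aP.2 bP.2.
  by exists 1 => a aP; case: na; exists a.
pose y0 d i := projT1 (cid (y0_ex d i)).
have y0P d i := projT2 (cid (y0_ex d i)).
have [|y yP] :=
    @net_cluster D le D0 le_trans le_dir I (fun i => code_group (tag i.1)) y0.
  by move=> i; apply: finite_finset.
pose c H := projT1 (cid (code_groupP H)).
have c_ex H := projT2 (cid (code_groupP H)).
pose k H := projT1 (cid (c_ex H)); have k_ex H := projT2 (cid (c_ex H)).
pose k' H := projT1 (cid (k_ex H)); have kP H := projT2 (cid (k_ex H)).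
pose ix (H : finGroupType) (f : X -> H) : C :=
  Tagged (fun c => X -> code_group c) (k H \o f).
pose Psi (H : finGroupType) (f : X -> H) (x : K) : H := k' H (y (ix H f, x)).
(* finitely many values of [Psi] are read off the lift of a large enough index *)
have PsiE (H H' : finGroupType) (f : X -> H) (f' : X -> H') (E : set K) :
    nilpotent [set: H]%G -> finsupp f -> nilpotent [set: H']%G -> finsupp f' ->
    finite_set E -> exists d a a', [/\ maps d H f a, maps d H' f' a' & forall x, E x ->
      Psi H f x = a (th d x) /\ Psi H' f' x = a' (th d x)].
  move=> nilH ff nilH' ff' Ef; have [d0 [a0 a0P]] := cover H f nilH ff.
  have [d1 [a1 a1P]] := cover H' f' nilH' ff'.
  have [d2 [le0 le1]] := le_dir d0 d1.
  have [|d [le2 e0]] := yP ([set (ix H f, x) | x in E] `|`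
      [set (ix H' f', x) | x in E])%classic d2.
    by rewrite finite_setU; split; apply: finite_image.
  have [b0 b0P] := le_trans _ _ _ le0 le2; have [b1 b1P] := le_trans _ _ _ le1 le2.
  have c0P := maps_comp _ _ _ _ _ _ b0P a0P.
  have c1P := maps_comp _ _ _ _ _ _ b1P a1P.
  have PsiP (H2 : finGroupType) (f2 : X -> H2) a x : maps d H2 f2 a ->
      y0 d (ix H2 f2, x) = y (ix H2 f2, x) -> Psi H2 f2 x = a (th d x).
    move=> [aM aE] yE; have [kM kK _] := kP H2; rewrite /Psi -yE.
    suff -> : y0 d (ix H2 f2, x) = k H2 (a (th d x)) by apply: kK.
    apply: (y0P d (ix H2 f2, x) (k H2 \o a)); split=> [|u]; last by rewrite /= aE.
    exact: morphism_comp aM kM.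
  exists d, (a0 \o b0), (a1 \o b1); split=> // x Ex; split; apply: PsiP => //; apply: e0.
    by left; exists x.
  by right; exists x.
have thM d : monoid_morphism (th d) := (thP d).1.
exists Psi; split.
- move=> H f nilH ff.
  have PM x x' : Psi H f (x * x') = Psi H f x * Psi H f x'.
    have [d [a [a2 [[aM _] _ e0]]]] := PsiE _ _ f f [set x; x'; x * x']%classic
      nilH ff nilH ff (finite_set3 _ _ _).
    rewrite !(e0 _ _).1; [|by left; right|by left; left|by right].
    by rewrite (morphMg (thM d)) (morphMg aM).
  by split=> //; apply: (mulgI (Psi H f 1)); rewrite -PM !mulg1.
- move=> H H' f a nilH ff nilH' aM x.
  have f'f : finsupp (a \o f) by apply: finsupp_comp ff; apply: morph1g aM.
  have [d [b [b' [[bM bE] [b'M b'E] e0]]]] := PsiE _ _ f (a \o f) [set x]%classic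
    nilH ff nilH' f'f (finite_set1 _).
  rewrite (e0 x erefl).1 (e0 x erefl).2.
  apply: (epiF d _ b' (a \o b)) => // [|u]; last by rewrite b'E /= bE.
  exact: morphism_comp bM aM.
- move=> H f p al nilH ff pr ah.
  have [|chi [chih chiE]] := dc_surj (ec pr) (f := al \o f).
    apply: sub_finite_set ff => x /= ax fx; apply: ax.
    by rewrite fx addhom1.
  have -> : al \o Psi H f = chi; last exact: chiE.
  apply/funext => x.
  have [d [a [a2 [[aM aE] _ e0]]]] := PsiE _ _ f f [set x]%classic
    nilH ff nilH ff (finite_set1 _).
  rewrite /= (e0 x erefl).1; have aah : addhom (al \o a).
    by move=> u v; rewrite /= (morphMg aM) ah.
  apply: (dc_eq (ec pr) (chi := (al \o a) \o th d)) => //.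
    by move=> u v; rewrite /= (morphMg (thM d)) (morphMg aM) ah.
  move=> u; rewrite chiE (proj2 (thP d) p (al \o a) pr aah) /=.
  by rewrite aE.
Qed.
End NaturalFamily.

Section NaturalBijection.
Import GRing.Theory boot.monoid fintype boot.finset GroupScope.
Local Open Scope group_scope.
Variables (K : groupType) (X : Type) (e : forall p, (K -> 'F_p) -> X -> 'F_p).
Arguments e {p}.
Hypothesis ec : forall p, prime p -> dual_coords (@e p).
Variable Psi : forall H : finGroupType, (X -> H) -> K -> H.
Arguments Psi {H}.
Hypothesis PsiN : natural_family (@e) (@Psi).

Let PsiM (H : finGroupType) (f : X -> H) :
  nilpotent [set: H]%G -> finsupp f -> monoid_morphism (Psi f).
Proof. by case: PsiN => h _ _; apply: h. Qed.

Let Psi_nat (H H' : finGroupType) (f : X -> H) (a : H -> H') :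
  nilpotent [set: H]%G -> finsupp f -> nilpotent [set: H']%G -> monoid_morphism a ->
  forall k, Psi (a \o f) k = a (Psi f k).
Proof. by case: PsiN => _ h _; apply: h. Qed.

(** Multiplication by powers of the central [z] is a homomorphism [mu] from [H * C] to [H], so the
    formula is naturality along the two projections and [mu]. *)
Lemma natural_family_central (H : finGroupType) (z : H) (f : X -> H)
    (chi : K -> 'F_(#[z])) : nilpotent [set: H]%G -> prime #[z] ->
  (forall h, commute z h) -> finsupp f -> addhom chi ->
  finsupp (fun x => f x * z ^+ e chi x) /\
  forall k, Psi (fun x => f x * z ^+ e chi x) k = Psi f k * z ^+ chi k.
Proof.
move=> nilH pr zC ff chih; pose C : finGroupType := 'F_(#[z]).
have nilC : nilpotent [set: C]%G.
  apply: abelian_nil; apply/centsP => a _ b _; exact: (@addrC 'F_(#[z])).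
have idh : addhom (id : C -> 'F_(#[z])) by [].
pose g : X -> C := e chi.
have gf : finsupp g := dc_supp (ec pr) chih.
have gE k : Psi g k = chi k.
  have h : addhom (id \o Psi g) by move=> x y; rewrite /= (morphMg (PsiM nilC gf)).
  apply: (dc_eq (ec pr) h chih) => x; have [_ _ PsiE] := PsiN.
  by rewrite (PsiE C g _ id nilC gf pr idh).
pose F x : H * C := (f x, g x).
have nilP : nilpotent [set: (H * C)%type]%G.
  by apply: (nilpotent_joint_inj (a1 := fst) (a2 := snd)) => // -[u v] [u' v'] /= -> ->.
have Ff : finsupp F.
  have fU : finite_set ([set u | f u <> 1] `|` [set u | g u <> 1])%classic.
    by rewrite finite_setU.
  apply: sub_finite_set fU => u /= nu.
  by apply: contrapT => /not_orP[/contrapT xu /contrapT yu]; apply: nu; rewrite /F xu yu.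
have fM : monoid_morphism (fst : H * C -> H) by [].
have sM : monoid_morphism (snd : H * C -> C) by [].
have F1 k : (Psi F k).1 = Psi f k by rewrite -(Psi_nat nilP Ff nilH fM).
have F2 k : (Psi F k).2 = chi k by rewrite -gE -(Psi_nat nilP Ff nilC sM).
pose mu (u : H * C) := u.1 * z ^+ (u.2 : 'F_(#[z])).
have muM : monoid_morphism mu.
  split=> [|u v]; first by rewrite /mu /= mulg1.
  rewrite /mu /= (expg_FpD u.2 v.2 pr) !mulgA; congr (_ * _).
  by rewrite -!mulgA; congr (_ * _); apply/commuteX/commute_sym/zC.
split; first exact: finsupp_comp (morph1g muM) Ff.
by move=> k; rewrite (Psi_nat nilP Ff nilH muM) /mu F1 F2.
Qed.

(** Modulo [z] the homomorphism comes from some [fb]. A lift of [fb] gives a homomorphism differing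
    from [th] by an additive map into the powers of [z], which [natural_family_central] absorbs. *)
Lemma natural_family_surj (H : finGroupType) (th : K -> H) : nilpotent [set: H]%G ->
  monoid_morphism th -> exists f, finsupp f /\ forall k, th k = Psi f k.
Proof.
have [n] := ubnP #|[set: H]|; elim: n => // n IH in H th * => leH nilH thM.
have [H1|Hn] := eqVneq [set: H] 1.
  have eq1 (h : H) : h = 1 by have := in_setT h; rewrite H1 => /set1P.
  exists (fun=> 1); split=> [|k]; last by rewrite [LHS]eq1 [RHS]eq1.
  by apply: (sub_finite_set _ (finite_set0 X)) => x /=.
have [z [pr zC]] := finite_Cauchy_center nilH Hn.
have [cM /choice[sig sigK] ck cz] := central_quotient zC.
have nilZ := nilpotent_coset nilH zC.
have [|fb [fbf fbE]] := IH _ (coset <[z]> \o th) (card_coset_lt pr zC leH) nilZ.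
  exact: morphism_comp thM cM.
(* The lift must be 1 where [fb] is, to keep finite support. *)
pose f x := if fb x == 1 then 1 else sig (fb x).
have ff : finsupp f.
  by apply: sub_finite_set fbf => x /=; rewrite /f => + fx; rewrite fx eqxx.
have fE : coset <[z]> \o f = fb.
  apply/funext => x; rewrite /f /=; case: eqP => [->|_]; last exact: sigK.
  exact: morph1g cM.
have PM := PsiM nilH ff.
have /choice[d dP] : forall k, exists a : 'F_(#[z]), th k = Psi f k * z ^+ a.
  move=> k; have /ck/cycleP[j jE] : coset <[z]> ((Psi f k)^-1 * th k) = 1.
    rewrite (morphMg cM) (morphVg cM) -(Psi_nat nilH ff nilZ cM) fE.
    by rewrite -[coset _ (th k)]/((coset <[z]> \o th) k) fbE mulVg.
  have jz : (j %% #[z] < (Zp_trunc (pdiv #[z])).+2)%N.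
    by rewrite [X in (_ < X)%N](Fp_cast pr) ltn_mod order_gt0.
  by exists (Ordinal jz); rewrite /= expg_mod_order -jE mulKVg.
have dh : addhom d.
  move=> x y; apply: (expg_Fp_inj pr); rewrite expg_FpD //.
  apply: (mulgI (Psi f (x * y))); rewrite -dP (morphMg thM) !dP (morphMg PM).
  rewrite !mulgA; congr (_ * _); rewrite -!mulgA; congr (_ * _).
  exact/commute_sym/commuteX/commute_sym/zC.
have [f'f f'E] := natural_family_central nilH pr zC ff dh.
by eexists; split; [exact: f'f|move=> k; rewrite f'E dP].
Qed.

(** Modulo [z] the two maps agree, so they differ by powers of [z] with exponents [g]. These are the
    coordinates of some [chi], which vanishes because both maps give the same homomorphism. *)
Lemma natural_family_inj (H : finGroupType) (f f' : X -> H) : nilpotent [set: H]%G ->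
  finsupp f -> finsupp f' -> (forall k, Psi f k = Psi f' k) -> forall x, f x = f' x.
Proof.
have [n] := ubnP #|[set: H]|; elim: n => // n IH in H f f' * => leH nilH ff f'f ef.
have [H1|Hn] := eqVneq [set: H] 1.
  have eq1 (h : H) : h = 1 by have := in_setT h; rewrite H1 => /set1P.
  by move=> x; rewrite [LHS]eq1 [RHS]eq1.
have [z [pr zC]] := finite_Cauchy_center nilH Hn.
have [cM cs ck cz] := central_quotient zC.
have nilZ := nilpotent_coset nilH zC; have c1 := morph1g cM.
have cff' x : coset <[z]> (f x) = coset <[z]> (f' x).
  apply: (IH _ (coset <[z]> \o f) (coset <[z]> \o f') (card_coset_lt pr zC leH) nilZ).
  - exact: finsupp_comp c1 ff.
  - exact: finsupp_comp c1 f'f.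
  - by move=> k; rewrite !(Psi_nat _ _ nilZ cM) // ef.
have /choice[g gP] : forall x, exists a : 'F_(#[z]), f' x = f x * z ^+ a.
  move=> x; have /ck/cycleP[j jE] : coset <[z]> ((f x)^-1 * f' x) = 1.
    by rewrite (morphMg cM) (morphVg cM) cff' mulVg.
  have jz : (j %% #[z] < (Zp_trunc (pdiv #[z])).+2)%N.
    by rewrite [X in (_ < X)%N](Fp_cast pr) ltn_mod order_gt0.
  by exists (Ordinal jz); rewrite /= expg_mod_order -jE mulKVg.
have gf : finite_set [set x | g x <> 0%R]%classic.
  have fU : finite_set ([set u | f u <> 1] `|` [set u | f' u <> 1])%classic.
    by rewrite finite_setU.
  apply: sub_finite_set fU => x /= gx.
  apply: contrapT => /not_orP[/contrapT xu /contrapT yu]; apply: gx.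
  by apply: (expg_Fp_eq1 pr); have := gP x; rewrite xu yu mul1g.
have [chi [chih chiE]] := dc_surj (ec pr) gf.
have [_ f'E] := natural_family_central nilH pr zC ff chih.
have chi0 k : chi k = 0%R.
  apply: (expg_Fp_eq1 pr); apply: (mulgI (Psi f k)); rewrite -f'E mulg1 ef.
  by congr (Psi _ k); apply/funext => x; rewrite chiE.
move=> x; rewrite gP -chiE.
have -> : chi = fun=> 0%R by apply/funext.
by rewrite (dc0 (ec pr)) mulg1.
Qed.

End NaturalBijection.

(** * Profinite completions *)

Section FiniteGroups.
Local Open Scope group_scope.
Variables (Q : groupType) (s : seq Q).
Hypothesis sP : forall x, x \in s.

(** The proof stays an argument of the type because the group operations attached to it depend on
    it. *)
Definition listed_group (_ : forall x, x \in s) : Type := seq_sub s.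
Local Notation T := (listed_group sP).
HB.instance Definition _ := Finite.on T.

Definition listed (x : Q) : T := SeqSub (sP x).
Lemma listedK (u : T) : listed (ssval u) = u. Proof. exact: val_inj. Qed.

Definition listed_mul (u v : T) : T := listed (ssval u * ssval v).
Definition listed_inv (u : T) : T := listed (ssval u)^-1.

Lemma listed_mulA : associative listed_mul.
Proof. by move=> u v w; rewrite /listed_mul /= mulgA. Qed.
Lemma listed_mul1 : left_id (listed 1) listed_mul.
Proof. by move=> u; rewrite /listed_mul /= mul1g listedK. Qed.
Lemma listed_mulV : left_inverse (listed 1) listed_inv listed_mul.
Proof. by move=> u; rewrite /listed_mul /= mulVg. Qed.

HB.instance Definition _ := Finite_isGroup.Build T listed_mulA listed_mul1 listed_mulV.

Lemma listed_iso : group_iso (listed : Q -> T).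
Proof.
split; last by exists (fun u : T => ssval u) => u //; apply: listedK.
by split=> // x y; apply: val_inj.
Qed.
End FiniteGroups.

Lemma finite_groupP (Q : groupType) : finite_set [set: Q]%classic ->
  exists (N : finGroupType) (f : Q -> N), group_iso f.
Proof.
move=> /finite_seqP[s sE]; have sP x : x \in s.
  by have : [set: Q]%classic x by []; rewrite sE.
by exists (listed_group sP), (listed sP); apply: listed_iso.
Qed.

Section Completion.
Local Open Scope classical_set_scope.
Local Open Scope group_scope.
Variable K : groupType.
Local Notation Kh := (profinite_completion K).
Local Notation iota := (@to_completion K).
Implicit Types (t : Kh) (k : K) (N : finite_index_normal K).

Definition cthread t N : finite_quotient N := @thread (finite_quotients K) t N.

Lemma cthread_surj t N : exists k, cthread t N = quotient_proj (sval N) k.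
Proof. by exists (quotient_repr (cthread t N)); rewrite quotient_reprK. Qed.

Lemma completion_le (N M : finite_index_normal K) t :
  fin_le N M -> cthread t M = 1 -> cthread t N = 1.
Proof.
move=> NM tM; have e : finite_quotient_map N (cthread t M) = cthread t N.
  exact: (@threadP (finite_quotients K) t N M NM).
by rewrite -e tM; apply: (finite_quotient_mapM NM).1.
Qed.

Definition completion_cont (A : groupType) (f : Kh -> A) : Prop :=
  exists N, forall t, cthread t N = 1 -> f t = 1.

Lemma completion_dense (A : groupType) (f g : Kh -> A) :
  monoid_morphism f -> completion_cont f -> monoid_morphism g -> completion_cont g ->
  (forall k, f (iota k) = g (iota k)) -> forall t, f t = g t.
Proof.
move=> fM [N fN] gM [M gM'] fg t.
have [_ [_ _ _ dir]] := fin_le_directed K; have [P [NP MP]] := dir N M.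
have [k tk] := cthread_surj t P.
have t1 : cthread ((iota k)^-1 * t) P = 1.
  by rewrite -[LHS]/((quotient_proj (sval P) k)^-1 * cthread t P) tk mulVg.
have -> : t = iota k * ((iota k)^-1 * t) by rewrite mulKVg.
rewrite (morphMg fM) (morphMg gM) fg (fN _ (completion_le NP t1)).
by rewrite (gM' _ (completion_le MP t1)).
Qed.

Definition kernel_subgroup (A : groupType) (f : K -> A) (fM : monoid_morphism f) :
  normal_subgroup K.
Proof.
exists (fun x => f x = 1).
- exact: morph1g fM.
- by move=> x y fx fy; rewrite (morphMg fM) fx fy mulg1.
- by move=> x fx; rewrite (morphVg fM) fx invg1.
- by move=> x y fx; rewrite /conjg !(morphMg fM) fx mul1g -(morphMg fM) mulVg (morph1g fM).
Defined.

Lemma kernel_projP (A : groupType) (f : K -> A) (fM : monoid_morphism f) x y :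
  quotient_proj (kernel_subgroup fM) x = quotient_proj (kernel_subgroup fM) y <->
  f x = f y.
Proof.
rewrite quotient_projP /= (morphMg fM) (morphVg fM); split=> [/(congr1 (mulg (f x)))|->].
  by rewrite mulKVg mulg1 => ->.
by rewrite mulVg.
Qed.

Lemma completion_extend (A : groupType) (f : K -> A) : finite_set [set: A] ->
  monoid_morphism f -> exists g : Kh -> A,
  [/\ monoid_morphism g, completion_cont g & forall k, g (iota k) = f k].
Proof.
move=> Af fM; pose N0 := kernel_subgroup fM.
have N0f : finite_set [set: Defs.quotient_group N0].
  rewrite -(preimage_setT (fun u : Defs.quotient_group N0 => f (quotient_repr u))).
  apply: finite_preimage Af => u v _ _ /(kernel_projP fM).
  by rewrite !quotient_reprK.
pose N : finite_index_normal K := exist _ N0 N0f.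
have fE k : f (quotient_repr (quotient_proj N0 k)) = f k.
  by apply/(kernel_projP fM); rewrite quotient_reprK.
exists (fun t => f (quotient_repr (cthread t N))); split.
- split; first by rewrite -[cthread 1 N]/(quotient_proj N0 1) fE (morph1g fM).
  move=> t u; have [x tx] := cthread_surj t N; have [y uy] := cthread_surj u N.
  rewrite -[cthread (t * u) N]/(cthread t N * cthread u N) tx uy.
  by rewrite -(quotient_proj_morphism (sval N)).2 !fE (morphMg fM).
- by exists N => t ->; rewrite -[1]/(quotient_proj N0 1) fE (morph1g fM).
- by move=> k; rewrite -[RHS]fE.
Qed.

Lemma completion_cont_continuous (A : groupType) (f : Kh -> A) :
  monoid_morphism f -> completion_cont f ->
  continuous (f : Kh -> discrete_topology A).
Proof.
move=> fM [N fN] t U /principal_filterP Uf.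
apply: filterS (@near_thread (finite_quotients K) N t) => u /= ut.
have tu : cthread (t^-1 * u) N = 1.
  by rewrite -[LHS]/((thread t N)^-1 * thread u N) ut mulVg.
suff -> : f u = f t by exact: Uf.
have := fN _ tu; rewrite (morphMg fM) (morphVg fM) => /(congr1 (mulg (f t))).
by rewrite mulKVg mulg1.
Qed.

End Completion.

Section OnePoint.
Local Open Scope classical_set_scope.
Local Open Scope group_scope.
Variable X : choiceType.
Local Notation Xs := (one_point_compactification (discrete_topology X)).

Lemma discrete_compact_finite (W : set (discrete_topology X)) :
  compact W -> finite_set W.
Proof.
move=> Wc; apply: contrapT => Winf.
pose F : set_system (discrete_topology X) := fun A => finite_set (W `\` A).
have FF : ProperFilter F.
  apply: Build_ProperFilter_ex.
    move=> A FA; apply: contrapT => nA; apply: Winf.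
    by apply: sub_finite_set FA => x Wx; split=> // Ax; apply: nA; exists x.
  split.
  - by rewrite /F setDT; apply: finite_set0.
  - by move=> A B FA FB; rewrite /F setDIr finite_setU.
  - by move=> A B AB; apply: sub_finite_set => x [Wx nBx]; split=> // /AB.
have FW : F W by rewrite /F setDv; apply: finite_set0.
have [x [Wx cx]] := Wc F FF FW.
have [|y [[_ ny] /= xy]] := cx (W `\ x) [set x] _ (discrete_set1 x).
  apply: (sub_finite_set _ (finite_set1 x)) => y [Wy /= ny].
  by apply: contrapT => yx; apply: ny.
exact: ny.
Qed.

Lemma one_point_nbhs_cofinite (U : set Xs) :
  nbhs (None : Xs) U <-> U None /\ finite_set [set x | ~ U (Some x)].
Proof.
split=> [U0|[U0 Uf]].
  split; first exact: nbhs_singleton U0.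
  case: U0 => W [Wc _] WU; apply: sub_finite_set (discrete_compact_finite Wc).
  move=> x /= nUx; apply: contrapT => nWx; apply: nUx; apply: WU.
  by left; exists x.
exists [set x | ~ U (Some x)].
  by split; [apply: finite_compact|apply: discrete_closed].
by move=> _ [[x /= /contrapT Ux <-]|->].
Qed.

Lemma one_point_continuous (T : topologicalType) (f : Xs -> T) :
  (forall U, nbhs (f None) U -> finite_set [set x | ~ U (f (Some x))]) ->
  continuous f.
Proof.
move=> H [x|] U fU; last first.
  apply/one_point_nbhs_cofinite; split; first exact: nbhs_singleton fU.
  exact: H.
have sub : [set (x : discrete_topology X)] `<=` [set y | U (f (Some y))].
  by move=> y ->; exact: nbhs_singleton fU.
exact: (filterS sub (discrete_set1 (x : discrete_topology X))).
Qed.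

End OnePoint.

(** * The universal property of the completion *)

Section CompletionFree.
Local Open Scope classical_set_scope.
Local Open Scope group_scope.
Variables (K : groupType) (X : choiceType).
Variable Psi : forall H : finGroupType, (X -> H) -> K -> H.
Arguments Psi {H}.
Hypothesis PsiM : forall (H : finGroupType) (f : X -> H),
  nilpotent [set: H]%G -> finsupp f -> monoid_morphism (Psi f).
Hypothesis Psi_nat : forall (H H' : finGroupType) (f : X -> H) (a : H -> H'),
  nilpotent [set: H]%G -> finsupp f -> nilpotent [set: H']%G -> monoid_morphism a ->
  forall k, Psi (a \o f) k = a (Psi f k).
Hypothesis Psi_surj : forall (H : finGroupType) (th : K -> H), nilpotent [set: H]%G ->
  monoid_morphism th -> exists f, finsupp f /\ forall k, th k = Psi f k.
Hypothesis Psi_inj : forall (H : finGroupType) (f f' : X -> H), nilpotent [set: H]%G ->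
  finsupp f -> finsupp f' -> (forall k, Psi f k = Psi f' k) -> forall x, f x = f' x.
Hypothesis Knil : nil_quotients K.

Lemma group_iso_inv (G H : groupType) (f : G -> H) : group_iso f ->
  exists g : H -> G, [/\ monoid_morphism g, cancel f g & cancel g f].
Proof.
by move=> [fM [g fK gK]]; exists g; split=> //; apply: inverse_morphism fM fK gK.
Qed.

(* [f] is the restriction to the basis of the extension of [th] to the completion *)
Definition matches (H : groupType) (th : K -> H) (f : X -> H) : Prop :=
  finsupp f /\ exists (N : finGroupType) (k : H -> N),
    [/\ group_iso k, nilpotent [set: N]%G & forall x, k (th x) = Psi (k \o f) x].

(** By naturality the relation [matches] does not depend on the finite group chosen as a model of
    [H]. *)
Lemma matches_map (H H' : groupType) (th : K -> H) f (a : H -> H')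
    (N : finGroupType) (k : H' -> N) : matches th f -> monoid_morphism a ->
  nilpotent [set: N]%G -> monoid_morphism k ->
  forall x, k (a (th x)) = Psi (k \o (a \o f)) x.
Proof.
move=> [ff [N0 [k0 [k0i nil0 e0]]]] aM nilN kM x.
have [g [gM k0K gK]] := group_iso_inv k0i.
have kf : finsupp (k0 \o f) by apply: finsupp_comp ff; apply: morph1g k0i.1.
have cM : monoid_morphism (k \o (a \o g)).
  exact: morphism_comp (morphism_comp gM aM) kM.
have -> : k \o (a \o f) = (k \o (a \o g)) \o (k0 \o f).
  by apply/funext => u; rewrite /= k0K.
by rewrite (Psi_nat nil0 kf nilN cM) -e0 /= k0K.
Qed.

Lemma matches_comp (H H' : groupType) (th : K -> H) f (a : H -> H') :
  finite_nilpotent H' -> matches th f -> monoid_morphism a -> matches (a \o th) (a \o f).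
Proof.
move=> [N [k [ki nilN]]] m aM; split.
  by apply: finsupp_comp m.1; apply: morph1g aM.
by exists N, k; split=> // x; apply: (matches_map m aM nilN ki.1).
Qed.

Lemma matches_fun (H : groupType) (th : K -> H) f f' :
  matches th f -> matches th f' -> f = f'.
Proof.
move=> m [f'f [N [k [ki nilN e']]]]; have [g [_ kK _]] := group_iso_inv ki.
have idM : monoid_morphism (id : H -> H) by [].
apply/funext => x; apply: (can_inj kK).
have k1 := morph1g ki.1.
apply: (Psi_inj nilN (finsupp_comp k1 m.1) (finsupp_comp k1 f'f)) => y.
by rewrite -e' (matches_map m idM nilN ki.1).
Qed.

Lemma matches_hom (H : groupType) (th th' : K -> H) f :
  matches th f -> matches th' f -> forall x, th x = th' x.
Proof.
move=> m [f'f [N [k [ki nilN e']]]]; have [g [_ kK _]] := group_iso_inv ki.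
have idM : monoid_morphism (id : H -> H) by [].
by move=> x; apply: (can_inj kK); rewrite e' (matches_map m idM nilN ki.1).
Qed.

Lemma matches_exists (H : groupType) (th : K -> H) : finite_nilpotent H ->
  monoid_morphism th -> exists f, matches th f.
Proof.
move=> [N [k [ki nilN]]] thM; have [g [gM kK gK]] := group_iso_inv ki.
have [f [ff fE]] := Psi_surj nilN (morphism_comp thM ki.1).
exists (g \o f); split; first by apply: finsupp_comp ff; apply: morph1g gM.
exists N, k; split=> // x.
have -> : k \o (g \o f) = f by apply/funext => u; rewrite /= gK.
by rewrite -fE.
Qed.

Lemma matches_lift (H : groupType) (f : X -> H) : finite_nilpotent H -> finsupp f ->
  exists th : K -> H, monoid_morphism th /\ matches th f.
Proof.
move=> [N [k [ki nilN]]] ff; have [g [gM kK gK]] := group_iso_inv ki.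
have kf : finsupp (k \o f) by apply: finsupp_comp ff; apply: morph1g ki.1.
exists (g \o Psi (k \o f)); split; first exact: morphism_comp (PsiM nilN kf) gM.
by split=> //; exists N, k; split=> // x; rewrite /= gK.
Qed.

Local Notation S := (finite_quotients K).
Local Notation Kh := (profinite_completion K).
Local Notation iota := (@to_completion K).

Lemma finite_quotient_nilpotent (N : finite_index_normal K) :
  finite_nilpotent (finite_quotient N).
Proof.
have [Q [f fi]] := finite_groupP (svalP N).
have [g [gM fK gK]] := group_iso_inv fi.
exists Q, f; split=> //; apply: nilpotent_coprime_commute => x y _ _.
have pM := quotient_proj_morphism (sval N).
rewrite -(gK x) -(gK y) -(quotient_reprK (g x)) -(quotient_reprK (g y)).
exact: (Knil (morphism_comp pM fi.1)).
Qed.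

Lemma completion_pronilpotent : pronilpotent Kh.
Proof.
exists S; split; first exact: finite_quotient_nilpotent.
by exists id; apply: topgroup_iso_id.
Qed.

Let fq_ex N := matches_exists (finite_quotient_nilpotent N) (quotient_proj_morphism (sval N)).
Let fq N : X -> finite_quotient N := projT1 (cid (fq_ex N)).
Let fqP N : matches (quotient_proj (sval N) : K -> finite_quotient N) (fq N) :=
  projT2 (cid (fq_ex N)).

Lemma basis_thread x (N M : inv_index S) : inv_le N M ->
  @inv_map S N M (fq M x) = fq N x.
Proof.
move=> NM; have m := matches_comp (finite_quotient_nilpotent N) (fqP M)
  (finite_quotient_mapM NM).
have e : @finite_quotient_map K N M \o quotient_proj (sval M) = quotient_proj (sval N).
  by apply/funext => k; apply: finite_quotient_map_proj.
rewrite e in m; by have /(congr1 (fun f => f x)) := matches_fun m (fqP N).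
Qed.

Definition completion_basis
    (u : one_point_compactification (discrete_topology X)) : Kh :=
  if u is Some x then @mk_thread S (fun N => fq N x) (@basis_thread x) else 1.

Lemma completion_basis_continuous : continuous completion_basis.
Proof.
apply: inverse_limit_continuous => N; apply: one_point_continuous => U /= UN.
apply: sub_finite_set (fqP N).1 => x /= nU fx; apply: nU.
have : U (1 : finite_quotient N) by apply: nbhs_singleton UN.
by rewrite -fx.
Qed.

(** Continuity makes [g] factor through one finite quotient of [K], where the basis is given by [fq]
    and [matches_comp] applies. *)
Lemma completion_basisP (H : groupType) (g : Kh -> H) f : finite_nilpotent H ->
  monoid_morphism g -> completion_cont g -> matches (g \o iota) f ->
  forall x, g (completion_basis (Some x)) = f x.
Proof.
move=> Hnil gM [N gN] m x.
have gE t u : cthread t N = cthread u N -> g t = g u.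
  move=> tu; have := gN (u^-1 * t); rewrite (morphMg gM) (morphVg gM) => e.
  apply: (mulgI (g u)^-1); rewrite mulVg; apply: e.
  by rewrite -[LHS]/((cthread u N)^-1 * cthread t N) tu mulVg.
pose g' (u : finite_quotient N) := g (iota (quotient_repr u)).
have g'E t : g' (cthread t N) = g t by apply: gE; apply: quotient_reprK.
have g'M : monoid_morphism g'.
  split; first by rewrite -[1]/(cthread 1 N) g'E (morph1g gM).
  move=> u v; rewrite -(quotient_reprK u) -(quotient_reprK v).
  rewrite -[quotient_proj _ (quotient_repr u)]/(cthread (iota (quotient_repr u)) N).
  rewrite -[quotient_proj _ (quotient_repr v)]/(cthread (iota (quotient_repr v)) N).
  by rewrite -[_ * _]/(cthread (iota (quotient_repr u) * iota (quotient_repr v)) N)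
    !g'E (morphMg gM).
have := matches_comp Hnil (fqP N) g'M.
have -> : g' \o quotient_proj (sval N) = g \o iota.
  by apply/funext => k; rewrite /= -g'E.
move=> /matches_fun/(_ m)/(congr1 (@^~ x)) /= <-.
by rewrite -g'E.
Qed.

Lemma finite_nilpotent_finite (H : groupType) : finite_nilpotent H ->
  finite_set [set: H].
Proof.
move=> [N [k [[_ [g kK _]] _]]].
rewrite -(preimage_setT k); apply: finite_preimage; last exact: finite_finset.
by move=> u v _ _ /(can_inj kK).
Qed.

(** A continuous pointed map into a limit is a compatible family of finitely supported maps. Each
    matches exactly one homomorphism from [K], which extends to the completion; uniqueness and
    density make the extensions compatible. *)
Lemma completion_free_on : free_pronilpotent_on completion_basis.
Proof.
split; [exact: completion_pronilpotent|exact: completion_basis_continuous|by []|].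
move=> H f [S' [S'nil [g [gM gc [g' [gK g'K g'c]]]]]] fc f1.
have g'M : monoid_morphism g' by apply: inverse_morphism gM gK g'K.
have thM j : monoid_morphism (fun h : H => thread (g h) j).
  by split=> [|x y]; rewrite ?(morph1g gM) ?(morphMg gM).
pose fj j x := thread (g (f (Some x))) j.
have fjf j : finsupp (fj j).
  have U : nbhs (f None) [set h | thread (g h) j = 1].
    have := gc (f None) _ (near_thread j (g (f None))).
    by rewrite f1 (morph1g gM).
  have /one_point_nbhs_cofinite[_] := fc None _ U.
  by apply: sub_finite_set => x.
pose thj j := projT1 (cid (matches_lift (S'nil j) (fjf j))).
have thjP j : monoid_morphism (thj j) /\ matches (thj j) (fj j) :=
  projT2 (cid (matches_lift (S'nil j) (fjf j))).
have ext_ex j := completion_extend (finite_nilpotent_finite (S'nil j)) (thjP j).1.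
pose ext j := projT1 (cid (ext_ex j)).
have extP j : [/\ monoid_morphism (ext j), completion_cont (ext j) &
    forall k, ext j (iota k) = thj j k] := projT2 (cid (ext_ex j)).
have extM j : monoid_morphism (ext j) by have [] := extP j.
have ext_thread t i j : inv_le i j -> inv_map i (ext j t) = ext i t.
  move=> ij; have mM := inv_mapM ij; have [ejM [N ejN] ejE] := extP j.
  have [eiM eic eiE] := extP i.
  apply: (completion_dense (f := @inv_map S' i j \o ext j)) => //.
  - exact: morphism_comp ejM mM.
  - by exists N => u uN; rewrite /= ejN // (morph1g mM).
  move=> k; rewrite /= ejE eiE.
  have m := matches_comp (S'nil i) (thjP j).2 mM.
  apply: (matches_hom m).
  have -> : @inv_map S' i j \o fj j = fj i by apply/funext => x; apply: threadP.
  exact: (thjP i).2.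
pose F t := g' (mk_thread (ext_thread t)).
have gF t j : thread (g (F t)) j = ext j t by rewrite /F g'K.
have FM : monoid_morphism F.
  split=> [|t u]; apply: (can_inj gK); apply: thread_inj => j; rewrite gF.
    by rewrite (morph1g gM) (morph1g (extM j)).
  by rewrite (morphMg gM) -[RHS]/(thread (g (F t)) j * thread (g (F u)) j) !gF (morphMg (extM j)).
have F0c : continuous (fun t => mk_thread (ext_thread t) : inverse_limit S').
  apply: inverse_limit_continuous => j; have [_ ec _] := extP j.
  exact: completion_cont_continuous (extM j) ec.
have Fc : continuous F.
  by move=> t; apply: continuous_comp; [exact: F0c|exact: g'c].
exists F; split=> [|F' [F'M F'c fF']].
- split=> //; apply/funext => -[x|]; last by rewrite f1 /= (morph1g FM).
  apply: (can_inj gK); apply: thread_inj => j; rewrite /= gF.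
  have [eM ec eE] := extP j; apply/esym.
  apply: (completion_basisP (f := fj j) (S'nil j) eM ec).
  by have -> : ext j \o iota = thj j; [apply/funext|exact: (thjP j).2].
apply/funext => t; apply: (can_inj gK); apply: thread_inj => j; rewrite gF.
have [eM ec eE] := extP j; pose rho u := thread (g (F' u)) j.
have rhoM : monoid_morphism rho by apply: morphism_comp F'M (thM j).
have rhoc : completion_cont rho.
  have U : nbhs (1 : Kh) [set u | rho u = 1].
    have := F'c 1 _ (gc (F' 1) _ (near_thread j (g (F' 1)))).
    by rewrite /= (morph1g F'M) (morph1g gM).
  by have [N NU] := nbhs_inverse_limit U; exists N => u uN; apply: NU.
apply: (completion_dense (g := rho)) => // k; rewrite eE.
have [f' m] := matches_exists (S'nil j) (morphism_comp (to_completion_morphism K) rhoM).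
apply: (matches_hom (th' := rho \o iota) (thjP j).2); suff <- : f' = fj j by [].
apply/funext => x; rewrite -(completion_basisP (S'nil j) rhoM rhoc m) /rho.
by rewrite /fj fF'.
Qed.

End CompletionFree.

Section ConstantSystem.
Local Open Scope classical_set_scope.
Local Open Scope group_scope.
Variable H : groupType.

Lemma unit_directed : directed_order (fun _ _ : unit => True).
Proof.
split; first by exists tt.
by split; [| |case=> -[]|move=> _ _; exists tt].
Qed.

Lemma const_mapM (i j : unit) : True -> monoid_morphism (id : H -> H).
Proof. by []. Qed.

(* Its limit is the discrete group [H]. *)
Definition const_system : inverse_system :=
  @InverseSystem unit _ unit_directed (fun=> H) (fun _ _ => id) const_mapM
    (fun _ _ => erefl) (fun _ _ _ _ _ _ => erefl).

Definition const_thread (h : H) : inverse_limit const_system :=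
  @mk_thread const_system (fun=> h) (fun _ _ _ => erefl).

Lemma const_threadM : monoid_morphism const_thread.
Proof. by split; [|move=> x y]; apply: thread_inj. Qed.

Lemma const_pronilpotent : finite_nilpotent H -> pronilpotent (inverse_limit const_system).
Proof.
by move=> Hnil; exists const_system; split=> //; exists id; apply: topgroup_iso_id.
Qed.

End ConstantSystem.

Section TopGroup.
Local Open Scope classical_set_scope.
Local Open Scope group_scope.
Variable G : topGroupType.

Lemma nbhs_translate (x : G) (U : set G) : nbhs 1 U -> nbhs x [set y | U (x^-1 * y)].
Proof.
move=> U1; have cx : {for x, continuous (fun y : G => x^-1 * y)}.
  apply: (@continuous_comp _ _ _ (fun y : G => (x^-1, y)) (fun z : G * G => z.1 * z.2)).
    by apply: cvg_pair; [apply: cvg_cst|apply: cvg_id].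
  exact: mulg_continuous.
by have := cx U; rewrite mulVg => /(_ U1).
Qed.

Lemma finite_nilpotent_self (H : finGroupType) : nilpotent [set: H]%G -> finite_nilpotent H.
Proof.
move=> nilH; exists H, id; split=> //; split; first by split.
by exists id.
Qed.

Variables (X : choiceType) (i : one_point_compactification (discrete_topology X) -> G).
Hypothesis Gi : free_pronilpotent_on i.

(** The universal property is applied to finite groups by viewing them as limits of one-object
    systems. *)
Lemma free_pronilpotent_pres : exists (L : Type) (N : L -> finGroupType)
  (q : forall l, G -> N l), pronil_pres q /\ free_pres q (i \o Some).
Proof.
have [Gnil ic i1 univ] := Gi.
have [L [N [q [Gq q1 qU]]]] := pronilpotent_presP Gnil.
exists L, N, q; split=> //.
have cont (H : finGroupType) (th : G -> H) : monoid_morphism th -> pres_cont q th ->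
    continuous (fun g => const_thread (th g)).
  move=> thM [l thl]; apply: inverse_limit_continuous => -[] x U /principal_filterP Ux.
  apply: filterS (nbhs_translate x (q1 l)) => y /= /thl.
  rewrite (morphMg thM) (morphVg thM) => /(congr1 (mulg (th x))).
  by rewrite mulKVg mulg1 => e; rewrite -[thread _ _]/(th y) e.
split=> [l|H f nilH ff|H th th' nilH thM thc th'M th'c e].
- have U : nbhs (i None) [set x | q l x = 1] by rewrite i1; apply: q1.
  have [_] := (one_point_nbhs_cofinite _).1 (ic _ _ U).
  by apply: sub_finite_set => x.
- pose f' (u : one_point_compactification (discrete_topology X)) :
    inverse_limit (const_system H) := if u is Some x then const_thread (f x) else 1.
  have f'c : continuous f'.
    apply: one_point_continuous => U U1; apply: sub_finite_set ff => x /= nU fx; apply: nU.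
    by rewrite fx (morph1g (const_threadM H)); apply: nbhs_singleton U1.
  have [th [[thM thc thE] _]] := univ _ f' (const_pronilpotent (finite_nilpotent_self nilH)) f'c erefl.
  exists (fun g => @thread (const_system H) (th g) tt); split=> [| |x].
  + by split=> [|x y]; rewrite ?(morph1g thM) ?(morphMg thM).
  + have [|l lP] := qU [set g | @thread (const_system H) (th g) tt = 1]; last by exists l.
    have := thc 1 _ (@near_thread (const_system H) tt (th 1)).
    by rewrite (morph1g thM).
  + by rewrite -[th _]/((th \o i) (Some x)) -thE.
- have nilc := const_pronilpotent (finite_nilpotent_self nilH).
  have c1 := morph1g (const_threadM H).
  pose f' := (fun g => const_thread (th g)) \o i.
  have [||g [_ gu]] := univ _ f' nilc.
  + by move=> u; apply: continuous_comp; [apply: ic|apply: cont].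
  + by rewrite /f' /= i1 (morph1g thM).
  have mM (t : G -> H) : monoid_morphism t -> monoid_morphism (fun g => const_thread (t g)).
    by move=> tM; apply: morphism_comp tM (const_threadM H).
  have e1 : g = (fun g => const_thread (th g)).
    by apply: gu; split=> //; [apply: mM|apply: cont].
  have e2 : g = (fun g => const_thread (th' g)).
    apply: gu; split=> //; [exact: mM|exact: cont|].
    apply/funext => -[x|]; rewrite /f' /=; last first.
      by rewrite i1 (morph1g thM) (morph1g th'M).
    by congr const_thread; apply: e.
  move=> x; have /(congr1 (fun u => @thread (const_system H) u tt)) : const_thread (th x) = const_thread (th' x).
    by rewrite -[LHS]/((fun g => const_thread (th g)) x) -e1 e2.
  by [].
Qed.

End TopGroup.

(** * Realizing all maps to 'F_p by homomorphisms *)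

Section Realizing.
Import GRing.Theory.
Local Open Scope classical_set_scope.
Local Open Scope ring_scope.

Definition realizing (K : groupType) : Prop :=
  infinite_set [set: K] /\ forall p, prime p -> exists k : K -> K,
    forall g : K -> 'F_p, exists2 chi, addhom chi & chi \o k = g.

(** Finite duality with the roles exchanged: the value vectors at the points of [F] are closed under
    addition, and a linear form killing all of them is a relation between the [chi y]. *)
Lemma lin_indep_values (F : groupType) (p : nat) (Y : choiceType) (chi : Y -> F -> 'F_p)
    (s : seq Y) (w : Y -> 'F_p) :
  (forall y, addhom (chi y)) -> lin_indep chi -> uniq s ->
  exists t, forall y, y \in s -> chi y t = w y.
Proof.
move=> ch ci us.
have [||c Hc|_ [t _ <-] e] := @finite_duality p Y [set chi^~ t | t in [set: F]] s w us.
- by exists 1%g => //; apply/funext => y; rewrite addhom1.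
- move=> _ _ [t _ <-] [u _ <-]; exists (t * u)%g => //.
  by apply/funext => y; rewrite ch.
- rewrite big_seq big1 // => y ys; rewrite (ci s c us _ y ys) ?mul0r // => t.
  by apply: (Hc (chi^~ t)); exists t.
- by exists t.
Qed.

Lemma lin_indep_values_compact (F : groupType) (L : Type) (N : L -> finGroupType)
    (q : forall l, F -> N l) (p : nat) (Y : choiceType) (chi : Y -> F -> 'F_p)
    (w : Y -> 'F_p) : pronil_pres q -> (forall y, addhom (chi y)) ->
  (forall y, exists l, forall x, q l x = 1%g -> chi y x = 0) -> lin_indep chi ->
  exists t, forall y, chi y t = w y.
Proof.
move=> Fq ch cc ci.
have /choice[f fP] : forall s : seq Y, exists t, forall y, y \in s -> chi y t = w y.
  move=> s; have [t tP] := lin_indep_values w ch ci (undup_uniq s).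
  by exists t => y ys; apply: tP; rewrite mem_undup.
have [|||u uP] := pres_cluster Fq (D := seq Y) (le := fun s t => {subset s <= t})
  _ _ _ (fun s (_ : unit) => f s).
- exact: (inhabits [::]).
- by move=> s t v st tv x /st/tv.
- by move=> s t; exists (s ++ t); split=> x xs; rewrite mem_cat xs ?orbT.
exists (u tt) => y; have [l lP] := cc y.
have [s [ys e]] := uP l [set tt] [:: y] (finite_set1 _).
rewrite -(fP s y); last by apply: ys; rewrite inE.
apply/eqP; rewrite -subr_eq0 -addhomV // -ch; apply/eqP/lP.
by rewrite (morphMg (pres_hom Fq l)) (morphVg (pres_hom Fq l)) (e tt) // mulgV.
Qed.

Section FreePresentation.
Variables (F : groupType) (L : Type) (N : L -> finGroupType) (q : forall l, F -> N l).
Variables (X : choiceType) (i : X -> F).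
Hypotheses (Fq : pronil_pres q) (Fi : free_pres q i) (Xi : infinite_set [set: X]).

(* Elements are separated by the values of homomorphisms to coded groups, and
   such a homomorphism is determined by finitely many values on the basis. *)
Lemma free_pres_card : inj_le F (set X).
Proof.
have [pc pcI] : exists f : group_code -> nat, injective f.
  by exists pickle; apply: pcan_inj pickleK.
have [pk pkI] : exists f : forall c, code_group c -> nat, forall c, injective (f c).
  by exists (fun=> pickle) => c; apply: pcan_inj pickleK.
(* A triple codes a target group, the finite table of the nontrivial values on the basis, and the
   value at [t]. *)
pose R (t : F) : set (nat * seq (X * nat) * nat) := fun u => exists (c : group_code)
  (f : X -> code_group c) (th : F -> code_group c),
  [/\ u.1.1 = pc c, u.2 = pk _ (th t), nilpotent [set: code_group c]%G,
     [/\ monoid.monoid_morphism th, pres_cont q th & forall x, th (i x) = f x] &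
     (forall x, f x <> 1%g -> (x, pk _ (f x)) \in u.1.2) /\
     (forall x m, (x, m) \in u.1.2 -> m = pk _ (f x))].
have leX : inj_le (nat * seq (X * nat) * nat) X.
  have eN := infinite_nat_inj Xi; have eS := infinite_square Xi.
  have eX : inj_le (seq (X * nat)) X.
    exact: inj_le_trans (inj_le_seq (infinite_nat_prod Xi)) (infinite_seq Xi).
  apply: inj_le_trans (infinite_nat_prod Xi); apply: inj_le_prod; last by exists id.
  exact: inj_le_trans (inj_le_prod eN eX) eS.
apply: inj_le_trans (inj_le_set leX); exists R => t t' RR.
apply: (pres_eq Fq) => l.
have [c [k [k' [kM kK k'K]]]] := code_groupP (N l).
apply: (can_inj kK); pose th x := k (q l x); pose f x := th (i x).
have thM : monoid.monoid_morphism th by exact: morphism_comp (pres_hom Fq l) kM.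
have ff : finite_set [set x | f x <> 1%g].
  by apply: sub_finite_set (fp_supp Fi l) => x /= fx e; apply: fx; rewrite /f /th e (morph1g kM).
have nilc : nilpotent [set: code_group c]%G.
  have k'M := inverse_morphism kM kK k'K.
  apply: (nilpotent_joint_inj k'M k'M) (pres_nil Fq l) (pres_nil Fq l) => x y e _.
  exact: can_inj k'K _ _ e.
have /finite_seqP[s sE] := ff.
have Rt : R t (pc c, [seq (x, pk _ (f x)) | x <- s], pk _ (th t)).
  exists c, f, th; split=> //=.
    by split=> //; exists l => x e; rewrite /th e (morph1g kM).
  split=> [x fx|x m /mapP[y _ [-> ->]] //].
  apply/mapP; exists x => //.
  by have : [set x | f x <> 1%g] x by []; rewrite sE.
rewrite RR in Rt; have [c' [f' [th' [/= /pcI ec em _ [th'M th'c th'E] [f'1 f'2]]]]] := Rt.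
subst c'; have /pkI := em; rewrite -/(th t) => ->.
have thc : pres_cont q th by exists l => x e; rewrite /th e (morph1g kM).
rewrite -/(th t'); apply: (fp_uniq Fi nilc th'M th'c thM thc).
move=> x; rewrite th'E -/(f x).
have [fx|fx] := eqVneq (f x) 1%g.
  have [f'x|/eqP f'x] := eqVneq (f' x) 1%g; first by rewrite fx f'x.
  have /mapP[y _ [<- ]] := f'1 x f'x.
  by move=> /pkI.
have : (x, pk _ (f x)) \in [seq (x, pk _ (f x)) | x <- s].
  apply/mapP; exists x => //.
  have fx' : [set x | f x <> 1%g] x by exact/eqP.
  by rewrite sE in fx'.
by move=> /f'2/pkI ->.
Qed.

Lemma free_pres_dual_basis (p : nat) : prime p -> exists chi : X -> F -> 'F_p,
  [/\ forall x, addhom (chi x), forall x, exists l, forall t, q l t = 1%g -> chi x t = 0 &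
      forall x y, chi x (i y) = if x == y then 1 else 0].
Proof.
move=> pr; pose C : finGroupType := 'F_p.
have nilC : nilpotent [set: C]%G.
  by apply: abelian_nil; apply/centsP => a _ b _; exact: (@addrC 'F_p).
have /choice[chi chiP] : forall x, exists th : F -> C, [/\ monoid.monoid_morphism th,
    pres_cont q th & forall y, th (i y) = if x == y then 1 else 0 :> 'F_p].
  move=> x; apply: (fp_lift Fi nilC).
  apply: (sub_finite_set _ (finite_set1 x)) => y /=; case: eqP => [->|] // _.
exists chi; split=> [x|x|x y]; have [cM cc cE] := chiP x.
- by move=> t u; apply: (morphMg cM).
- exact: cc.
- exact: cE.
Qed.

(** Compactness yields elements [k t] whose coordinates [chi x] are the independent functions
    [d (eta t)]. Thus the evaluations at the [k t] satisfy no relation even on the [chi x], and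
    duality gives all values. *)
Lemma free_pres_realizing : realizing F.
Proof.
split.
  apply: inj_infinite; apply: inj_le_trans (infinite_nat_inj Xi) _.
  have [chi [_ _ chiE]] := free_pres_dual_basis (isT : prime 2).
  exists i => x y e; have := chiE x y; rewrite -e chiE eqxx.
  by case: eqP => // _ /eqP; rewrite oner_eq0.
move=> p pr; have [chi [ch cc cE]] := free_pres_dual_basis pr.
have ci : lin_indep chi.
  move=> s c us Hs x xs; have := Hs (i x).
  rewrite (bigD1_seq x) //= cE eqxx mulr1 big1 ?addr0 // => y yx.
  by rewrite cE (negPf yx) mulr0.
have [d di] := lin_indep_subsets p Xi; have [eta etai] := free_pres_card.
have /choice[k kP] : forall t : F, exists u, forall x, chi x u = d (eta t) x.
  by move=> t; apply: (lin_indep_values_compact _ Fq ch cc ci).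
exists k => g; suff [psi h e] : exists2 psi, addhom psi & forall t, psi (k t) = g t.
  by exists psi => //; apply/funext.
apply: addhom_duality => s c us Hs; rewrite big_seq big1 // => t ts.
suff -> : c t = 0 by rewrite mul0r.
have [c' c'E] : exists c' : {classic set X} -> 'F_p, forall t, c' (eta t) = c t.
  have /choice[c' c'P] : forall S : {classic set X}, exists a, forall t, eta t = S -> a = c t.
    move=> S; have [[u <-]|nS] := pselect (exists u, eta u = S).
      by exists (c u) => v /etai ->.
    by exists 0 => v vS; case: nS; exists v.
  by exists c' => u; apply: c'P.
rewrite -c'E; apply: (di [seq (eta t : {classic set X}) | t <- s]).
- by rewrite map_inj_uniq.
- move=> x; rewrite big_map -[RHS](Hs (chi x)) //; apply: eq_bigr => u _.
  by rewrite kP c'E.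
- by apply/mapP; exists t.
Qed.

End FreePresentation.
End Realizing.

(** * A family in the completion, independent modulo the group *)

Section Diagonal.
Import GRing.Theory.
Local Open Scope classical_set_scope.
Local Open Scope ring_scope.
Variable F : groupType.
Hypotheses (Fnil : nil_quotients F) (FR : realizing F).
Variable p : nat.
Hypothesis pr : prime p.
Local Notation iota := (@to_completion F).

Let nilC : nilpotent [set: ('F_p : finGroupType)]%G.
Proof. by apply: abelian_nil; apply/centsP => a _ b _; exact: (@addrC 'F_p). Qed.

(* Finite formal combinations and elements of [F] are coded by elements of [F];
   the coordinate of [w t] at the singleton of a code prevents the coded
   combination of the [w t] from being the image of the coded element. *)
Lemma diagonal_weights (chi : {classic set F} -> F -> 'F_p) :
  exists w : F -> {classic set F} -> 'F_p, forall (s : seq F) c v, uniq s ->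
    (exists2 t, t \in s & c t != 0) ->
    exists y, \sum_(t <- s) c t * w t y != chi y v.
Proof.
have Fi := FR.1.
have [code codei] : inj_le (seq (F * nat) * F) F.
  apply: inj_le_trans (infinite_square Fi); apply: inj_le_prod; last by exists id.
  exact: inj_le_trans (inj_le_seq (infinite_nat_prod Fi)) (infinite_seq Fi).
pose cd (s : seq F) (c : F -> 'F_p) v : {classic set F} :=
  [set code ([seq (t, nat_of_ord (c t)) | t <- s], v)].
have cd_inj s c v s' c' v' : cd s c v = cd s' c' v' ->
    [/\ s = s', {in s, c =1 c'} & v = v'].
  move=> e; have /codei[es ->] : code ([seq (t, nat_of_ord (c t)) | t <- s], v) =
      code ([seq (t, nat_of_ord (c' t)) | t <- s'], v').
    by have : cd s c v (code ([seq (t, nat_of_ord (c t)) | t <- s], v)) by []; rewrite e.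
  have ss : s = s'.
    by have /(congr1 (map fst)) := es; rewrite -!map_comp !map_id.
  split=> // t ts; subst s'; apply/val_inj => /=.
  have : (t, nat_of_ord (c t)) \in [seq (t, nat_of_ord (c' t)) | t <- s].
    by rewrite -es; apply/mapP; exists t.
  by move=> /mapP[u _ [-> ->]].
have /choice[w wP] : forall y : {classic set F}, exists w : F -> 'F_p,
    forall s c v, uniq s -> (exists2 t, t \in s & c t != 0) -> y = cd s c v ->
    \sum_(t <- s) c t * w t != chi y v.
  move=> y; have [[s [c [v [us [t0 t0s ct0] ->]]]]|ny] := pselect (exists s c v,
      [/\ uniq s, exists2 t, t \in s & c t != 0 & y = cd s c v]); last first.
    by exists (fun=> 0) => s c v us nt ey; case: ny; exists s, c, v.
  exists (fun t => if t == t0 then (chi (cd s c v) v + 1) / c t0 else 0).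
  move=> s' c' v' us' _ /cd_inj[ss cc vv]; subst s' v'.
  rewrite (bigD1_seq t0) //= eqxx big1 ?addr0 => [|t /negPf ->]; last by rewrite mulr0.
  by rewrite -cc // mulrC divfK // -subr_eq0 addrAC subrr add0r oner_eq0.
exists (fun t y => w y t) => s c v us nt; exists (cd s c v).
exact: wP.
Qed.

Lemma sum_sum_type (A B : choiceType) (s : seq (A + B)) : uniq s ->
  exists (s1 : seq A) (s2 : seq B), [/\ uniq s2,
    forall b, (b \in s2) = (inr b \in s) & forall f : A + B -> 'F_p,
    \sum_(u <- s) f u = \sum_(a <- s1) f (inl a) + \sum_(b <- s2) f (inr b)].
Proof.
move=> us; pose s1 := pmap (fun u : A + B => if u is inl a then Some a else None) s.
pose s2 := pmap (fun u : A + B => if u is inr b then Some b else None) s.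
exists s1, s2; split.
- apply: (pmap_uniq (g := inr)) us => -[a|b] //.
- move=> b; rewrite mem_pmap; apply/mapP/idP => [[[a|b'] us' // [->]] //|bs].
  by exists (inr b).
move=> f; rewrite /s1 /s2; elim: {us s1 s2} s => [|[a|b] s IH]; rewrite ?big_nil ?addr0 //=.
  by rewrite !big_cons IH addrA.
by rewrite !big_cons IH addrCA.
Qed.

(** The elements [j t] are built with coordinates [w t]. A relation between evaluations at the [j t]
    and at points of [F] would make a combination of the [w t] the coordinate vector of an element
    of [F], which the weights exclude; by duality one may prescribe 0 on [F] and [g] on the
    [j t]. *)
Lemma completion_diagonal : exists j : F -> profinite_completion F,
  forall g : F -> 'F_p, exists chi : profinite_completion F -> 'F_p,
  [/\ addhom chi, forall v, chi (iota v) = 0 & forall t, chi (j t) = g t].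
Proof.
have [Fi /(_ p pr)[k kP]] := FR.
have [b [bh bi bspan]] := addhom_basis_pow Fi kP.
have /choice[B BP] : forall y, exists B : profinite_completion F -> ('F_p : finGroupType),
    [/\ monoid.monoid_morphism B, completion_cont B & forall v, B (iota v) = b y v].
  move=> y; apply: completion_extend; first exact: finite_finset.
  by split; [exact: (addhom1 (bh y))|exact: bh].
have Bh y : addhom (B y) by have [BM _ _] := BP y; move=> t u; apply: (morphMg BM).
have BE y v : B y (iota v) = b y v by have [_ _] := BP y; apply.
have Bi : lin_indep B.
  move=> s c us Hs; apply: (bi s c us) => x; rewrite -[RHS](Hs (iota x)).
  by apply: eq_bigr => y _; rewrite BE.
have [L [N [q [Fq q1 qU]]]] := pronilpotent_presP (completion_pronilpotent Fnil).
have Bc y : exists l, forall x, q l x = 1%g -> B y x = 0.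
  have [_ [M BM] _] := BP y.
  have [|l lP] := qU [set x | cthread x M = 1%g].
    exact: (@near_thread (finite_quotients F) M 1%g).
  by exists l => x /lP/BM.
have [w wP] := diagonal_weights b.
have /choice[j jP] : forall t, exists u, forall y, B y u = w t y.
  by move=> t; apply: (lin_indep_values_compact _ Fq Bh Bc Bi).
exists j => g.
pose kk (u : F + F) := match u with inl v => iota v | inr t => j t end.
pose gg (u : F + F) := match u with inl v => 0 | inr t => g t end.
suff [chi ch ce] : exists2 chi, addhom chi & forall u, chi (kk u) = gg u.
  by exists chi; split=> // [v|t]; [exact: (ce (inl v))|exact: (ce (inr t))].
apply: addhom_duality => s c us Hs.
have [s1 [s2 [us2 s2E sE]]] := sum_sum_type us.
rewrite big_seq big1 // => -[v|t] us'; rewrite ?mulr0 //=.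
suff -> : c (inr t) = 0 by rewrite mul0r.
apply/eqP/negPn/negP => ct.
(* The whole part of the relation supported on [F] is the evaluation at a single [v0]. *)
have [v0 v0P] := addhom_comb s1 (fun v => - c (inl v)) (id : F -> F).
have [|y /eqP[]] := wP s2 (fun t => c (inr t)) v0 us2.
  by exists t; rewrite ?s2E.
have := Hs (B y) (Bh y); rewrite sE /=.
rewrite (eq_bigr (fun v => c (inl v) * b y v)) => [|v _]; last by rewrite BE.
rewrite [X in _ + X](eq_bigr (fun t => c (inr t) * w t y)) => [|u _]; last by rewrite jP.
move=> /eqP; rewrite addr_eq0 => /eqP e; rewrite v0P; last exact: bh.
apply: oppr_inj; rewrite -e -sumrN; apply: eq_bigr => v _.
by rewrite mulNr opprK.
Qed.

End Diagonal.

(** * Towers of completions *)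

Section DirectLimits.
Import fintype boot.finset GroupScope.
Local Open Scope group_scope.
Variable S : direct_system.
Local Notation K := (direct_limit S).

Lemma dir_le_trans i j k : @dir_le S i j -> dir_le j k -> dir_le i k.
Proof. by have [_ [_ + _ _]] := dir_directed S; apply. Qed.
Lemma dir_le_dir i j : exists k, @dir_le S i k /\ dir_le j k.
Proof. by have [_ [_ _ _]] := dir_directed S; apply. Qed.

(** The [th i] need not be compatible with the transition maps. The limit reads each class at late
    stages only, where finitely many identities of the direct limit already hold. *)
Lemma dirlim_cluster (A : finGroupType) (th : forall i, S i -> A) :
  (forall i, monoid_morphism (th i)) ->
  exists f : K -> A, monoid_morphism f /\ forall i (z : S i) i0, exists j,
    [/\ dir_le i j, dir_le i0 j & f (to_dirlim z) = th j (dir_map j z)].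
Proof.
move=> thM; have D0 : inhabited (dir_index S) by have [[i _] _] := dir_directed S.
pose rep (u : K) := sval (dirlim_surj u).
have repP u : u = to_dirlim (tagged (rep u)) := svalP (dirlim_surj u).
have [|f fP] := net_cluster (A := fun=> A : Type) D0 dir_le_trans dir_le_dir
  (fun j (u : K) => th j (dir_map j (tagged (rep u)))).
  by move=> _; apply: finite_finset.
have fM u v : f (u * v) = f u * f v.
  have [i [iu iv]] := dir_le_dir (tag (rep u)) (tag (rep v)).
  pose x := dir_map i (tagged (rep u)); pose y := dir_map i (tagged (rep v)).
  have : to_dirlim (x * y) = to_dirlim (tagged (rep (u * v))).
    rewrite -repP (to_dirlim_morphism i).2 !to_dirlim_map // -!repP //.
  move=> /to_dirlimP[m [im uvm e]].
  have [j [mj ej]] := fP [set u; v; u * v]%classic m (finite_set3 _ _ _).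
  rewrite -!ej; [|by left; right|by left; left|by right].
  have ij := dir_le_trans im mj.
  rewrite -(morphMg (thM j)) -(dir_map_comp _ uvm mj) -e (dir_map_comp _ im mj).
  by rewrite (dir_mapM ij).2 /x /y !dir_map_comp.
exists f; split=> [|i z i0].
  by split=> //; apply: (mulgI (f 1)); rewrite -fM !mulg1.
have /to_dirlimP[k [rk ik e]] := esym (repP (to_dirlim z)).
have [k' [kk' i0k']] := dir_le_dir k i0.
have [j [kj ej]] := fP [set to_dirlim z]%classic k' (finite_set1 _).
have kj' := dir_le_trans kk' kj.
exists j; split; [exact: dir_le_trans ik kj'|exact: dir_le_trans i0k' kj|].
by rewrite -ej // -(dir_map_comp _ rk kj') e (dir_map_comp _ ik kj').
Qed.

Lemma dirlim_nil_quotients : (forall i, nil_quotients (S i)) -> nil_quotients K.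
Proof.
move=> Snil Q phi phiM u v; have [i [x [y [-> ->]]]] := dirlim_surj2 u v.
exact: (Snil i Q _ (morphism_comp (to_dirlim_morphism i) phiM)).
Qed.

Lemma dirlim_p_projective p : (forall i, p_projective (S i) p) -> p_projective K p.
Proof.
move=> Sp A B pi pB piM pis phi phiM.
have H i := Sp i A B pi pB piM pis _ (morphism_comp (to_dirlim_morphism i) phiM).
pose th i := projT1 (cid (H i)).
have thP i : monoid_morphism (th i) /\ forall x, pi (th i x) = phi (to_dirlim x) :=
  projT2 (cid (H i)).
have [|psi [psiM psiP]] := @dirlim_cluster B th; first by move=> i; case: (thP i).
exists psi; split=> // u; have [[i x] /= ->] := dirlim_surj u.
have [j [ij _ ->]] := psiP i x i.
by rewrite (thP j).2 to_dirlim_map.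
Qed.

End DirectLimits.

Section Tower.
Import fintype boot.finset GroupScope.
Local Open Scope group_scope.
Variables (G : topGroupType) (d : Order.disp_t) (W : orderType d).
Hypothesis woW : well_order (<=%O : rel W).
Variable T : completion_tower G W.
Implicit Types a b c : W.
Local Notation map := (@tow_map d W T).

Lemma ord_succ_below a b : ord_limit a -> (b < a)%O -> exists c, ord_succ b c /\ (c < a)%O.
Proof.
move=> [_ la] /la[c0 [bc0 c0a]].
have [m [[bm mmin] _]] := woW (A := [pred c | (b < c)%O]) (ex_intro _ c0 bc0).
have mc0 : (m <= c0)%O by apply: mmin.
exists m; split; last exact: Order.POrderTheory.le_lt_trans mc0 c0a.
split=> // c cm; rewrite Order.TotalTheory.leNgt; apply/negP => bc.
by have := mmin c bc; rewrite Order.TotalTheory.leNgt cm.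
Qed.

Lemma topgroup_iso_inv (H H' : topGroupType) (e : H -> H') : topgroup_iso e ->
  exists e' : H' -> H, [/\ monoid_morphism e', cancel e e' & cancel e' e].
Proof.
by move=> [eM _ [e' [eK e'K _]]]; exists e'; split=> //; apply: inverse_morphism eM eK e'K.
Qed.

Definition extends_along (A : finGroupType) b c (chi : T b -> A) : Prop :=
  exists f : T c -> A, monoid_morphism f /\ forall x, f (map c x) = chi x.

Lemma tower_extend_limit (A : finGroupType) b a (la : ord_limit a) (chi : T b -> A)
    (ba : (b < a)%O) : monoid_morphism chi ->
  (forall c, (b <= c)%O -> (c < a)%O -> extends_along c chi) ->
  exists f : direct_limit (tower_below T la) -> A, monoid_morphism f /\
    forall x : T b, f (@to_dirlim (tower_below T la) (exist _ b ba) x) = chi x.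
Proof.
move=> chiM ext; pose S := tower_below T la.
have th_ex (i : dir_index S) : exists f : S i -> A, monoid_morphism f /\
    ((b <= val i)%O -> forall x, f (map (val i) x) = chi x).
  (* Stages before [b] get the trivial homomorphism; the limit is read at stages after [b]. *)
  have [bi|nbi] := boolP (b <= val i)%O; last by exists (fun=> 1); split=> //; split=> // x y; rewrite mulg1.
  by have [f [fM fE]] := ext (val i) bi (valP i); exists f.
pose th i := projT1 (cid (th_ex i)).
have thP i : monoid_morphism (th i) /\ ((b <= val i)%O -> forall x, th i (map (val i) x) = chi x)
  := projT2 (cid (th_ex i)).
have [|f [fM fE]] := @dirlim_cluster S A th; first by move=> i; case: (thP i).
exists f; split=> // x; have [j [bj _ ->]] := fE (exist _ b ba) x (exist _ b ba).
by rewrite -[LHS]/(th j (map (val j) x)) (thP j).2.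
Qed.

(** Homomorphisms to finite groups extend to completions. At a limit the extensions to the earlier
    stages need not agree, but all of them extend [chi], and so does their cluster point. *)
Lemma tower_extend (A : finGroupType) b c (chi : T b -> A) : (b <= c)%O ->
  monoid_morphism chi -> extends_along c chi.
Proof.
elim/(well_founded_ind (well_order_wf woW)): c => c IH.
rewrite Order.POrderTheory.le_eqVlt => /orP[/eqP <-|bc] chiM.
  by exists chi; split=> // x; rewrite tow_map_id.
have Af : finite_set [set: A]%classic by apply: finite_finset.
have [[m mc]|lc] := ord_succ_or_limit bc.
  have bm : (b <= val m)%O by apply: mc.2.
  have [f [fM fE]] := IH (val m) mc.1 bm chiM.
  have [e [ei eE]] := comp_succ T mc.
  have [e' [e'M eK e'K]] := topgroup_iso_inv ei.
  have [g [gM _ gE]] := completion_extend Af fM.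
  exists (g \o e'); split; first exact: morphism_comp e'M gM.
  by move=> x; rewrite -(tow_map_comp x bm (Order.POrderTheory.ltW mc.1)) -eE /= eK gE fE.
have [|f [fM fE]] := tower_extend_limit lc bc chiM.
  by move=> c' bc' c'c; apply: IH.
have [e [ei eE]] := comp_limit T lc.
have [e' [e'M eK e'K]] := topgroup_iso_inv ei.
have [g [gM _ gE]] := completion_extend Af fM.
exists (g \o e'); split; first exact: morphism_comp e'M gM.
move=> x; have := eE (exist _ b bc) x => /= <-.
by rewrite eK gE fE.
Qed.

End Tower.

Section FreeCompletion.
Local Open Scope classical_set_scope.
Local Open Scope group_scope.

Definition completes_freely (K : groupType) : Prop :=
  [/\ nil_quotients K, realizing K & forall p, prime p -> p_projective K p].

Lemma free_pronilpotent_completes_freely (G : topGroupType) :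
  free_pronilpotent G -> completes_freely G.
Proof.
move=> [X [i [Xi Gi]]]; have [L [N [q [Gq Gf]]]] := free_pronilpotent_pres Gi.
split; first exact: pres_nil_quotients Gq.
  exact: free_pres_realizing Gq Gf Xi.
by move=> p pr A B pi; apply: (free_pres_p_projective Gq Gf pr).
Qed.

Lemma completes_freelyP (K : groupType) :
  completes_freely K -> free_pronilpotent (profinite_completion K).
Proof.
move=> [Knil [Ki Kr] Kp]; pose X : choiceType := {classic set K}.
have ex p : exists e : (K -> 'F_p) -> X -> 'F_p, prime p -> dual_coords e.
  have [pr|np] := boolP (prime p); last by exists (fun _ _ => 0%R).
  have [k kP] := Kr p pr; have [b bb] := addhom_basis_pow Ki kP.
  by have [e ee] := addhom_basis_coords bb; exists e.
pose e p := projT1 (cid (ex p)).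
have ec p : prime p -> dual_coords (e p) := projT2 (cid (ex p)).
have [Psi PsiN] := natural_family_exists ec Kp; have [PsiM Psi_nat _] := PsiN.
exists X, (completion_basis Psi_nat (@natural_family_surj _ _ _ ec _ PsiN)
  (@natural_family_inj _ _ _ ec _ PsiN) Knil).
split; last exact: completion_free_on.
have leX : inj_le K X.
  by exists (fun x => [set x]) => x y e1; have : [set x] x by []; rewrite e1.
apply: inj_infinite; exact: inj_le_trans (infinite_nat_inj Ki) leX.
Qed.

Lemma free_pronilpotent_iso (G H : topGroupType) (e : G -> H) :
  topgroup_iso e -> free_pronilpotent G -> free_pronilpotent H.
Proof.
move=> [eM ec [e' [eK e'K e'c]]] [X [i [Xi [Gnil ic i1 univ]]]].
have e'M := inverse_morphism eM eK e'K.
exists X, (e \o i); split=> //; split.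
- have [S [Snil [f [fM fc [f' [fK f'K f'c]]]]]] := Gnil.
  exists S; split=> //; exists (f \o e'); split; first exact: morphism_comp e'M fM.
    by move=> x; apply: continuous_comp; [exact: e'c|exact: fc].
  exists (e \o f'); split; [exact: can_comp|exact: can_comp|].
  by move=> x; apply: continuous_comp; [exact: f'c|exact: ec].
- by move=> x; apply: continuous_comp; [exact: ic|exact: ec].
- by rewrite /= i1 (morph1g eM).
move=> A f Anil fc f1; have [g [[gM gc gE] gu]] := univ A f Anil fc f1.
exists (g \o e'); split=> [|h [hM hc hE]].
  split; first exact: morphism_comp e'M gM.
    by move=> x; apply: continuous_comp; [exact: e'c|exact: gc].
  by rewrite gE; apply/funext => x; rewrite /= eK.
have -> : g = h \o e; last by apply/funext => x; rewrite /= e'K.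
apply: gu; split=> //; first exact: morphism_comp eM hM.
by move=> x; apply: continuous_comp; [exact: ec|exact: hc].
Qed.

End FreeCompletion.

Lemma seq_max_ex (I : eqType) (d : Order.disp_t) (W : orderType d) (f : I -> W) (s : seq I) x :
  x \in s -> exists2 m, m \in s & forall y, y \in s -> (f y <= f m)%O.
Proof.
elim: s x => // y s IH x _; case: s IH => [_|z s /(_ z (mem_head z s))[m ms mP]].
  by exists y; rewrite ?mem_head // => u; rewrite inE => /eqP ->.
have [ym|my] := Order.TotalTheory.leP (f y) (f m).
  exists m; first by rewrite inE ms orbT.
  by move=> u; rewrite inE => /orP[/eqP ->|/mP].
exists y; first exact: mem_head.
move=> u; rewrite inE => /orP[/eqP -> //|/mP um].
exact: Order.POrderTheory.le_trans um (Order.POrderTheory.ltW my).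
Qed.

(** * Realizing families at limit stages *)

Section TowerRealizing.
Import GRing.Theory.
Local Open Scope ring_scope.
Variables (G : topGroupType) (d : Order.disp_t) (W : orderType d).
Hypothesis woW : well_order (<=%O : rel W).
Variable T : completion_tower G W.
Variables (a : W) (la : ord_limit a).
Hypothesis Tf : forall b, (b < a)%O -> free_pronilpotent (T b).
Local Notation S := (tower_below T la).
Local Notation K := (direct_limit S).

(** The diagonal family lies in the stage after [b], so its elements come from every later stage,
    while homomorphisms killing stage [b] separate them and extend to the limit. *)
Lemma tower_diagonal p (b : below a) : prime p -> exists J : T (val b) -> K,
  (forall g : T (val b) -> 'F_p, exists chi : K -> 'F_p,
    [/\ addhom chi, forall v : S b, chi (to_dirlim v) = 0 & forall t, chi (J t) = g t]) /\
  (forall c : below a, (val b < val c)%O -> forall t, exists z : S c, J t = to_dirlim z).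
Proof.
move=> pr; have [c [bc ca]] := ord_succ_below woW la (valP b).
have [Fnil FR _] := free_pronilpotent_completes_freely (Tf (valP b)).
have [e [ei eE]] := comp_succ T bc; have [e' [e'M eK e'K]] := topgroup_iso_inv ei.
have [j jP] := completion_diagonal Fnil FR pr.
pose c' : below a := exist _ c ca.
exists (fun t => @to_dirlim S c' (e (j t))); split=> [g|c2 bc2 t]; last first.
  have cc2 : (c <= val c2)%O.
    rewrite Order.TotalTheory.leNgt; apply/negP => /bc.2.
    by rewrite Order.TotalTheory.leNgt bc2.
  by exists (tow_map (val c2) (e (j t))); rewrite (@to_dirlim_map S c' c2).
have [chi [chiM chi0 chiE]] := jP g; pose C : finGroupType := 'F_p.
have chiM' : monoid.monoid_morphism (chi \o e' : T c -> C).
  apply: (morphism_comp e'M); split; [exact: (addhom1 chiM)|exact: chiM].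
have [|f [fM fE]] := tower_extend_limit la ca chiM'.
  by move=> c2 cc2 _; apply: tower_extend.
exists f; split=> [x y|v|t]; first exact: (morphMg fM).
  rewrite -(@to_dirlim_map S b c') ?fE; last exact: (Order.POrderTheory.ltW bc.1).
  by rewrite -[dir_map _ _]/(tow_map c v) -eE /= eK.
by rewrite fE /= eK.
Qed.

(** The family sends [u] to the diagonal element of a chosen representative. In a relation, take a
    nonzero coefficient at the latest stage: a homomorphism killing that stage and singling out its
    element also kills the terms from earlier stages, so the coefficient is zero. *)
Lemma tower_limit_realizing : realizing K.
Proof.
have [[b0 b0a] _] := la; split.
  have [_ [Ti _] _] := free_pronilpotent_completes_freely (Tf b0a).
  apply: inj_infinite; apply: inj_le_trans (infinite_nat_inj Ti) _.
  have [J [JP _]] := @tower_diagonal 2 (exist _ b0 b0a) isT.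
  exists J => x y e; have [chi [_ _ chiE]] := JP (fun t => (t == x)%:R).
  by have := chiE y; rewrite -e chiE eqxx; case: (y =P x).
move=> p pr; pose J (b : below a) := projT1 (cid (tower_diagonal b pr)).
have JP (b : below a) := projT2 (cid (tower_diagonal b pr)).
pose rep (u : K) := sval (dirlim_surj u).
have repI : injective rep.
  by move=> u v e; rewrite (svalP (dirlim_surj u)) (svalP (dirlim_surj v)) -/(rep u) e.
pose k u := J (tag (rep u)) (tagged (rep u)).
exists k => g; suff [chi h e] : exists2 chi, addhom chi & forall u, chi (k u) = g u.
  by exists chi => //; apply/funext.
apply: addhom_duality => s c us Hs.
suff c0 u : u \in s -> c u = 0.
  by rewrite big_seq big1 // => u /c0 ->; rewrite mul0r.
move=> us0; apply/eqP/negPn/negP => cu.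
have [|m] := @seq_max_ex _ _ _ (fun u => val (tag (rep u))) [seq u <- s | c u != 0] u.
  by rewrite mem_filter cu.
rewrite mem_filter => /andP[cm ms] mmax.
have [chi [chiM chi0 chiE]] := (JP (tag (rep m))).1 (fun t => (t == tagged (rep m))%:R).
have chiN (w : {i & S i}) : tag w = tag (rep m) -> w != rep m ->
    chi (J (tag w) (tagged w)) = 0.
  move: chiE; case: (rep m) w => i y [i' x] /= chiE e; subst i'.
  by rewrite eq_Tagged chiE => /negPf ->.
have := Hs chi chiM; rewrite (bigD1_seq m) //= chiE eqxx mulr1 big_seq_cond big1.
  by rewrite addr0 => /eqP; rewrite (negPf cm).
move=> v /andP[vs vm]; have [cv|cv] := eqVneq (c v) 0; first by rewrite cv mul0r.
have := mmax v; rewrite mem_filter cv vs => /(_ isT).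
rewrite Order.POrderTheory.le_eqVlt => /orP[/eqP /val_inj e|/(JP _).2 vlt]; last first.
  by have [z ez] := vlt (tagged (rep v)); rewrite /k /J ez chi0 mulr0.
have vm' : rep v != rep m by apply: contra vm => /eqP/repI ->.
by rewrite (chiN _ e vm') mulr0.
Qed.

End TowerRealizing.

Theorem theorem24 (G : topGroupType) (hG : free_pronilpotent G)
    (d : Order.disp_t) (W : orderType d)
    (hW : well_order (<=%O : rel W))
    (T : completion_tower G W) (a : W) :
  free_pronilpotent (T a).
Proof.
elim/(well_founded_ind (well_order_wf hW)): a => a IH.
have [[b ba]|nb] := pselect (exists b, (b < a)%O); last first.
  have [|e ei] := @comp_zero _ _ _ T a; last exact: free_pronilpotent_iso ei hG.
  by move=> b; rewrite Order.TotalTheory.leNgt; apply/negP => ba; apply: nb; exists b.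
have [[c ca]|la] := ord_succ_or_limit ba.
  have [e [ei _]] := comp_succ T ca; apply: free_pronilpotent_iso ei _.
  exact/completes_freelyP/free_pronilpotent_completes_freely/(IH _ ca.1).
have [e [ei _]] := comp_limit T la; apply: free_pronilpotent_iso ei _.
have Tf i : completes_freely (tower_below T la i).
  exact/free_pronilpotent_completes_freely/IH/(valP i).
apply: completes_freelyP; split.
- by apply: dirlim_nil_quotients => i; case: (Tf i).
- exact: tower_limit_realizing.
- by move=> p pr; apply: dirlim_p_projective => i; case: (Tf i) => _ _; apply.
Qed.
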